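(* Let $\chi$ be a non-principal Dirichlet character of order $r\geqslant 2$, let $y>0$, $V\geqslant 1$ and $t\geqslant 1$. Put $U=\min(V,\log x)$. Then, as $x\to+\infty$, $$\sum_{n\leqslant x}\mu^2(n)y^{\omega(n)}\Delta_V(n,\chi)^{2t}\gg x\Big((\log x)^{y-1}+(\log x)^{2^ty-t-1}U^{t}+(\log x)^{2^{2t}y/r-2t-1}U^{2t}\Big).$$
   Context: For $n\in\mathbb{N}^*$, an arithmetic function $f$, $u\in\mathbb{R}$, $v\geqslant 0$: $\Delta(n,f,u,v)=\sum_{d\mid n,\ \mathrm{e}^u<d\leqslant \mathrm{e}^{u+v}}f(d)$, and $\Delta_V(n,f)=\sup_{u\in\mathbb{R},\,v\in[0,V]}|\Delta(n,f,u,v)|$. $\mu$ is the Möbius function and $\omega(n)$ the number of distinct prime factors of $n$. *)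

(* Defs.v *)
From mathcomp Require Import all_boot all_order all_algebra.
From mathcomp Require Import complex.
From mathcomp Require Import all_classical all_reals all_analysis.
Set Implicit Arguments.
Unset Strict Implicit.
Unset Printing Implicit Defensive.
Import Order.TTheory GRing.Theory Num.Theory.
Import numFieldNormedType.Exports.
Local Open Scope classical_set_scope.
Local Open Scope complex_scope.
Local Open Scope ring_scope.

Definition omega (n : nat) : nat := size (primes n).

Definition mobius (n : nat) : int :=
  if (0 < n)%N && all (fun p => ~~ (p ^ 2 %| n)%N) (primes n)
  then (-1) ^+ omega n else 0.

Section DirichletCharacter.
Variable R : realType.
Implicit Types (q r : nat) (chi : nat -> R[i]).

(* A character modulo q is given by its values at the natural numbers, which
   determine it on all integers by periodicity. *)
Definition dirichlet_character q chi : Prop :=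
  [/\ (0 < q)%N,
      forall n, chi (n + q)%N = chi n,
      forall m n, chi (m * n)%N = chi m * chi n
    & forall n, (chi n != 0) = coprime n q].

Definition principal_character q : nat -> R[i] := fun n => (coprime n q)%:R.

(* Order in the group of characters modulo q, whose unit is the principal
   character and whose law is the pointwise product. *)
Definition character_order q chi r : Prop :=
  [/\ (0 < r)%N,
      (fun n => chi n ^+ r) =1 principal_character q
    & forall k, (0 < k)%N ->
        (fun n => chi n ^+ k) =1 principal_character q -> (r <= k)%N].

End DirichletCharacter.

Section Delta.
Variable R : realType.
Implicit Types (f : nat -> R[i]) (u v V : R).

Definition Delta (n : nat) f u v : R[i] :=
  \sum_(d <- divisors n | expR u < d%:R <= expR (u + v)) f d.

(* For V >= 0 the set below is nonempty, and it is bounded because Delta takes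
   finitely many values for fixed n and f, so sup is the genuine supremum.
   The norm of R[i] takes its values in R[i], whereas normc is R-valued. *)
Definition DeltaV V (n : nat) f : R :=
  sup [set ComplexField.Normc.normc (Delta n f u v) | u in [set: R] & v in `[0, V]].

End Delta.

(* Main.v *)
(** Write [n = m p] with [m <= N], [N ^ 4] about [x], and [p > N] prime.  A window
    below [m] sees only the divisors of [m], and by Chebyshev there are [>> x / (m log x)]
    such primes, so the moment is [>> x / log x] times a logarithmically weighted
    sum over squarefree [m], whose size is governed by sums of the shape
    [\sum_p h(p) / p].

    The first term only uses [Delta_V >= |chi(1)| = 1].  For the other two, let
    [tau(xi, m) = \sum_(d | m) chi(d) d^(i xi)].  A finite Fourier (large sieve)
    inequality bounds [\sum_k |tau(xi_k, m)|^2], over [xi_k << 1 / U] spaced by about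
    [1 / log x], by [(log x / U)^2 Delta_U(m)^2].  Keeping only [xi = 0] and the [m]
    all of whose prime factors satisfy [chi(p) = 1] gives the third term.  Keeping
    all frequencies, and replacing [a^t] by a linear minorant in [a], reduces the
    second term to means of [|tau(xi, m)|^2], hence to a lower bound, uniform for
    small [xi], of the sum over primes of [Re(chi(p) p^(i xi)) / p].

    This bound follows from [L(1 + i xi, chi) <> 0] near [xi = 0], by Mertens' method.
    That [L(1, chi) <> 0] is proved with [3 + 4 cos + cos 2] when [chi ^ 2] is not
    principal, and otherwise from [\sum_(d | n) chi(d)] being nonnegative and at
    least [1] on squares. *)
Require Import Defs.
From mathcomp Require Import all_boot all_order all_algebra.
From mathcomp Require Import complex.
From mathcomp Require Import all_classical all_reals all_analysis.
From mathcomp Require Import ring lra zify.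
Import Order.TTheory GRing.Theory Num.Theory.
Import numFieldNormedType.Exports.
Local Open Scope classical_set_scope.
Local Open Scope complex_scope.
Local Open Scope ring_scope.
Set Implicit Arguments.
Unset Strict Implicit.
Unset Printing Implicit Defensive.

(** * Mertens and Chebyshev estimates *)

(** One frequency alone costs [(log x / U) ^ 2], but about [log x / U] frequencies share the same
    right-hand side of the large sieve, so their mean costs only [log x / U]. Hence [U ^ t] in the
    second term and [U ^ (2 t)] in the third.

    The exponent [2 ^ t y] comes from a normalisation. Let [a] be the mean of [|tau| ^ 2] over the
    frequencies, divided by [2 ^ omega(m)]; then [y ^ omega] times the [t]-th power of that mean is
    [(2 ^ t y) ^ omega a ^ t]. Under the weight [(2 ^ t y) ^ omega(m) / m] the mean of [a] is
    bounded below, because for [p] prime to [q] the factor [|1 + chi(p) p ^ (i xi)| ^ 2 / 2] is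
    [1 + Re(chi(p) p ^ (i xi))], which is [1] on average over primes. A linear minorant vanishing at
    a small constant then loses only a constant factor, without any higher moment of [a].

    [L(1 + i xi, chi)] occurs only through its partial sums, and the constants must not depend on
    [xi]. The exponent in [N ^ 4] leaves [N ^ 3 <= x / m], so that primes up to [N] are negligible
    among those up to [x / m], while [log N] keeps the order of [log x]. *)

Lemma ler_sum_subset (R : numDomainType) (T : eqType) (s r : seq T) (F : T -> R) :
  uniq s -> uniq r -> {subset s <= r} -> (forall i, i \in r -> 0 <= F i) ->
  \sum_(i <- s) F i <= \sum_(i <- r) F i.
Proof.
move=> us ur sr F0; rewrite [leRHS](bigID (mem s)) /= -[leLHS]addr0; apply: lerD.
  rewrite -[leRHS]big_filter le_eqVlt; apply/orP; left; apply/eqP.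
  apply: perm_big; apply: uniq_perm; rewrite ?filter_uniq// => i.
  by rewrite mem_filter andb_idr// => /sr.
by rewrite big_seq_cond sumr_ge0// => i /andP[ir _]; exact: F0.
Qed.

Section LogFacts.
Variable R : realType.
Implicit Types (m n N : nat).

Lemma ln_natS_ub n : (0 < n)%N -> ln n.+1%:R - ln n%:R <= n%:R^-1 :> R.
Proof.
move=> n0; have n0' : 0 < n%:R :> R by rewrite ltr0n.
have -> : n.+1%:R = n%:R * (1 + n%:R^-1) :> R.
  by rewrite mulrDr mulr1 divff ?gt_eqF// -natr1.
have i0 : 0 < n%:R^-1 :> R by rewrite invr_gt0.
rewrite lnM ?posrE ?addr_gt0//.
rewrite addrAC subrr add0r le_ln1Dx//.
by rewrite (lt_trans (ltrN10 _))// invr_gt0.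
Qed.

Lemma ln_natS_lb n : (0 < n)%N -> n.+1%:R^-1 <= ln n.+1%:R - ln n%:R :> R.
Proof.
move=> n0; have n0' : 0 < n%:R :> R by rewrite ltr0n.
have n1' : 0 < n.+1%:R :> R by rewrite ltr0n.
have -> : ln n%:R = ln n.+1%:R + ln (1 - n.+1%:R^-1) :> R.
  rewrite -lnM ?posrE// ?subr_gt0 ?invf_lt1//; last by rewrite ltr1n ltnS.
  by rewrite mulrBr mulr1 divff ?gt_eqF// -natr1 addrK.
have : ln (1 - n.+1%:R^-1) <= - n.+1%:R^-1 :> R.
  by apply: le_ln1Dx; rewrite ltrN2 invf_lt1// ltr1n ltnS.
by rewrite opprD addrA subrr add0r lerNr.
Qed.

Lemma ln_nat_ge0 n : 0 <= ln n%:R :> R.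
Proof.
case: n => [|n]; first by rewrite ln0.
by rewrite ln_ge0// ler1n.
Qed.

Lemma ln_nat_le m n : (0 < m)%N -> (m <= n)%N -> ln m%:R <= ln n%:R :> R.
Proof.
by move=> m0 mn; rewrite ler_ln ?posrE ?ltr0n ?ler_nat// (leq_trans m0).
Qed.

Lemma ln_natM m n : (0 < m)%N -> (0 < n)%N ->
  ln (m * n)%:R = ln m%:R + ln n%:R :> R.
Proof. by move=> m0 n0; rewrite natrM lnM// posrE ltr0n. Qed.

(** Discrete form of the fact that [- (ln x + 2) / x] is a primitive of [(ln x + 1) / x ^ 2]. *)
Lemma log_over_square_telescope n : (0 < n)%N ->
  (ln n%:R + 1) / (n%:R * n.+1%:R) <=
  (ln n%:R + 2) / n%:R - (ln n.+1%:R + 2) / n.+1%:R :> R.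
Proof.
move=> n0; have n0' : 0 < n%:R :> R by rewrite ltr0n.
have n1' : 0 < n.+1%:R :> R by rewrite ltr0n.
have h := ln_natS_ub n0.
have h2 : n%:R * (ln n.+1%:R - ln n%:R) <= 1 :> R.
  by rewrite mulrC -ler_pdivlMr// div1r.
have -> : (ln n%:R + 2) / n%:R - (ln n.+1%:R + 2) / n.+1%:R
   = (n.+1%:R * (ln n%:R + 2) - n%:R * (ln n.+1%:R + 2)) / (n%:R * n.+1%:R) :> R.
  by field; rewrite !gt_eqF.
rewrite ler_pM2r ?invr_gt0 ?mulr_gt0//.
move: h2; rewrite -(natr1 n); move: (ln n%:R) (ln (n%:R + 1)) => a b; nra.
Qed.

Lemma sum_log_over_square N :
  \sum_(1 <= n < N.+1) (ln n%:R + 1) / (n%:R * n.+1%:R) <= 2 :> R.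
Proof.
apply: (@le_trans _ _ (2 - (ln N.+1%:R + 2) / N.+1%:R)).
  elim: N => [|N IH]; first by rewrite big_geq// ln1 add0r divr1 subrr.
  have aux (a b c d : R) : a <= 2 - b -> c <= b - d -> a + c <= 2 - d by lra.
  by rewrite big_nat_recr//=; apply: (aux _ _ _ _ IH); apply: log_over_square_telescope.
by rewrite gerBl divr_ge0// addr_ge0// ln_nat_ge0.
Qed.

Lemma ln_fact_lb N : (0 < N)%N ->
  N%:R * ln N%:R - N%:R <= ln (N`!)%:R :> R.
Proof.
case: N => // N _; elim: N => [|N IH]; first by rewrite ln1; lra.
rewrite factS ln_natM ?fact_gt0//.
have := @ln_natS_ub N.+1 isT.
have n0' : 0 < N.+1%:R :> R by rewrite ltr0n.
rewrite -[_^-1]div1r ler_pdivlMr// => h.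
move: IH h; rewrite -[N.+2%:R]natr1; move: (ln (N.+1%:R + 1)) (ln N.+1%:R) => a b; nra.
Qed.

Lemma ln_fact_ub N : (0 < N)%N -> ln (N`!)%:R <= N%:R * ln N%:R :> R.
Proof.
move=> N0; have : (N`! <= N ^ N)%N.
  elim: N {N0} => // N IH; rewrite factS expnS leq_mul2l /=.
  by rewrite (leq_trans IH)//; case: N {IH} => // N; rewrite leq_exp2r.
move=> h; apply: (le_trans (ln_nat_le (fact_gt0 N) h)).
by rewrite natrX lnXn ?ltr0n// mulr_natl.
Qed.

End LogFacts.

Section PrimeSums.
Variable R : realType.
Implicit Types (m n N p k d : nat).

Lemma big_nat_recr_cond (T : Type) (idx : T) (op : Monoid.law idx) m n
    (P : pred nat) (F : nat -> T) : (m <= n)%N ->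
  \big[op/idx]_(m <= i < n.+1 | P i) F i =
  op (\big[op/idx]_(m <= i < n | P i) F i) (if P n then F n else idx).
Proof. by move=> mn; rewrite big_mkcond big_nat_recr// -big_mkcond. Qed.

Lemma prod_primes_dvd m n N :
  (forall p, (m <= p < n)%N -> prime p -> p %| N)%N ->
  (\prod_(m <= p < n | prime p) p %| N)%N.
Proof.
elim: n => [|n IH] h; first by rewrite big_geq.
have [mn|nm] := leqP m n; last by rewrite big_geq.
rewrite big_nat_recr_cond//=; case: ifPn => pn; last first.
  by rewrite muln1; apply: IH => p /andP[mp pn']; apply: h; rewrite mp ltnS ltnW.
rewrite Gauss_dvd ?IH ?h ?mn ?ltnSn//.
  by move=> p /andP[mp pn']; apply: h; rewrite mp ltnS ltnW.
rewrite coprime_sym big_nat_cond.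
apply: (big_ind (fun x => coprime n x)) => [|x y|p].
- exact: coprimen1.
- by rewrite coprimeMr => -> ->.
- case/andP=> /andP[_ pn'] pp; rewrite prime_coprime// dvdn_prime2//.
  by rewrite gtn_eqF.
Qed.

Lemma prime_dvd_fact p n : prime p -> (p %| n`!)%N -> (p <= n)%N.
Proof.
move=> pp; elim: n => [|n IH]; first by rewrite Euclid_dvd1.
by rewrite factS Euclid_dvdM// => /orP[/dvdn_leq->//|/IH/leqW].
Qed.

(** Erdos's argument: the primes in [(m + 1, 2 m + 1]] divide ['C(2 m + 1, m)], which occurs twice
    in the expansion of [(1 + 1) ^ (2 m + 1)] and so is at most [4 ^ m]. An even number above [2]
    adds no prime. *)
Lemma primorial_ub n : (\prod_(1 <= p < n.+1 | prime p) p <= 4 ^ n)%N.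
Proof.
have [k] := ubnP n; elim: k n => // k IH [|n]; first by rewrite big_geq.
rewrite ltnS => nk.
have [n_odd|n_even] := boolP (odd n).
  rewrite big_nat_recr_cond//=; case: ifPn => pn; last first.
    by rewrite muln1 (leq_trans (IH _ nk))// leq_exp2l.
  have : n.+1 = 2%N.
    by apply/eqP; rewrite eq_sym -dvdn_prime2// dvdn2 /= n_odd.
  by case=> n1; rewrite n1 big_mkcond big_nat1.
case: n n_even nk => [|n] n_even nk; first by rewrite big_mkcond big_nat1.
have [m nE] : exists m, n.+1 = m.*2.
  by exists n.+1./2; rewrite even_halfK.
have m0 : (0 < m)%N by case: m nE => //.
rewrite nE (@big_cat_nat _ _ _ m.+2)//=; last by rewrite ltnS -addnn; lia.
have -> : (4 ^ m.*2.+1 = 4 ^ m.+1 * 4 ^ m)%N.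
  by rewrite -expnD; congr (_ ^ _)%N; lia.
apply: leq_mul; first by apply: IH; lia.
apply: (@leq_trans 'C(m.*2.+1, m)).
  apply: dvdn_leq; first by rewrite bin_gt0; lia.
  apply: prod_primes_dvd => p /andP[mp pm] pp.
  have : (p %| (m.*2.+1)`!)%N by rewrite dvdn_fact// prime_gt0//=; lia.
  rewrite -(@bin_fact _ m); last by lia.
  rewrite !Euclid_dvdM// => /or3P[//|h|h].
  - by move/(prime_dvd_fact pp): h; lia.
  - by move/(prime_dvd_fact pp): h; lia.
rewrite -(leq_pmul2l (isT : 0 < 2)%N).
have -> : (2 * 4 ^ m = 2 ^ m.*2.+1)%N.
  by rewrite expnS -mul2n expnM.
rewrite -[(2 ^ _)%N]/((1 + 1) ^ _)%N expnDn.
have mm : (m < m.*2.+2)%N by lia.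
have mm1 : (m.+1 < m.*2.+2)%N by lia.
rewrite (bigD1 (Ordinal mm))//= (bigD1 (Ordinal mm1))//=; last first.
  by rewrite -val_eqE /= gtn_eqF.
rewrite !exp1n !muln1 addnA.
have -> : 'C(m.*2.+1, m.+1) = 'C(m.*2.+1, m).
  rewrite -bin_sub; last by lia.
  by congr 'C(_, _); lia.
by rewrite mul2n addnn leq_addr.
Qed.

Lemma ln_prodn (I : Type) (r : seq I) (P : pred I) (F : I -> nat) :
  (forall i, P i -> 0 < F i)%N ->
  ln (\prod_(i <- r | P i) F i)%N%:R = \sum_(i <- r | P i) ln (F i)%:R :> R.
Proof.
move=> F0; elim: r => [|i r IH]; first by rewrite !big_nil ln1.
rewrite !big_cons; case: ifPn => // Pi.
by rewrite ln_natM ?F0// ?IH// prodn_cond_gt0.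
Qed.

Lemma sum_ln_primes_ub N :
  \sum_(1 <= p < N.+1 | prime p) ln p%:R <= 2 * N%:R :> R.
Proof.
rewrite -ln_prodn; last by move=> p /prime_gt0.
have h : (0 < \prod_(1 <= p < N.+1 | prime p) p)%N.
  by rewrite prodn_cond_gt0// => p /prime_gt0.
apply: (le_trans (ln_nat_le R h (primorial_ub N))).
rewrite natrX lnXn ?ltr0n// -[leLHS]mulr_natr ler_wpM2r//.
have -> : 4 = 2 ^+ 2 :> R by rewrite -natrX.
rewrite lnXn ?ltr0n//.
have := @ln_natS_ub R 1 isT; rewrite ln1 subr0 invr1; lra.
Qed.

Lemma sum_prime_powers_dvd p n N : prime p -> (0 < n <= N)%N ->
  (\sum_(1 <= k < N.+1) (p ^ k %| n) = logn p n)%N.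
Proof.
move=> pp /andP[n0 nN].
have lN : (logn p n <= N)%N.
  by rewrite (leq_trans _ nN)// ltnW// ltn_logl.
rewrite (@big_cat_nat _ _ _ (logn p n).+1)//=.
rewrite [X in (_ + X)%N]big_nat_cond [X in (_ + X)%N]big1 ?addn0; last first.
  by move=> k /andP[/andP[lk _] _]; rewrite pfactor_dvdn// leqNgt lk.
rewrite big_nat_cond (eq_bigr (fun=> 1%N)); last first.
  by move=> k /andP[/andP[_ kl] _]; rewrite pfactor_dvdn// -ltnS kl.
by rewrite -big_nat_cond sum_nat_const_nat subn1 muln1.
Qed.

(** The identity of [log] with the divisor sum of the von Mangoldt function. The common bound [N] on
    [p] and [k] makes the ranges independent of [n], so that sums over [n] can be exchanged with
    it. *)
Lemma ln_prime_powers n N : (0 < n <= N)%N ->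
  ln n%:R = \sum_(1 <= p < N.+1 | prime p) \sum_(1 <= k < N.+1)
              (p ^ k %| n)%:R * ln p%:R :> R.
Proof.
move=> nN; have /andP[n0 n_le] := nN.
have -> : ln n%:R = ln (\prod_(0 <= p < N.+1) p ^ logn p n)%N%:R :> R.
  by rewrite -(@widen_partn N predT n n_le) partnT.
rewrite ln_prodn; last first.
  by move=> [|p] _; [rewrite lognE | rewrite expn_gt0].
rewrite big_nat_recl// lognE /= ln1 add0r big_add1 /=.
rewrite [LHS](bigID (fun p => prime p.+1)) /= addrC big1 ?add0r; last first.
  by move=> p /negPf pp; rewrite lognE pp /= ln1.
apply: eq_bigr => p pp; rewrite -mulr_suml -natr_sum sum_prime_powers_dvd//.
by rewrite natrX lnXn ?ltr0n ?prime_gt0// mulr_natl.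
Qed.

Lemma sum_multiples (V : nmodType) (g : nat -> V) d N : (0 < d)%N ->
  \sum_(1 <= n < N.+1 | (d %| n)%N) g n = \sum_(1 <= j < (N %/ d).+1) g (d * j)%N.
Proof.
move=> d0; elim: N => [|N IH]; first by rewrite div0n !big_geq.
rewrite big_nat_recr_cond//= IH divnS//; case: ifPn => dN /=; last first.
  by rewrite addr0 add0n.
rewrite add1n [RHS]big_nat_recr//=; congr (_ + g _).
rewrite -[in LHS](divnK dN) mulnC; congr (_ * _)%N.
by rewrite divnS// dN.
Qed.

(** The morphism [phi] lets one statement serve both the logarithm of a factorial, with real
    coefficients all equal to [1], and complex character sums. *)
Lemma sum_mul_ln (K : nzRingType) (phi : {rmorphism R -> K}) (g : nat -> K) N :
  \sum_(1 <= n < N.+1) g n * phi (ln n%:R) =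
  \sum_(1 <= p < N.+1 | prime p) \sum_(1 <= k < N.+1)
    (\sum_(1 <= j < (N %/ p ^ k).+1) g (p ^ k * j)%N) * phi (ln p%:R).
Proof.
under eq_big_nat => n nN do
  rewrite (@ln_prime_powers n N)// rmorph_sum mulr_sumr.
rewrite exchange_big_nat; apply: eq_bigr => p pp.
under eq_big_nat => n nN do rewrite rmorph_sum mulr_sumr.
rewrite exchange_big_nat; apply: eq_bigr => k _.
rewrite -sum_multiples ?expn_gt0 ?prime_gt0// mulr_suml [RHS]big_mkcond /=.
apply: eq_bigr => n _; rewrite rmorphM rmorph_nat; case: ifP => _.
  by rewrite mul1r.
by rewrite mul0r mulr0.
Qed.

Lemma sum_inv_powers_ub (a : R) M : 1 < a ->
  \sum_(2 <= k < M) (a ^+ k)^-1 <= (a * (a - 1))^-1.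
Proof.
move=> a1; have a0 : 0 < a by apply: lt_trans a1.
have a10 : 0 < a - 1 by rewrite subr_gt0.
have [M2|M2] := leqP M 2; first by rewrite big_geq// invr_ge0 mulr_ge0 ?ltW.
apply: (@le_trans _ _ ((a * (a - 1))^-1 - (a ^+ M.-1 * (a - 1))^-1)); last first.
  by rewrite gerBl invr_ge0 mulr_ge0// ?exprn_ge0 ?ltW.
case: M M2 => [|[|M]]// _; elim: M => [|M IH].
  by rewrite big_geq// expr1 subrr.
rewrite big_nat_recr//=; apply: (le_trans (lerD IH (lexx _))).
rewrite le_eqVlt; apply/orP; left; apply/eqP.
rewrite -pred_Sn [a ^+ M.+2]exprS /=.
by field; rewrite !gt_eqF// ?exprn_gt0.
Qed.

(** For [p = n + 1] the geometric series over [k] is at most [ln p / (p (p - 1))], and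
    [ln (n + 1) <= ln n + 1] bounds this by a term of [sum_log_over_square]. *)
Lemma sum_prime_powers_tail N :
  \sum_(1 <= p < N.+1 | prime p) \sum_(2 <= k < N.+1)
     ln p%:R / (p ^ k)%:R <= 2 :> R.
Proof.
apply: (le_trans _ (@sum_log_over_square R N)).
case: N => [|N]; first by rewrite !big_geq.
rewrite big_mkcond big_ltn//= add0r big_add1 /= [leRHS]big_nat_recr//=.
apply: ler_wpDr.
  by rewrite divr_ge0// addr_ge0// ln_nat_ge0.
apply: ler_sum_nat => n /andP[n0 _]; case: ifPn => pn; last first.
  by rewrite divr_ge0// addr_ge0// ln_nat_ge0.
under eq_bigr do rewrite natrX.
rewrite -mulr_sumr.
have n1 : 1 < n.+1%:R :> R by rewrite ltr1n ltnS.
apply: (@le_trans _ _ (ln n.+1%:R * (n.+1%:R * (n.+1%:R - 1))^-1)).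
  by rewrite ler_wpM2l ?ln_nat_ge0// sum_inv_powers_ub.
rewrite -[X in (_ * (X - 1))^-1]natr1 addrK [(_ * n%:R)]mulrC.
rewrite ler_wpM2r ?invr_ge0//.
have := ln_natS_ub R n0; have : n%:R^-1 <= 1 :> R by rewrite invf_le1 ?ltr0n// ler1n.
by move: (n%:R^-1) => z; lra.
Qed.

End PrimeSums.

Section Mertens.
Variable R : realType.
Implicit Types (m n N p k d : nat).

Lemma natdiv_le N d : (N %/ d)%:R <= N%:R / d%:R :> R.
Proof.
case: d => [|d]; first by rewrite divn0 invr0 mulr0.
by rewrite ler_pdivlMr ?ltr0n// -natrM ler_nat leq_trunc_div.
Qed.

Lemma natdiv_ge N d : (0 < d)%N -> N%:R / d%:R <= (N %/ d)%:R + 1 :> R.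
Proof.
by move=> d0; rewrite natr1 ler_pdivrMr ?ltr0n// -natrM ler_nat ltnW// ltn_ceil.
Qed.

Lemma ln_fact N : ln (N`!)%:R = \sum_(1 <= n < N.+1) ln n%:R :> R.
Proof.
elim: N => [|N IH]; first by rewrite big_geq// ln1.
by rewrite factS ln_natM ?fact_gt0// big_nat_recr//= IH addrC.
Qed.

Lemma ln_fact_primes N : ln (N`!)%:R = \sum_(1 <= p < N.+1 | prime p)
  \sum_(1 <= k < N.+1) (N %/ p ^ k)%:R * ln p%:R :> R.
Proof.
rewrite ln_fact; have := @sum_mul_ln R R idfun (fun=> 1) N.
under eq_bigr do rewrite mul1r.
move=> /= ->; apply: eq_bigr => p _; apply: eq_bigr => k _.
by rewrite sumr_const_nat subSS subn0.
Qed.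

(** In Legendre's formula for [ln N!] only [k = 1] is kept. Rounding [N %/ p] up to [N / p] costs at
    most [\sum_p ln p <= 2 N], by the primorial bound. *)
Lemma mertens1_ub N : (0 < N)%N ->
  \sum_(1 <= p < N.+1 | prime p) ln p%:R / p%:R <= ln N%:R + 2 :> R.
Proof.
move=> N0; have N0' : 0 < N%:R :> R by rewrite ltr0n.
rewrite -(ler_pM2l N0') mulr_sumr.
apply: (@le_trans _ _ (\sum_(1 <= p < N.+1 | prime p) ((N %/ p)%:R * ln p%:R + ln p%:R))).
  apply: ler_sum => p pp; rewrite -[X in _ + X]mul1r -mulrDl mulrCA mulrC.
  by rewrite ler_wpM2r ?ln_nat_ge0// natdiv_ge// prime_gt0.
rewrite big_split /= mulrDr; apply: lerD; last first.
  by rewrite mulrC sum_ln_primes_ub.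
apply: le_trans (ln_fact_ub R N0).
rewrite ln_fact_primes; apply: ler_sum => p pp.
rewrite big_ltn ?ltnS// expn1 lerDl sumr_ge0// => k _.
by rewrite mulr_ge0// ln_nat_ge0.
Qed.

Lemma mertens1_lb N : (0 < N)%N ->
  ln N%:R - 3 <= \sum_(1 <= p < N.+1 | prime p) ln p%:R / p%:R :> R.
Proof.
move=> N0; have N0' : 0 < N%:R :> R by rewrite ltr0n.
rewrite -(ler_pM2l N0').
suff h : ln (N`!)%:R <= N%:R * (\sum_(1 <= p < N.+1 | prime p) ln p%:R / p%:R + 2) :> R.
  have := le_trans (ln_fact_lb R N0) h; lra.
rewrite ln_fact_primes.
apply: (@le_trans _ _ (N%:R * (\sum_(1 <= p < N.+1 | prime p)
    (ln p%:R / p%:R + \sum_(2 <= k < N.+1) ln p%:R / (p ^ k)%:R)))).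
  rewrite mulr_sumr; apply: ler_sum => p pp.
  rewrite big_ltn ?ltnS// expn1 mulrDr; apply: lerD.
    by rewrite [leRHS]mulrCA [leRHS]mulrC ler_wpM2r ?ln_nat_ge0// natdiv_le.
  rewrite mulr_sumr; apply: ler_sum => k _.
  by rewrite [leRHS]mulrCA [leRHS]mulrC ler_wpM2r ?ln_nat_ge0// natdiv_le.
rewrite big_split /= ler_pM2l// lerD2l; exact: sum_prime_powers_tail.
Qed.

Lemma ln2_ge_half : 2^-1 <= ln 2 :> R.
Proof. by have := @ln_natS_lb R 1 isT; rewrite ln1 subr0. Qed.

(** The two Mertens bounds are [5] apart, so [ln A >= 6] leaves at least [1] for the sum of
    [ln p / p] over [M < p <= N], with [M = N %/ A]. Each of its terms is at most [ln N / M]. *)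
Lemma chebyshev_lb : exists2 C : R, 0 < C & exists N0, forall N, (N0 <= N)%N ->
  N%:R <= C * ln N%:R * (\sum_(1 <= p < N.+1 | prime p) 1).
Proof.
have [A [A0 lnA]] : exists A, (0 < A)%N /\ 6 <= ln A%:R :> R.
  exists (2 ^ 12)%N; split; first by rewrite expn_gt0.
  rewrite natrX lnXn ?ltr0n// -mulr_natr.
  have := ln2_ge_half; lra.
exists (2 * A%:R); first by rewrite mulr_gt0 ?ltr0n.
exists A => N AN; pose M := (N %/ A)%N.
have M0 : (0 < M)%N by rewrite divn_gt0.
have MN : (M <= N)%N by rewrite leq_div.
have N0 : (0 < N)%N by rewrite (leq_trans M0).
have lnM : ln M%:R + ln A%:R <= ln N%:R :> R.
  by rewrite -ln_natM// ln_nat_le// ?muln_gt0 ?M0// leq_trunc_div.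
have h1 := mertens1_ub M0; have h2 := mertens1_lb N0.
have M0' : 0 < M%:R :> R by rewrite ltr0n.
have h3 : 1 <= \sum_(M.+1 <= p < N.+1 | prime p) ln p%:R / p%:R :> R.
  by move: h2; rewrite (@big_cat_nat _ _ _ M.+1)//=; move: h1; lra.
have h4 : M%:R <= ln N%:R * \sum_(1 <= p < N.+1 | prime p) 1 :> R.
  apply: (le_trans (ler_peMr (ltW M0') h3)); rewrite !mulr_sumr.
  rewrite [leRHS](@big_cat_nat _ _ _ M.+1)//=; apply: ler_wpDl.
    by rewrite sumr_ge0// => p _; rewrite mulr1 ln_nat_ge0.
  rewrite big_nat_cond [leRHS]big_nat_cond; apply: ler_sum => p /andP[/andP[Mp pN] pp].
  have p0 : 0 < p%:R :> R by rewrite ltr0n prime_gt0.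
  rewrite mulr1 mulrCA -[leRHS]mulr1; apply: ler_pM => //.
  - exact: ln_nat_ge0.
  - by rewrite ln_nat_le ?prime_gt0.
  - by rewrite ler_pdivrMr// mul1r ler_nat ltnW.
have h5 : N%:R <= A%:R * (2 * M%:R) :> R.
  rewrite -ler_pdivrMl ?ltr0n// mulrC (le_trans (natdiv_ge _ A0))//.
  have : 1 <= M%:R :> R by rewrite ler1n.
  by rewrite -/M; lra.
apply: (le_trans h5).
by rewrite mulrCA -!mulrA !ler_pM2l ?ltr0n.
Qed.

Lemma abel_sum (K : nzRingType) (a w : nat -> K) m N : (m <= N)%N ->
  \sum_(m <= n < N.+1) a n * w n =
  (\sum_(m <= n < N.+1) a n) * w N +
  \sum_(m <= n < N) (\sum_(m <= k < n.+1) a k) * (w n - w n.+1).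
Proof.
elim: N => [|N IH].
  by rewrite leqn0 => /eqP ->; rewrite !big_nat1 big_geq// addr0.
rewrite leq_eqVlt => /predU1P[->|]; first by rewrite !big_nat1 big_geq// addr0.
rewrite ltnS => mN; rewrite big_nat_recr ?leqW//= IH//.
rewrite [in RHS]big_nat_recr ?leqW//= [X in _ = _ + X]big_nat_recr//=.
rewrite mulrDl mulrBr; set x := \sum_(_ <= _ < _) _; set y := \sum_(_ <= _ < _) _.
by rewrite [RHS]addrC addrA -[y + _ + _]addrA subrK [y + _]addrC.
Qed.

Lemma primes_from2 (K : nmodType) (F : nat -> K) N :
  \sum_(1 <= p < N.+1 | prime p) F p =
  \sum_(2 <= p < N.+1) if prime p then F p else 0.
Proof.
rewrite [LHS]big_mkcond; case: N => [|N]; first by rewrite !big_geq.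
by rewrite big_ltn//= add0r.
Qed.

Lemma ln_nat_gt0 n : (1 < n)%N -> 0 < ln n%:R :> R.
Proof. by move=> n1; rewrite ln_gt0// ltr1n. Qed.

Lemma inv_ln_decr n : (1 < n)%N -> 0 <= (ln n%:R)^-1 - (ln n.+1%:R)^-1 :> R.
Proof.
move=> n1; rewrite subr_ge0 lef_pV2 ?posrE ?ln_nat_gt0 ?ln_nat_le//; lia.
Qed.

Lemma sum_inv_ln_decr N : (1 < N)%N ->
  \sum_(2 <= n < N) ((ln n%:R)^-1 - (ln n.+1%:R)^-1)
    = (ln 2%:R)^-1 - (ln N%:R)^-1 :> R.
Proof.
move=> N1; have := telescope_sumr (fun n => - (ln n%:R)^-1 : R) N1.
rewrite opprK addrC => <-; apply: eq_bigr => n _; by rewrite opprK addrC.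
Qed.

(** With [a = ln n] and [b = ln (n + 1)], this is [1 - a / b <= ln (b / a) <= b / a - 1] combined
    with [b - a <= 1]. It turns the terms of the Abel summation into increments of [ln ln], up to an
    error that telescopes. *)
Lemma lnln_increment n : (1 < n)%N ->
  forall d e : R, d = ln (ln n.+1%:R) - ln (ln n%:R) ->
  e = (ln n%:R)^-1 - (ln n.+1%:R)^-1 ->
  d - e <= ln n%:R * e <= d.
Proof.
move=> n1 d e d_def e_def.
have l0 := ln_nat_gt0 n1; have l1 := ln_nat_gt0 (leqW n1).
have l01 : ln n%:R <= ln n.+1%:R :> R by rewrite ln_nat_le// ltnW.
have l2 : ln n.+1%:R - ln n%:R <= 1 :> R.
  apply: le_trans (ln_natS_ub R (ltnW n1)) _.
  by rewrite invf_le1 ?ltr0n ?ler1n ltnW.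
have dE : d = ln (ln n.+1%:R / ln n%:R) by rewrite d_def ln_div.
have dE' : d = - ln (ln n%:R / ln n.+1%:R) by rewrite d_def ln_div// opprB.
rewrite e_def; move: l0 l1 l01 l2 dE dE' {d_def e_def}.
move: (ln n%:R) (ln n.+1%:R) => a b a0 b0 ab ab1 dE dE'.
have aV : 0 < a^-1 by rewrite invr_gt0.
have bV : 0 < b^-1 by rewrite invr_gt0.
have h1 : d <= b / a - 1.
  rewrite dE; have := @le_ln1Dx R (b / a - 1); rewrite addrCA subrr addr0; apply.
  by rewrite ltrBrDr addNr mulr_gt0.
have h2 : 1 - a / b <= d.
  rewrite dE' lerNr; have := @le_ln1Dx R (a / b - 1).
  rewrite addrCA subrr addr0 opprB; apply.
  by rewrite ltrBrDr addNr mulr_gt0.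
rewrite mulrBr divff ?gt_eqF// h2 andbT.
have h3 : (b - a) * (a^-1 - b^-1) <= a^-1 - b^-1.
  by rewrite ler_piMl// subr_ge0 lef_pV2.
move: h1 h3; rewrite !mulrBr !mulrBl !divff ?gt_eqF//.
by move: (b / a) (a / b) => u v; lra.
Qed.

Lemma sum_inv_primes_abel N : (1 < N)%N ->
  \sum_(1 <= p < N.+1 | prime p) p%:R^-1 =
  (\sum_(1 <= p < N.+1 | prime p) ln p%:R / p%:R) * (ln N%:R)^-1 +
  \sum_(2 <= n < N) (\sum_(1 <= p < n.+1 | prime p) ln p%:R / p%:R) *
     ((ln n%:R)^-1 - (ln n.+1%:R)^-1) :> R.
Proof.
move=> N1; rewrite !primes_from2.
under [X in _ = _ + X]eq_bigr do rewrite primes_from2.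
rewrite -abel_sum//; apply: eq_big_nat => p /andP[p1 _]; case: ifPn => pp.
  by rewrite mulrAC divff ?mul1r// gt_eqF// ln_nat_gt0.
by rewrite mul0r.
Qed.

Lemma mertens2_ub : exists C : R, forall N, (1 < N)%N ->
  \sum_(1 <= p < N.+1 | prime p) p%:R^-1 <= ln (ln N%:R) + C.
Proof.
exists (1 + 2 * (ln 2)^-1 - ln (ln 2)) => N N1.
rewrite sum_inv_primes_abel//.
have N0 := ln_nat_gt0 N1; have N0' := ltnW N1.
apply: (@le_trans _ _ ((ln N%:R + 2) * (ln N%:R)^-1 +
   \sum_(2 <= n < N) ((ln (ln n.+1%:R) - ln (ln n%:R)) +
     2 * ((ln n%:R)^-1 - (ln n.+1%:R)^-1)))).
  apply: lerD.
    by rewrite ler_wpM2r ?mertens1_ub ?invr_ge0 ?ltW.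
  apply: ler_sum_nat => n /andP[n1 _].
  have /andP[_ h] := lnln_increment n1 erefl erefl.
  apply: (le_trans (y := (ln n%:R + 2) * ((ln n%:R)^-1 - (ln n.+1%:R)^-1))).
    by rewrite ler_wpM2r ?inv_ln_decr ?mertens1_ub// ltnW.
  by rewrite mulrDl lerD2r.
rewrite big_split /= -mulr_sumr sum_inv_ln_decr// telescope_sumr//.
rewrite mulrDl divff ?gt_eqF//.
have : 0 < (ln N%:R)^-1 :> R by rewrite invr_gt0.
lra.
Qed.

Lemma mertens2_lb : exists C : R, forall N, (1 < N)%N ->
  ln (ln N%:R) - C <= \sum_(1 <= p < N.+1 | prime p) p%:R^-1.
Proof.
exists (4 * (ln 2)^-1 + ln (ln 2)) => N N1.
rewrite sum_inv_primes_abel//.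
have N0 := ln_nat_gt0 N1; have N0' := ltnW N1.
apply: (@le_trans _ _ ((ln N%:R - 3) * (ln N%:R)^-1 +
   \sum_(2 <= n < N) ((ln (ln n.+1%:R) - ln (ln n%:R)) -
     4 * ((ln n%:R)^-1 - (ln n.+1%:R)^-1)))); last first.
  apply: lerD.
    by rewrite ler_wpM2r ?mertens1_lb ?invr_ge0 ?ltW.
  apply: ler_sum_nat => n /andP[n1 _].
  have /andP[h _] := lnln_increment n1 erefl erefl.
  apply: (le_trans (y := (ln n%:R - 3) * ((ln n%:R)^-1 - (ln n.+1%:R)^-1))); last first.
    by rewrite ler_wpM2r ?inv_ln_decr ?mertens1_lb// ltnW.
  by rewrite mulrBl; move: h; lra.
rewrite big_split /= sumrN -mulr_sumr sum_inv_ln_decr// telescope_sumr//.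
rewrite mulrBl divff ?gt_eqF//.
have : 0 < (ln N%:R)^-1 :> R by rewrite invr_gt0.
lra.
Qed.

End Mertens.

(** * Character sums twisted by [n ^ (i xi)] *)

Notation cnorm := ComplexField.Normc.normc.
Notation cre := complex.Re.
Notation cim := complex.Im.

Section ComplexNorm.
Variable R : realType.
Implicit Types (z w : R[i]) (x : R).

Lemma cnorm_ge0 z : 0 <= cnorm z.
Proof. by case: z => a b; rewrite sqrtr_ge0. Qed.

Lemma cnorm0 : cnorm (0 : R[i]) = 0.
Proof. exact: ComplexField.Normc.normc0. Qed.

Lemma cnorm1 : cnorm (1 : R[i]) = 1.
Proof. exact: ComplexField.Normc.normc1. Qed.

Lemma cnormM z w : cnorm (z * w) = cnorm z * cnorm w.
Proof. exact: ComplexField.Normc.normcM. Qed.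

Lemma cnormV z : cnorm z^-1 = (cnorm z)^-1.
Proof. exact: ComplexField.Normc.normcV. Qed.

Lemma cnormD z w : cnorm (z + w) <= cnorm z + cnorm w.
Proof. exact: le_normcD. Qed.

Lemma cnormN z : cnorm (- z) = cnorm z.
Proof. by case: z => a b; rewrite /= !sqrrN. Qed.

Lemma cnormB z w : cnorm (z - w) <= cnorm z + cnorm w.
Proof. by rewrite -[cnorm w]cnormN cnormD. Qed.

Lemma cnorm_distC z w : cnorm (z - w) = cnorm (w - z).
Proof. by rewrite -cnormN opprB. Qed.

Lemma cnorm_subr_le z w : cnorm z - cnorm w <= cnorm (z - w).
Proof. by rewrite lerBlDr; apply: le_trans (cnormD _ _); rewrite subrK. Qed.

Lemma cnormX z n : cnorm (z ^+ n) = cnorm z ^+ n.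
Proof. by elim: n => [|n IH]; rewrite ?expr0 ?cnorm1// !exprS cnormM IH. Qed.

Lemma cnorm_real x : cnorm x%:C = `|x|.
Proof. by rewrite /= expr0n /= addr0 sqrtr_sqr. Qed.

Lemma cnorm_nat n : cnorm (n%:R : R[i]) = n%:R.
Proof. by rewrite -(rmorph_nat (real_complex R)) cnorm_real normr_nat. Qed.

Lemma cnorm_eq0 z : (cnorm z == 0) = (z == 0).
Proof.
apply/eqP/eqP => [|->]; last exact: cnorm0.
exact: ComplexField.Normc.eq0_normc.
Qed.

Lemma cnorm_sqr z : cnorm z ^+ 2 = cre z ^+ 2 + cim z ^+ 2.
Proof. by case: z => a b /=; rewrite sqr_sqrtr// addr_ge0 ?sqr_ge0. Qed.

Lemma normr_Re_le z : `|cre z| <= cnorm z.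
Proof.
rewrite -(@ler_pXn2r _ 2) ?nnegrE ?cnorm_ge0// real_normK ?num_real// cnorm_sqr.
by rewrite lerDl sqr_ge0.
Qed.

Lemma Re_le z : cre z <= cnorm z.
Proof. exact: le_trans (ler_norm _) (normr_Re_le z). Qed.

Lemma cnorm_sum (I : Type) (r : seq I) (P : pred I) (F : I -> R[i]) :
  cnorm (\sum_(i <- r | P i) F i) <= \sum_(i <- r | P i) cnorm (F i).
Proof.
elim/big_rec2: _ => [|i x z _ h]; first by rewrite cnorm0.
by apply: (le_trans (cnormD _ _)); rewrite lerD2l.
Qed.

Lemma ReD z w : cre (z + w) = cre z + cre w.
Proof. by case: z; case: w. Qed.

Lemma Re_sum (I : Type) (r : seq I) (P : pred I) (F : I -> R[i]) :
  cre (\sum_(i <- r | P i) F i) = \sum_(i <- r | P i) cre (F i).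
Proof. by elim/big_rec2: _ => [|i x z _ h]//; rewrite ReD h. Qed.

Lemma ReMr z x : cre (z * x%:C) = cre z * x.
Proof. by case: z => a b /=; rewrite mulr0 subr0. Qed.

Definition cis x : R[i] := cos x +i* sin x.

Lemma cisD x1 x2 : cis (x1 + x2) = cis x1 * cis x2.
Proof.
by apply/eqP; rewrite eq_complex /= cosD sinD eqxx /= addrC [cos x1 * _]mulrC mulrC.
Qed.

Lemma cis0 : cis 0 = 1.
Proof. by rewrite /cis cos0 sin0. Qed.

Lemma cnorm_cis x : cnorm (cis x) = 1.
Proof. by rewrite /= cos2Dsin2 sqrtr1. Qed.

Lemma cisXn x n : cis (x *+ n) = cis x ^+ n.
Proof. by elim: n => [|n IH]; rewrite ?mulr0n ?cis0// mulrS cisD exprS IH. Qed.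

Lemma sin_lip x1 x2 : x1 <= x2 -> `|sin x2 - sin x1| <= x2 - x1.
Proof.
rewrite le_eqVlt => /predU1P[->|x12]; first by rewrite !subrr normr0.
have [|c _ ->] := @MVT R sin cos x1 x2 x12 (fun x _ => is_derive_sin x).
  by apply: continuous_subspaceT => x; apply: continuous_sin.
rewrite normrM [X in _ * X]gtr0_norm ?subr_gt0//.
by rewrite ler_piMl ?cos_max// subr_ge0 ltW.
Qed.

Lemma cos_lip x1 x2 : x1 <= x2 -> `|cos x2 - cos x1| <= x2 - x1.
Proof.
rewrite le_eqVlt => /predU1P[->|x12]; first by rewrite !subrr normr0.
have [|c _ ->] := @MVT R cos (fun x => - sin x) x1 x2 x12 (fun x _ => is_derive_cos x).
  by apply: continuous_subspaceT => x; apply: continuous_cos.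
rewrite normrM [X in _ * X]gtr0_norm ?subr_gt0// normrN.
by rewrite ler_piMl ?sin_max// subr_ge0 ltW.
Qed.

Lemma cnorm_le_ReIm z : cnorm z <= `|cre z| + `|cim z|.
Proof.
rewrite -(@ler_pXn2r _ 2) ?nnegrE ?cnorm_ge0 ?addr_ge0// cnorm_sqr.
rewrite -(real_normK (num_real (cre z))) -(real_normK (num_real (cim z))).
have := normr_ge0 (cre z); have := normr_ge0 (cim z).
by move: `|cre z| `|cim z| => a b; nra.
Qed.

Lemma cis_lip x1 x2 : cnorm (cis x1 - cis x2) <= 2 * `|x1 - x2|.
Proof.
wlog x12 : x1 x2 / x2 <= x1.
  move=> h; have [/h//|/ltW/h] := leP x2 x1.
  by rewrite cnorm_distC distrC.
apply: (le_trans (cnorm_le_ReIm _)) => /=.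
rewrite [X in 2 * X]ger0_norm ?subr_ge0//.
have := sin_lip x12; have := cos_lip x12; lra.
Qed.

End ComplexNorm.

Section CharacterSums.
Variables (R : realType) (q : nat) (chi : nat -> R[i]).
Hypothesis chi_char : dirichlet_character q chi.
Hypothesis chi_le1 : forall n, cnorm (chi n) <= 1.
Hypothesis chi_nonprincipal : ~ (chi =1 principal_character R q).

Let q_gt0 : (0 < q)%N. Proof. by case: chi_char. Qed.

Lemma character_periodic n k : chi (n + k * q)%N = chi n.
Proof.
case: chi_char => _ per _ _; elim: k => [|k IH]; first by rewrite addn0.
by rewrite mulSn [(q + _)%N]addnC addnA per IH.
Qed.

Lemma character_mod n : chi (n %% q)%N = chi n.
Proof. by rewrite {2}(divn_eq n q) addnC character_periodic. Qed.

Lemma character1 : chi 1%N = 1.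
Proof.
case: chi_char => _ _ mul nz; have := mul 1%N 1%N; rewrite muln1.
have : chi 1%N != 0 by rewrite nz coprime1n.
by move=> h /eqP; rewrite -{1}[chi 1%N]mulr1 => /eqP/(mulfI h).
Qed.

Lemma nonprincipal_witness : exists2 m, coprime m q & chi m != 1.
Proof.
have /existsNP[m hm] : ~ forall m, chi m = principal_character R q m by [].
case: chi_char => _ _ _ nz; exists m; last first.
  apply/eqP => chi_m1; apply: hm; rewrite /principal_character -nz chi_m1.
  by rewrite oner_eq0.
rewrite -nz; apply/eqP => chi_m0; apply: hm.
by rewrite /principal_character -nz chi_m0 eqxx.
Qed.

(** Multiplication by a unit [m] with [chi m != 1] permutes the residues modulo [q], so the sum
    equals [chi m] times itself. *)
Lemma character_period_sum : \sum_(i < q) chi i = 0.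
Proof.
have [m mq m1] := nonprincipal_witness.
pose h (i : 'I_q) : 'I_q := Ordinal (ltn_pmod (m * i) q_gt0).
have h_inj : injective h.
  move=> i j /(congr1 val) /= /eqP; rewrite -[X in _ == X]/((m * j) %% q)%N.
  move=> e; apply/val_inj/eqP; move: e.
  wlog ij : i j / (j <= i)%N.
    move=> H; have [ji|/ltnW ij] := leqP j i; first exact: H.
    by rewrite eq_sym [val i == _]eq_sym; apply: H.
  rewrite eqn_mod_dvd ?leq_mul2l ?ij ?orbT// -mulnBr Gauss_dvdr 1?coprime_sym//.
  by rewrite -eqn_mod_dvd// !modn_small.
have : \sum_(i < q) chi i = chi m * \sum_(i < q) chi i.
  rewrite [LHS](reindex_inj h_inj) /= mulr_sumr; apply: eq_bigr => i _.
  by rewrite character_mod; case: chi_char.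
move/eqP; rewrite -{1}[\sum_(_ < _) _]mul1r -subr_eq0 -mulrBl mulf_eq0.
by rewrite subr_eq0 eq_sym (negPf m1) => /eqP.
Qed.

Lemma character_shift_sum a : \sum_(a <= n < a + q) chi n = 0.
Proof.
elim: a => [|a IH]; first by rewrite add0n big_mkord character_period_sum.
have : \sum_(a <= n < (a + q).+1) chi n = \sum_(a <= n < a + q) chi n + chi (a + q)%N.
  by rewrite big_nat_recr// leq_addr.
rewrite big_ltn ?ltnS ?leq_addr// IH add0r.
by case: chi_char => _ -> _ _ /eqP; rewrite -subr_eq0 addrAC subrr add0r addSn => /eqP.
Qed.

Lemma character_sum_bound a b : cnorm (\sum_(a <= n < b) chi n) <= q%:R.
Proof.
have [k] := ubnP (b - a); elim: k a => // k IH a bk.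
have [bq|bq] := leqP (a + q) b.
  rewrite (@big_cat_nat _ _ _ (a + q))//= ?leq_addr// character_shift_sum add0r.
  by apply: IH; lia.
apply: (le_trans (cnorm_sum _ _ _)).
apply: (@le_trans _ _ (\sum_(a <= n < b) 1)); first exact: ler_sum.
by rewrite sumr_const_nat ler_nat; lia.
Qed.

Lemma character_abel (g : nat -> R[i]) a b : (a <= b)%N ->
  cnorm (\sum_(a <= n < b.+1) chi n * g n) <=
  q%:R * (cnorm (g b) + \sum_(a <= n < b) cnorm (g n - g n.+1)).
Proof.
move=> ab; rewrite abel_sum//; apply: (le_trans (cnormD _ _)).
rewrite cnormM mulrDr; apply: lerD.
  by rewrite ler_wpM2r ?cnorm_ge0 ?character_sum_bound.
rewrite mulr_sumr; apply: (le_trans (cnorm_sum _ _ _)).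
apply: ler_sum => n _; rewrite cnormM.
by rewrite ler_wpM2r ?cnorm_ge0 ?character_sum_bound.
Qed.

End CharacterSums.

Section Twist.
Variables (R : realType).

Lemma inv_nat_diff n : (0 < n)%N ->
  n%:R^-1 - n.+1%:R^-1 = (n%:R * n.+1%:R)^-1 :> R.
Proof.
move=> n0; have n0' : 0 < n%:R :> R by rewrite ltr0n.
have n1' : 0 < n.+1%:R :> R by rewrite ltr0n.
by rewrite -[n.+1%:R]natr1; field; rewrite natr1 !gt_eqF.
Qed.

Definition twist (chi : nat -> R[i]) (xi : R) (n : nat) : R[i] :=
  chi n * cis (xi * ln n%:R).

Lemma twist_norm_le1 chi xi : (forall n, cnorm (chi n) <= 1) ->
  forall n, cnorm (twist chi xi n) <= 1.
Proof. by move=> h n; rewrite cnormM cnorm_cis mulr1. Qed.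

Lemma twistM q chi xi m n : dirichlet_character q chi ->
  (0 < m)%N -> (0 < n)%N -> twist chi xi (m * n)%N = twist chi xi m * twist chi xi n.
Proof.
case=> _ _ mul _ m0 n0; rewrite /twist mul ln_natM// mulrDr cisD.
by rewrite !mulrA; congr (_ * _); rewrite mulrAC.
Qed.

Lemma twist0 chi : twist chi 0 = chi.
Proof. by apply/funext => n; rewrite /twist mul0r cis0 mulr1. Qed.

Definition cis_log_over (xi : R) (n : nat) : R[i] := cis (xi * ln n%:R) / n%:R.

Lemma cis_log_over_norm xi n : cnorm (cis_log_over xi n) = n%:R^-1.
Proof. by rewrite cnormM cnorm_cis mul1r cnormV cnorm_nat. Qed.

Lemma cis_log_over_increment xi n : `|xi| <= 1 -> (0 < n)%N ->
  cnorm (cis_log_over xi n - cis_log_over xi n.+1) <= 3 / (n%:R * n.+1%:R).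
Proof.
move=> xi1 n0; have n0' : 0 < n%:R :> R by rewrite ltr0n.
have n1' : 0 < n.+1%:R :> R by rewrite ltr0n.
have -> : cis_log_over xi n - cis_log_over xi n.+1 =
   cis (xi * ln n%:R) * (n%:R^-1 - n.+1%:R^-1) +
   (cis (xi * ln n%:R) - cis (xi * ln n.+1%:R)) / n.+1%:R.
  by rewrite /cis_log_over mulrBr mulrBl addrA subrK.
apply: (le_trans (cnormD _ _)); rewrite !cnormM cnorm_cis mul1r cnormV cnorm_nat.
have -> : (n%:R^-1 - n.+1%:R^-1 : R[i]) = (n%:R^-1 - n.+1%:R^-1 : R)%:C.
  by rewrite rmorphB !fmorphV !rmorph_nat.
rewrite cnorm_real ger0_norm; last first.
  by rewrite subr_ge0 lef_pV2 ?posrE// ler_nat.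
rewrite inv_nat_diff//.
have h : cnorm (cis (xi * ln n%:R) - cis (xi * ln n.+1%:R)) <= 2 / n%:R.
  apply: (le_trans (cis_lip _ _)); rewrite ler_pM2l// -mulrBr normrM distrC.
  apply: (le_trans _ (ln_natS_ub R n0)).
  rewrite [X in _ * X]ger0_norm ?subr_ge0 ?ln_nat_le//.
  by rewrite ler_piMl// subr_ge0 ln_nat_le.
apply: (le_trans (lerD (lexx _) (ler_wpM2r _ h))); first by rewrite invr_ge0 ltW.
by rewrite -mulrA -invfM -[X in X + _]mul1r -mulrDl.
Qed.

Variables (q : nat) (chi : nat -> R[i]).
Hypothesis chi_char : dirichlet_character q chi.
Hypothesis chi_le1 : forall n, cnorm (chi n) <= 1.
Hypothesis chi_nonprincipal : ~ (chi =1 principal_character R q).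

(** The increments of [n ^ (-1 + i xi)] are [O(1 / n ^ 2)] uniformly in [|xi| <= 1]. This uniformity
    is what allows a lower bound at [xi = 0] to be carried to a neighbourhood. *)
Lemma twist_tail xi a b : `|xi| <= 1 -> (0 < a)%N ->
  cnorm (\sum_(a <= n < b) twist chi xi n / n%:R) <= 3 * q%:R / a%:R.
Proof.
move=> xi1 a0; have a0' : 0 < a%:R :> R by rewrite ltr0n.
have [ab|ba] := ltnP a b; last first.
  by rewrite big_geq// cnorm0 !mulr_ge0// invr_ge0 ltW.
case: b ab => // b; rewrite ltnS => ab.
under eq_bigr do rewrite /twist -mulrA -/(cis_log_over _ _).
apply: (le_trans (character_abel chi_char chi_le1 chi_nonprincipal _ ab)).
rewrite cis_log_over_norm [3 * _]mulrC -[leRHS]mulrA ler_wpM2l//.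
have b0' : 0 < b%:R :> R by rewrite ltr0n (leq_trans a0).
apply: (@le_trans _ _ (b%:R^-1 + 3 * (a%:R^-1 - b%:R^-1))); last first.
  have : 0 < b%:R^-1 :> R by rewrite invr_gt0.
  by move: (a%:R^-1) (b%:R^-1) => u v; lra.
rewrite lerD2l.
have <- : \sum_(a <= n < b) (- (n.+1%:R)^-1 - - (n%:R^-1)) = a%:R^-1 - b%:R^-1 :> R.
  by rewrite (telescope_sumr (fun n => - (n%:R^-1) : R)) // opprK addrC.
rewrite mulr_sumr; apply: ler_sum_nat => n /andP[an _].
have n0 : (0 < n)%N by apply: leq_trans an.
apply: (le_trans (cis_log_over_increment xi1 n0)).
rewrite ler_pM2l// opprK addrC le_eqVlt; apply/orP; left; apply/eqP.
by rewrite inv_nat_diff.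
Qed.

(** Partial sums of [- L']. In [7 = 1 + 3 * 2] the endpoint of the Abel summation gives [1], since
    [ln N <= N], and the variation is at most [3] times [sum_log_over_square]. *)
Lemma twist_ln_sum xi N : `|xi| <= 1 ->
  cnorm (\sum_(1 <= n < N.+1) twist chi xi n / n%:R * (ln n%:R)%:C) <= 7 * q%:R.
Proof.
move=> xi1; case: N => [|N]; first by rewrite big_geq// cnorm0 mulr_ge0.
under eq_bigr do rewrite /twist -!mulrA [X in _ * X]mulrA -/(cis_log_over _ _).
apply: (le_trans (character_abel chi_char chi_le1 chi_nonprincipal
  (fun n => cis_log_over xi n * (ln n%:R)%:C) (isT : (1 <= N.+1)%N))).
rewrite [7 * _]mulrC ler_wpM2l// cnormM cis_log_over_norm cnorm_real.
have N0 : 0 < N.+1%:R :> R by rewrite ltr0n.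
have -> : 7 = 1 + 6 :> R by lra.
apply: lerD.
  rewrite ger0_norm ?ln_nat_ge0// mulrC ler_pdivrMr// mul1r.
  by apply/ltW/ln_sublinear.
have -> : 6 = 3 * 2 :> R by lra.
apply: le_trans (ler_wpM2l _ (sum_log_over_square R N)) => //.
rewrite mulr_sumr; apply: ler_sum_nat => n /andP[n0 _].
have n0' : 0 < n%:R :> R by rewrite ltr0n.
have n1' : 0 < n.+1%:R :> R by rewrite ltr0n.
have -> : cis_log_over xi n * (ln n%:R)%:C - cis_log_over xi n.+1 * (ln n.+1%:R)%:C
  = (cis_log_over xi n - cis_log_over xi n.+1) * (ln n%:R)%:C +
    cis_log_over xi n.+1 * (ln n%:R - ln n.+1%:R)%:C.
  by rewrite rmorphB mulrBl mulrBr addrA subrK.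
apply: (le_trans (cnormD _ _)); rewrite (cnormM (_ - _)) (cnormM (cis_log_over xi n.+1)).
rewrite !cnorm_real cis_log_over_norm.
rewrite ger0_norm ?ln_nat_ge0// distrC ger0_norm ?subr_ge0 ?ln_nat_le//.
apply: (@le_trans _ _ (3 / (n%:R * n.+1%:R) * ln n%:R + n.+1%:R^-1 * n%:R^-1)).
  apply: lerD; first by rewrite ler_wpM2r ?ln_nat_ge0 ?cis_log_over_increment.
  by rewrite ler_pM2l ?invr_gt0// ln_natS_ub.
rewrite -invfM [n.+1%:R * _]mulrC.
have : 0 < (n%:R * n.+1%:R)^-1 :> R by rewrite invr_gt0 mulr_gt0.
by move: (_^-1) => u u0; lra.
Qed.

End Twist.

(** * Divisor sums and Moebius inversion *)

Section DivisorSums.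
Implicit Types (m n N p d a : nat).

Lemma sum_divisors (V : nmodType) (g : nat -> V) n N : (0 < n <= N)%N ->
  \sum_(d <- divisors n) g d = \sum_(1 <= d < N.+1 | (d %| n)%N) g d.
Proof.
move=> /andP[n0 nN]; rewrite -[RHS]big_filter; apply: perm_big.
apply: uniq_perm; rewrite ?divisors_uniq ?filter_uniq ?iota_uniq// => d.
rewrite mem_filter -dvdn_divisors// mem_index_iota ltnS.
case: (boolP (d %| n)%N) => //= dn.
by rewrite (dvdn_gt0 n0 dn) (leq_trans (dvdn_leq n0 dn) nN).
Qed.

Lemma perm_divisors_primeM p a m : prime p -> ~~ (p %| m)%N -> (0 < m)%N ->
  perm_eq (divisors (p ^ a.+1 * m))
    (divisors (p ^ a * m) ++ [seq (p ^ a.+1 * e)%N | e <- divisors m]).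
Proof.
move=> pp pm m0; have p0 := prime_gt0 pp.
have pa0 k : (0 < p ^ k * m)%N by rewrite muln_gt0 expn_gt0 p0.
apply: uniq_perm; first exact: divisors_uniq.
  rewrite cat_uniq divisors_uniq map_inj_uniq ?divisors_uniq ?andbT; last first.
    by move=> x y /eqP; rewrite eqn_pmul2l ?expn_gt0 ?p0// => /eqP.
  apply/hasPn => _ /mapP[e _ ->]; rewrite /= -dvdn_divisors//; apply/negP => h.
  have : (p ^ a * p %| p ^ a * m)%N.
    by apply: dvdn_trans h; rewrite -expnSr dvdn_mulr.
  by rewrite dvdn_pmul2l ?expn_gt0 ?p0// (negPf pm).
move=> d; rewrite mem_cat -!dvdn_divisors//; apply/idP/orP => [h|[h|/mapP[e]]].
- have d0 : (0 < d)%N by apply: dvdn_gt0 h.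
  have [e pe dE] := pfactor_coprime pp d0.
  have em : (e %| m)%N.
    rewrite -(@Gauss_dvdr e (p ^ a.+1)); last by rewrite coprime_sym coprimeXl.
    by apply: dvdn_trans h; rewrite dE dvdn_mulr.
  have [la|la] := leqP (logn p d) a.
    left; rewrite dE mulnC dvdn_mul// dvdn_exp2l//.
  right; apply/mapP; exists e; first by rewrite -dvdn_divisors.
  rewrite {1}dE mulnC; congr (_ ^ _ * _)%N.
  apply/eqP; rewrite eqn_leq la andbT.
  apply: leq_trans (dvdn_leq_log p (pa0 _) h) _.
  rewrite lognM ?expn_gt0 ?p0// pfactorK// [logn p m]lognE pp m0 (negPf pm) addn0//.
- by apply: dvdn_trans h _; rewrite dvdn_mul// dvdn_exp2l.
- by rewrite -dvdn_divisors// => em ->; rewrite dvdn_pmul2l ?expn_gt0 ?p0.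
Qed.

Lemma sum_divisors_primeM (V : nmodType) (g : nat -> V) p a m :
  prime p -> ~~ (p %| m)%N -> (0 < m)%N ->
  \sum_(d <- divisors (p ^ a.+1 * m)) g d =
  \sum_(d <- divisors (p ^ a * m)) g d +
  \sum_(e <- divisors m) g (p ^ a.+1 * e)%N.
Proof.
by move=> pp pm m0; rewrite (perm_big _ (perm_divisors_primeM a pp pm m0)) big_cat big_map.
Qed.

Lemma primes_primeM p a m : prime p -> ~~ (p %| m)%N -> (0 < m)%N ->
  perm_eq (primes (p ^ a.+1 * m)) (p :: primes m).
Proof.
move=> pp pm m0; apply: uniq_perm; rewrite ?primes_uniq//=.
  by rewrite mem_primes (negPf pm) !andbF primes_uniq.
have pa0 : (0 < p ^ a.+1)%N by rewrite expn_gt0 prime_gt0.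
move=> r; rewrite primesM// primesX// primes_prime//.
by rewrite mem_seq1 inE.
Qed.

Lemma omega_primeM p a m : prime p -> ~~ (p %| m)%N -> (0 < m)%N ->
  omega (p ^ a.+1 * m) = (omega m).+1.
Proof. by move=> pp pm m0; rewrite /omega (perm_size (primes_primeM a pp pm m0)). Qed.

Lemma mobius1 : mobius 1 = 1.
Proof. by []. Qed.

Lemma mobius_primeM p m : prime p -> ~~ (p %| m)%N -> (0 < m)%N ->
  mobius (p * m) = - mobius m.
Proof.
move=> pp pm m0; have := primes_primeM 0 pp pm m0; rewrite expn1 => h.
have := omega_primeM 0 pp pm m0; rewrite expn1 /mobius => ->.
rewrite muln_gt0 prime_gt0//= m0 (perm_all _ h) /=.
have -> : ~~ (p ^ 2 %| p * m)%N.
  by rewrite expnS expn1 dvdn_pmul2l ?prime_gt0.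
have -> : all (fun r => ~~ (r ^ 2 %| p * m)%N) (primes m) =
          all (fun r => ~~ (r ^ 2 %| m)%N) (primes m).
  apply: eq_in_all => r; rewrite mem_primes => /and3P[rp _ rm].
  rewrite Gauss_dvdr// coprimeXl// prime_coprime// dvdn_prime2//.
  by apply: contraNN pm => /eqP <-.
by rewrite /=; case: ifP => _; rewrite ?oppr0// exprS mulN1r.
Qed.

Lemma mobius_square p m : prime p -> mobius (p ^ 2 * m) = 0.
Proof.
move=> pp; rewrite /mobius; case: ifP => // /andP[m0 /allP h].
have /h : p \in primes (p ^ 2 * m) by rewrite mem_primes pp m0 /= dvdn_mulr// dvdn_exp.
by rewrite dvdn_mulr.
Qed.

(** Only [d] and [p d] with [d | m] survive, as [mobius] kills multiples of [p ^ 2]. The prime power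
    thus acts on [g] as a difference operator, which annihilates constants and turns [- ln] into the
    constant [ln p]. *)
Lemma sum_mobius_primeM (K : nzRingType) (g : nat -> K) p a m :
  prime p -> ~~ (p %| m)%N -> (0 < m)%N ->
  \sum_(d <- divisors (p ^ a.+1 * m)) (mobius d)%:~R * g d =
  \sum_(d <- divisors m) (mobius d)%:~R * (g d - g (p * d)%N).
Proof.
move=> pp pm m0; elim: a => [|a IH]; last first.
  rewrite sum_divisors_primeM// IH [X in _ + X]big1 ?addr0// => e _.
  by rewrite -[a.+2]add2n expnD -mulnA mobius_square// mul0r.
rewrite sum_divisors_primeM// expn0 mul1n -big_split /=.
rewrite big_seq [RHS]big_seq; apply: eq_bigr => d; rewrite -dvdn_divisors// => dm.
rewrite expn1 mobius_primeM//; last exact: dvdn_gt0 dm.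
  by rewrite rmorphN mulNr mulrBr.
by apply: contraNN pm => /dvdn_trans; apply.
Qed.

Lemma prime_factorization_ind (P : nat -> Prop) :
  P 1%N ->
  (forall p a m, prime p -> ~~ (p %| m)%N -> (0 < m)%N -> P m -> P (p ^ a.+1 * m)%N) ->
  forall n, (0 < n)%N -> P n.
Proof.
move=> P1 IH n; have [k] := ubnP n; elim: k n => // k IHk n nk n0.
have [->//|n1] := eqVneq n 1%N.
have n2 : (1 < n)%N by case: n n0 n1 {nk} => [|[]].
have pp := pdiv_prime n2.
have [m pm nE] := pfactor_coprime pp n0.
have l0 : (0 < logn (pdiv n) n)%N by rewrite logn_gt0 mem_primes pp n0 pdiv_dvd.
have m0 : (0 < m)%N by move: n0; rewrite nE muln_gt0 => /andP[].
rewrite nE mulnC -(prednK l0); apply: IH => //; first by rewrite -prime_coprime.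
apply: IHk => //; apply: (@leq_trans n); last by rewrite -ltnS.
have : (m * 2 <= m * pdiv n ^ logn (pdiv n) n)%N.
  rewrite leq_pmul2l// -(prednK l0) expnS -[2%N]muln1 leq_mul ?prime_gt1//.
  by rewrite expn_gt0 prime_gt0.
rewrite -nE; lia.
Qed.

Lemma sum_mobius (K : nzRingType) n : (0 < n)%N ->
  \sum_(d <- divisors n) (mobius d)%:~R = (n == 1)%N%:R :> K.
Proof.
elim/prime_factorization_ind: n / => [|p a m pp pm m0 _].
  by rewrite big_seq1.
have := sum_mobius_primeM (fun=> 1 : K) a pp pm m0.
under eq_bigr do rewrite mulr1.
move=> ->; rewrite big1; last by move=> d _; rewrite subrr mulr0.
have : (1 < p ^ a.+1 * m)%N.
  by rewrite expnS -mulnA (leq_trans (prime_gt1 pp))// leq_pmulr// muln_gt0 expn_gt0 prime_gt0.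
by case: eqP => // ->.
Qed.

Variable R : realType.

(* [von_mangoldt N n] is the von Mangoldt function at [n], for all [0 < n <= N]. *)
Definition von_mangoldt N n : R :=
  \sum_(1 <= p < N.+1 | prime p) \sum_(1 <= k < N.+1) (n == p ^ k)%N%:R * ln p%:R.

Lemma von_mangoldt1 N : von_mangoldt N 1 = 0.
Proof.
rewrite /von_mangoldt big1// => p pp; rewrite big_nat_cond big1// => k /andP[/andP[k0 _] _].
have pk : (1 < p ^ k)%N by rewrite -(exp1n k) ltn_exp2r ?prime_gt1.
by rewrite ltn_eqF// mul0r.
Qed.

Lemma von_mangoldt_primeM N p a m : prime p -> ~~ (p %| m)%N -> (0 < m)%N ->
  (p ^ a.+1 * m <= N)%N ->
  von_mangoldt N (p ^ a.+1 * m) = (m == 1)%N%:R * ln p%:R.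
Proof.
move=> pp pm m0 nN; have p0 := prime_gt0 pp.
have key r k : prime r -> (p ^ a.+1 * m == r ^ k)%N = [&& r == p, k == a.+1 & m == 1%N].
  move=> rp; apply/eqP/and3P => [e|[/eqP-> /eqP-> /eqP->]]; last by rewrite muln1.
  have pr : p = r.
    have : (p %| r ^ k)%N by rewrite -e dvdn_mulr// dvdn_exp.
    by rewrite Euclid_dvdX// => /andP[]; rewrite dvdn_prime2// => /eqP.
  move: e; rewrite -pr => e.
  have m1 : m = 1%N.
    apply/eqP; have : (m %| p ^ k)%N by rewrite -e dvdn_mull.
    have : coprime m (p ^ k) by rewrite coprime_sym coprimeXl// prime_coprime.
    by rewrite /coprime => /eqP g1 /gcdn_idPl; rewrite g1 => <-.
  by move: e; rewrite m1 muln1 => /eqP; rewrite eqn_exp2l ?prime_gt1// eq_sym => /eqP->; rewrite !eqxx.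
have pN : (p <= N)%N.
  by rewrite (leq_trans _ nN)// expnS -mulnA leq_pmulr// muln_gt0 expn_gt0 p0.
have aN : (a.+1 <= N)%N.
  rewrite (leq_trans _ nN)// (leq_trans (ltnW (ltn_expl a.+1 (prime_gt1 pp))))//.
  by rewrite leq_pmulr.
rewrite /von_mangoldt big_mkcond (bigD1_seq p) ?iota_uniq ?mem_index_iota ?ltnS ?p0//=.
rewrite pp [X in _ + X]big1 ?addr0; last first.
  move=> r rp; case: ifP => // pr; rewrite big1// => k _.
  by rewrite key// (negPf rp) mul0r.
rewrite (bigD1_seq a.+1) ?iota_uniq ?mem_index_iota ?ltnS//=.
rewrite big1 ?addr0 ?key ?eqxx// => k ka.
by rewrite key// (negPf ka) andbF mul0r.
Qed.

(** The difference operator of [sum_mobius_primeM] leaves [ln p * \sum_(d | m) mu(d)], which is zero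
    unless [m = 1]: only prime powers contribute. *)
Lemma sum_mobius_log (c : R) n N : (0 < n <= N)%N ->
  \sum_(d <- divisors n) (mobius d)%:~R * (c - ln d%:R) =
  (n == 1)%N%:R * c + von_mangoldt N n.
Proof.
case/andP; elim/prime_factorization_ind: n / => [|p a m pp pm m0 _] nN.
  by rewrite big_seq1 ln1 subr0 von_mangoldt1 addr0.
rewrite sum_mobius_primeM// von_mangoldt_primeM//.
have -> : (p ^ a.+1 * m == 1)%N = false.
  apply: gtn_eqF.
  by rewrite expnS -mulnA (leq_trans (prime_gt1 pp))// leq_pmulr// muln_gt0 expn_gt0 prime_gt0.
rewrite mul0r add0r -sum_mobius// mulr_suml big_seq [RHS]big_seq.
apply: eq_bigr => d; rewrite -dvdn_divisors// => /(dvdn_gt0 m0) d0.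
have -> : c - ln d%:R - (c - ln (p * d)%:R) = ln p%:R.
  by rewrite (ln_natM R (prime_gt0 pp) d0) opprB addrC addrA subrK addrK.
by [].
Qed.

Lemma mobius_le1 d : `|(mobius d)%:~R| <= 1 :> R.
Proof.
rewrite /mobius; case: ifP => _; last by rewrite normr0.
by rewrite rmorphXn rmorphN1 normrX normrN1 expr1n.
Qed.

End DivisorSums.

(** * Nonvanishing of [L(1, chi)] *)

Section MultiplicativeMertens.
Variables (R : realType) (f : nat -> R[i]).
Implicit Types (m n N p d : nat).

Definition psum (g : nat -> R[i]) N : R[i] := \sum_(1 <= n < N.+1) g n / n%:R.
Definition prime_log_sum (g : nat -> R[i]) N : R[i] :=
  \sum_(1 <= p < N.+1 | prime p) g p / p%:R * (ln p%:R)%:C.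

Hypothesis fM : forall m n, (0 < m)%N -> (0 < n)%N -> f (m * n)%N = f m * f n.
Hypothesis f_le1 : forall n, cnorm (f n) <= 1.

Lemma psum_scale d N : (0 < d)%N ->
  \sum_(1 <= j < (N %/ d).+1) f (d * j)%N / (d * j)%:R =
  f d / d%:R * psum f (N %/ d).
Proof.
move=> d0; rewrite /psum mulr_sumr.
apply: eq_big_nat => j /andP[j0 _]; rewrite fM// natrM invfM.
by rewrite !mulrA; congr (_ * _); rewrite mulrAC.
Qed.

Lemma sum_multiples_psum d N : (0 < d)%N ->
  \sum_(1 <= n < N.+1 | (d %| n)%N) f n / n%:R = f d / d%:R * psum f (N %/ d).
Proof.
by move=> d0; rewrite sum_multiples// psum_scale.
Qed.

Lemma term_norm_le n (x : R) : 0 <= x ->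
  cnorm (f n / n%:R * x%:C) <= x / n%:R.
Proof.
move=> x0; rewrite !cnormM cnormV cnorm_nat cnorm_real (ger0_norm x0).
by rewrite [x / _]mulrC ler_wpM2r// ler_piMl// invr_ge0.
Qed.

(** Mertens' method: expand [ln n] over prime powers. Replacing [psum f (N %/ p)] by [psum f N]
    costs at most [(ln p / p) * (B p / N)] for each prime, in all [B / N * \sum_p ln p <= 2 B]; the
    higher prime powers cost another [2 B]. *)
Lemma psum_mul_prime_log_sum (B B' : R) N : (0 < N)%N ->
  (forall a b, (0 < a)%N -> cnorm (\sum_(a <= n < b) f n / n%:R) <= B / a%:R) ->
  cnorm (\sum_(1 <= n < N.+1) f n / n%:R * (ln n%:R)%:C) <= B' ->
  cnorm (psum f N * prime_log_sum f N) <= B' + 4 * B.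
Proof.
move=> N0 tail logs; have B0 : 0 <= B.
  by have := tail 1%N 1%N isT; rewrite big_geq// cnorm0 divr1.
have N0' : 0 < N%:R :> R by rewrite ltr0n.
have S_le M : cnorm (psum f M) <= B by have := tail 1%N M.+1 isT; rewrite divr1.
have /= E := @sum_mul_ln R _ (real_complex R) (fun n => f n / n%:R) N.
have E2 : psum f N * prime_log_sum f N =
  \sum_(1 <= n < N.+1) f n / n%:R * (ln n%:R)%:C -
  \sum_(1 <= p < N.+1 | prime p)
    (f p / p%:R * (ln p%:R)%:C * (psum f (N %/ p) - psum f N) +
     \sum_(2 <= k < N.+1) f (p ^ k)%N / (p ^ k)%:R * psum f (N %/ p ^ k) * (ln p%:R)%:C).
  rewrite E mulr_sumr -sumrB; apply: eq_bigr => p pp.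
  rewrite big_ltn ?ltnS// expn1 psum_scale ?prime_gt0//.
  under [X in _ + X - _]eq_bigr => k _ do rewrite psum_scale ?expn_gt0 ?prime_gt0//.
  by rewrite opprD addrACA subrr addr0 mulrBr opprB addrC [f p / _ * psum _ _ * _]mulrAC subrK mulrC.
rewrite E2; apply: (le_trans (cnormB _ _)); apply: lerD => //.
apply: (le_trans (cnorm_sum _ _ _)).
apply: (@le_trans _ _ (\sum_(1 <= p < N.+1 | prime p)
   (B / N%:R * ln p%:R + B * \sum_(2 <= k < N.+1) ln p%:R / (p ^ k)%:R))).
  apply: ler_sum => p pp; have p0 := prime_gt0 pp.
  have p0' : 0 < p%:R :> R by rewrite ltr0n.
  apply: (le_trans (cnormD _ _)); apply: lerD.
    rewrite cnormM; apply: (@le_trans _ _ (ln p%:R / p%:R * (B * (p%:R / N%:R)))).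
      apply: ler_pM; rewrite ?cnorm_ge0 ?term_norm_le ?ln_nat_ge0//.
      rewrite /psum [in X in _ - X](@big_cat_nat _ _ _ (N %/ p).+1) ?ltnS ?leq_div//=.
      rewrite opprD addrA subrr add0r cnormN.
      apply: (le_trans (tail _ _ _)) => //; rewrite ler_wpM2l//.
      rewrite -[p%:R / _]invrK lef_pV2 ?posrE ?ltr0n ?invr_gt0 ?divr_gt0//.
      by rewrite invfM invrK mulrC -natr1 natdiv_ge.
    by rewrite le_eqVlt; apply/orP; left; apply/eqP; field; rewrite !gt_eqF.
  rewrite mulr_sumr; apply: (le_trans (cnorm_sum _ _ _)); apply: ler_sum => k _.
  rewrite mulrAC cnormM mulrC; apply: ler_pM; rewrite ?cnorm_ge0//.
  by rewrite term_norm_le ?ln_nat_ge0.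
rewrite big_split /= -!mulr_sumr.
apply: (@le_trans _ _ (B / N%:R * (2 * N%:R) + B * 2)).
  apply: lerD; last by rewrite ler_wpM2l ?sum_prime_powers_tail.
  by rewrite ler_wpM2l ?divr_ge0 ?ler0n// sum_ln_primes_ub.
rewrite mulrCA divfK ?gt_eqF//; lra.
Qed.

(* Here the series [\sum_n f(n) / n] vanishes.  Sum [f(n) / n] against
   [\sum_(d | n) mu(d) log(N / d)], which is the von Mangoldt function plus
   [log N] at [n = 1]; exchanging summations gives [O(1)]. *)
Lemma prime_log_sum_vanishing (B : R) N : (0 < N)%N -> f 1%N = 1 ->
  (forall M, cnorm (psum f M) <= B / M.+1%:R) ->
  cnorm ((ln N%:R)%:C + prime_log_sum f N) <= B + 2.
Proof.
move=> N0 f1 S_le; have N0' : 0 < N%:R :> R by rewrite ltr0n.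
have B0 : 0 <= B by have := S_le 0%N; rewrite divr1; apply: le_trans (cnorm_ge0 _).
have E1 : \sum_(1 <= n < N.+1) f n / n%:R *
    (\sum_(d <- divisors n) (mobius d)%:~R * (ln N%:R - ln d%:R : R))%:C =
    (ln N%:R)%:C + \sum_(1 <= p < N.+1 | prime p) \sum_(1 <= k < N.+1)
      \sum_(1 <= n < N.+1 | n == (p ^ k)%N) f n / n%:R * (ln p%:R)%:C.
  under eq_big_nat => n nN do rewrite (@sum_mobius_log R _ n N nN) rmorphD mulrDr.
  rewrite big_split /=; congr (_ + _).
    rewrite big_ltn ?ltnS// f1 eqxx mul1r mul1r big_nat_cond big1 ?addr0//.
      by rewrite invr1 mul1r.
    move=> n /andP[/andP[n1 _] _].
    by rewrite gtn_eqF// mul0r mulr0.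
  under eq_bigr => n _ do rewrite /von_mangoldt rmorph_sum mulr_sumr.
  rewrite exchange_big_nat; apply: eq_bigr => p _.
  under eq_bigr => n _ do rewrite rmorph_sum mulr_sumr.
  rewrite exchange_big_nat; apply: eq_bigr => k _; rewrite [RHS]big_mkcond.
  apply: eq_bigr => n _; case: ifP => _; first by rewrite mul1r.
  by rewrite mul0r mulr0.
have E2 : \sum_(1 <= n < N.+1) f n / n%:R *
    (\sum_(d <- divisors n) (mobius d)%:~R * (ln N%:R - ln d%:R : R))%:C =
   \sum_(1 <= d < N.+1) ((mobius d)%:~R * (ln N%:R - ln d%:R : R))%:C *
     (f d / d%:R * psum f (N %/ d)).
  under eq_big_nat => n nN do rewrite (sum_divisors _ nN) rmorph_sum mulr_sumr big_mkcond.
  rewrite exchange_big_nat /=; apply: eq_big_nat => d /andP[d0 _].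
  rewrite -sum_multiples_psum// mulr_sumr big_mkcond [RHS]big_mkcond /=.
  by apply: eq_bigr => n _; case: ifP => // _; rewrite mulrC.
have E3 : (ln N%:R)%:C + prime_log_sum f N =
   \sum_(1 <= d < N.+1) ((mobius d)%:~R * (ln N%:R - ln d%:R : R))%:C *
     (f d / d%:R * psum f (N %/ d)) -
   \sum_(1 <= p < N.+1 | prime p) \sum_(2 <= k < N.+1)
      \sum_(1 <= n < N.+1 | n == (p ^ k)%N) f n / n%:R * (ln p%:R)%:C.
  rewrite -E2 E1 -addrA -sumrB; congr (_ + _).
  rewrite /prime_log_sum big_nat_cond [RHS]big_nat_cond.
  apply: eq_bigr => p /andP[/andP[p0 pN] pp].
  rewrite big_ltn ?ltnS// addrK expn1 big_mkcond (bigD1_seq p)/= ?mem_index_iota ?p0 ?iota_uniq//.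
  by rewrite eqxx big1 ?addr0// => n /negPf ->.
rewrite E3; apply: (le_trans (cnormB _ _)); apply: lerD.
  apply: (le_trans (cnorm_sum _ _ _)).
  apply: (@le_trans _ _ (\sum_(1 <= d < N.+1) B / N%:R * (ln N%:R - ln d%:R))).
    apply: ler_sum_nat => d /andP[d0 dN]; have d0' : 0 < d%:R :> R by rewrite ltr0n.
    have l0 : 0 <= ln N%:R - ln d%:R :> R by rewrite subr_ge0 ln_nat_le.
    rewrite cnormM cnorm_real normrM (ger0_norm l0).
    rewrite [leRHS]mulrC; apply: ler_pM; rewrite ?mulr_ge0 ?cnorm_ge0//.
      by rewrite ler_piMl// mobius_le1.
    rewrite cnormM; apply: (@le_trans _ _ (d%:R^-1 * (B * (d%:R / N%:R)))).
      apply: ler_pM; rewrite ?cnorm_ge0//.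
        by have := @term_norm_le d 1 ler01; rewrite rmorph1 mulr1 mul1r.
      apply: (le_trans (S_le _)); rewrite ler_wpM2l//.
      rewrite -[d%:R / _]invrK lef_pV2 ?posrE ?ltr0n ?invr_gt0 ?divr_gt0//.
      by rewrite invfM invrK mulrC -natr1 natdiv_ge.
    by rewrite le_eqVlt; apply/orP; left; apply/eqP; field; rewrite !gt_eqF.
  (* The sum of [ln (N / d)] is [N ln N - ln N! <= N]: the logarithmic factor disappears on average,
     so this error is only [B]. *)
  rewrite -mulr_sumr sumrB -ln_fact sumr_const_nat subSS subn0 -[ln N%:R *+ N]mulr_natl.
  have := ln_fact_lb R N0 => h.
  rewrite mulrAC ler_pdivrMr//; rewrite ler_wpM2l//; lra.
apply: (le_trans _ (@sum_prime_powers_tail R N)).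
apply: (le_trans (cnorm_sum _ _ _)); apply: ler_sum => p pp.
apply: (le_trans (cnorm_sum _ _ _)); apply: ler_sum => k _.
apply: (le_trans (cnorm_sum _ _ _)); have l0 := ln_nat_ge0 R p.
have [pk|pk] := boolP ((p ^ k)%N \in index_iota 1 N.+1).
  rewrite big_mkcond (bigD1_seq (p ^ k)%N) ?iota_uniq//= eqxx big1 ?addr0.
    exact: term_norm_le.
  by move=> n /negPf ->.
rewrite big_mkcond big_seq big1 ?divr_ge0// => n nN; case: eqP => // npk.
by move: pk; rewrite -npk nN.
Qed.

End MultiplicativeMertens.

Section NonvanishingComplex.
Variables (R : realType).

(** The alternative between a nonzero and a zero limit, expressed by partial sums. If they are not
    eventually bounded away from [0], there is an arbitrarily small [S M] with [M >= N], and the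
    Cauchy bound passes to [S N]. *)
Lemma nonvanishing_dichotomy (S : nat -> R[i]) (B : R) :
  (forall M N, (N <= M)%N -> cnorm (S M - S N) <= B / N.+1%:R) ->
  (exists2 c : R, 0 < c & exists N0, forall N, (N0 <= N)%N -> c <= cnorm (S N)) \/
  (forall N, cnorm (S N) <= B / N.+1%:R).
Proof.
move=> HS; case: (pselect (exists2 c : R, 0 < c & exists N0, forall N, (N0 <= N)%N -> c <= cnorm (S N))); first by left.
move=> H; right => N; apply/ler_addgt0Pr => e e0.
have /existsNP[M] : ~ forall M, (N <= M)%N -> e <= cnorm (S M).
  by move=> h; apply: H; exists e => //; exists N.
move/not_implyP => [NM] /negP; rewrite -ltNge => SM.
have -> : S N = - (S M - S N) + S M by rewrite opprB subrK.
apply: (le_trans (cnormD _ _)); rewrite cnormN; apply: lerD; last exact: ltW.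
exact: HS.
Qed.

Lemma ln_unbounded (C : R) N0 : exists N, [/\ (N0 <= N)%N, (0 < N)%N & C < ln N%:R].
Proof.
pose M := (Num.truncn (expR C)).+1.
exists (maxn M N0); split; first exact: leq_maxr.
  by rewrite leq_max.
rewrite -ltr_expR lnK ?posrE ?ltr0n ?leq_max//.
apply: (@lt_le_trans _ _ M%:R); first by rewrite truncnS_gt.
by rewrite ler_nat leq_maxl.
Qed.

Variables (q : nat) (chi : nat -> R[i]).
Hypothesis chi_char : dirichlet_character q chi.
Hypothesis chi_le1 : forall n, cnorm (chi n) <= 1.

Lemma character_pow_char k : (0 < k)%N -> dirichlet_character q (fun n => chi n ^+ k).
Proof.
case: chi_char => q0 per mul nz k0; split => //.
- by move=> n; rewrite per.
- by move=> m n; rewrite mul exprMn.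
- by move=> n; rewrite expf_eq0 k0 /= nz.
Qed.

Lemma character_pow_le1 k n : cnorm (chi n ^+ k) <= 1.
Proof. by rewrite cnormX exprn_ile1 ?cnorm_ge0. Qed.

(** With [a = cre z], the hypothesis gives [cre (z ^+ 2) >= 2 a ^ 2 - 1], leaving [2 (1 + a) ^ 2].
    The closed disc, rather than the circle, accommodates the primes where the character
    vanishes. *)
Lemma three_four_one (z : R[i]) : cnorm z <= 1 -> 0 <= 3 + 4 * cre z + cre (z ^+ 2).
Proof.
move=> z1; have : cnorm z ^+ 2 <= 1 by rewrite exprn_ile1 ?cnorm_ge0.
rewrite cnorm_sqr; case: z {z1} => a b /=; nra.
Qed.

Lemma re_prime_log_sum (g : nat -> R[i]) N : cre (prime_log_sum g N) =
  \sum_(1 <= p < N.+1 | prime p) cre (g p) * (ln p%:R / p%:R).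
Proof.
rewrite /prime_log_sum Re_sum; apply: eq_bigr => p pp.
have -> : g p / p%:R * (ln p%:R)%:C = g p * (ln p%:R / p%:R : R)%:C.
  by rewrite rmorphM fmorphV rmorph_nat -mulrA [_^-1 * _]mulrC.
by rewrite ReMr.
Qed.

Lemma psum_tail : ~ (chi =1 principal_character R q) -> forall M N, (N <= M)%N ->
  cnorm (psum chi M - psum chi N) <= 3 * q%:R / N.+1%:R.
Proof.
move=> nonpr M N NM; rewrite /psum (@big_cat_nat _ _ _ N.+1)//=.
rewrite addrAC subrr add0r.
have := @twist_tail R q chi chi_char chi_le1 nonpr 0 N.+1 M.+1 _ isT.
by rewrite normr0 twist0 => /(_ ler01).
Qed.

End NonvanishingComplex.

Section NonvanishingComplexCharacters.
Variables (R : realType) (q : nat).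

Lemma re_prime_log_sum_ub (chi : nat -> R[i]) :
  dirichlet_character q chi -> (forall n, cnorm (chi n) <= 1) ->
  ~ (chi =1 principal_character R q) ->
  exists C : R, exists N0, forall N, (N0 <= N)%N -> cre (prime_log_sum chi N) <= C.
Proof.
move=> chi_char chi_le1 nonpr.
have mul m n : (0 < m)%N -> (0 < n)%N -> chi (m * n)%N = chi m * chi n.
  by move=> _ _; case: chi_char.
have [[c c0 [N0 HN]]|van] := nonvanishing_dichotomy (psum_tail chi_char chi_le1 nonpr).
  exists ((7 * q%:R + 4 * (3 * q%:R)) / c), (maxn N0 1) => N.
  rewrite geq_max => /andP[N0N N1].
  apply: (le_trans (Re_le _)); rewrite ler_pdivlMr//.
  have : cnorm (psum chi N * prime_log_sum chi N) <= 7 * q%:R + 4 * (3 * q%:R).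
    apply: psum_mul_prime_log_sum => //.
      move=> a b a0; have := @twist_tail R q chi chi_char chi_le1 nonpr 0 a b.
      by rewrite normr0 twist0 => /(_ ler01 a0).
    have := @twist_ln_sum R q chi chi_char chi_le1 nonpr 0 N.
    by rewrite normr0 twist0 => /(_ ler01).
  apply: le_trans; rewrite cnormM mulrC ler_wpM2r ?cnorm_ge0//.
  exact: HN.
exists (3 * q%:R + 2), 1%N => N N1.
have := prime_log_sum_vanishing mul chi_le1 N1 (character1 chi_char) van.
move=> h; have := le_trans (Re_le _) h; rewrite ReD /=.
have := ln_nat_ge0 R N; lra.
Qed.

Lemma nonvanishing_complex (chi : nat -> R[i]) :
  dirichlet_character q chi -> (forall n, cnorm (chi n) <= 1) ->
  ~ (chi =1 principal_character R q) ->
  ~ ((fun n => chi n ^+ 2) =1 principal_character R q) ->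
  exists2 c : R, 0 < c & exists N0, forall N, (N0 <= N)%N -> c <= cnorm (psum chi N).
Proof.
move=> chi_char chi_le1 nonpr nonpr2.
have mul m n : (0 < m)%N -> (0 < n)%N -> chi (m * n)%N = chi m * chi n.
  by move=> _ _; case: chi_char.
have [//|van] := nonvanishing_dichotomy (psum_tail chi_char chi_le1 nonpr).
have [C [N0 HC]] := re_prime_log_sum_ub (character_pow_char chi_char (isT : (0 < 2)%N))
   (character_pow_le1 chi_le1 2) nonpr2.
(* The three sums of the inequality below are at most [3 ln N + 6], [- 4 ln N + 4 (3 q + 2)] and
   [C]; for a larger [ln N] their total is negative. *)
have [N [N0N N1 lnN]] := ln_unbounded (6 + 4 * (3 * q%:R + 2) + C) N0.
have := prime_log_sum_vanishing mul chi_le1 N1 (character1 chi_char) van.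
move=> h; have {}h := le_trans (Re_le _) h; move: h; rewrite ReD /= => h.
have h2 := HC N N0N; have h3 := mertens1_ub R N1.
have : 0 <= 3 * \sum_(1 <= p < N.+1 | prime p) ln p%:R / p%:R +
   4 * cre (prime_log_sum chi N) + cre (prime_log_sum (fun n => chi n ^+ 2) N).
  rewrite !re_prime_log_sum !mulr_sumr -!big_split /= sumr_ge0// => p pp.
  have := three_four_one (chi_le1 p); have : 0 <= ln p%:R / p%:R :> R.
    by rewrite divr_ge0// ln_nat_ge0.
  move: (ln p%:R / p%:R) (cre (chi p)) (cre (chi p ^+ 2)) => x a b; nra.
lra.
Qed.

End NonvanishingComplexCharacters.

(** * Riesz means and real characters *)

Section RieszCount.
Variable R : realType.
Implicit Types X d j : nat.

(* The smoothing by [X - n] makes the cofactor of [chi(d)] monotone in [d]; a sharp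
   cutoff would leave an error of the same order as the main term. *)
Definition riesz_count X d : R := \sum_(1 <= j < (X %/ d).+1) (X%:R - (d * j)%:R).

Lemma riesz_count_ge0 X d : 0 <= riesz_count X d.
Proof.
rewrite /riesz_count big_nat_cond sumr_ge0// => j /andP[/andP[_]]; rewrite ltnS => jX _.
by rewrite subr_ge0 ler_nat mulnC (leq_trans _ (leq_trunc_div X d))// leq_mul2r jX orbT.
Qed.

Lemma riesz_count_noninc X d : (0 < d)%N -> riesz_count X d.+1 <= riesz_count X d.
Proof.
move=> d0; rewrite /riesz_count [leRHS](@big_cat_nat _ _ _ (X %/ d.+1).+1)//=; last first.
  by rewrite ltnS leq_div2l.
rewrite -[leLHS]addr0; apply: lerD.
  by apply: ler_sum => j _; rewrite lerD2l lerN2 ler_nat leq_mul2r leqnSn orbT.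
rewrite big_nat_cond sumr_ge0// => j /andP[/andP[_]]; rewrite ltnS => jX _.
by rewrite subr_ge0 ler_nat mulnC (leq_trans _ (leq_trunc_div X d))// leq_mul2r jX orbT.
Qed.

Lemma riesz_count_ub X d : riesz_count X d <= X%:R ^+ 2 / d%:R.
Proof.
apply: (@le_trans _ _ (\sum_(1 <= j < (X %/ d).+1) X%:R)).
  by apply: ler_sum => j _; rewrite gerBl.
rewrite sumr_const_nat subSS subn0 -[X%:R *+ _]mulr_natr expr2 -mulrA ler_wpM2l//.
exact: natdiv_le.
Qed.

(** Writing [X = d K + rho], the difference is exactly [rho (d - rho) / (2 d)]; it is therefore
    bounded in terms of [d] alone. *)
Lemma riesz_count_approx X d : (0 < d)%N ->
  `|riesz_count X d - (X%:R ^+ 2 / (2 * d%:R) - X%:R / 2)| <= d%:R.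
Proof.
move=> d0; have d0' : 0 < d%:R :> R by rewrite ltr0n.
pose K := (X %/ d)%N; pose rho := (X %% d)%N.
have XE : X%:R = d%:R * K%:R + rho%:R :> R.
  by rewrite -natrM -natrD; congr (_%:R); rewrite mulnC -divn_eq.
have HE L : \sum_(1 <= j < L.+1) (X%:R - (d * j)%:R) =
   X%:R * L%:R - d%:R * L%:R * (L%:R + 1) / 2 :> R.
  elim: L => [|L IH]; first by rewrite big_geq// !mulr0 !mul0r subrr.
  by rewrite big_nat_recr//= IH natrM -[L.+1%:R]natr1; field.
have -> : riesz_count X d - (X%:R ^+ 2 / (2 * d%:R) - X%:R / 2) =
   rho%:R * (d%:R - rho%:R) / (2 * d%:R).
  by rewrite /riesz_count HE -/K XE; field; rewrite gt_eqF.
have rd : rho%:R <= d%:R :> R by rewrite ler_nat ltnW// ltn_pmod.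
rewrite ger0_norm; last by rewrite divr_ge0 ?mulr_ge0 ?subr_ge0 ?(ltW d0').
rewrite ler_pdivrMr ?mulr_gt0//.
have : 0 <= rho%:R :> R by [].
by move: (rho%:R) (d%:R) rd d0' => r e rd d0' r0; nra.
Qed.

End RieszCount.

Section QuadraticDivisorSum.
Variables (R : realType) (v : nat -> R).
Implicit Types (m n p a d : nat).
Hypothesis v1 : v 1%N = 1.
Hypothesis vM : forall m n, v (m * n)%N = v m * v n.
Hypothesis v_cases : forall n, [\/ v n = 0, v n = 1 | v n = -1].

Let vX p a : v (p ^ a)%N = v p ^+ a.
Proof. by elim: a => [|a IH]; rewrite ?expn0 ?expr0// expnS exprS vM IH. Qed.

Definition divisor_sum n : R := \sum_(d <- divisors n) v d.

Lemma divisor_sum_primeM p a m : prime p -> ~~ (p %| m)%N -> (0 < m)%N ->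
  divisor_sum (p ^ a * m) = (\sum_(0 <= j < a.+1) v p ^+ j) * divisor_sum m.
Proof.
move=> pp pm m0; elim: a => [|a IH]; first by rewrite big_nat1 expr0 mul1r mul1n.
rewrite /divisor_sum in IH *; rewrite sum_divisors_primeM// IH.
rewrite [in RHS]big_nat_recr//= mulrDl; congr (_ + _); rewrite mulr_sumr.
by apply: eq_bigr => d _; rewrite vM vX.
Qed.

Lemma geometric_sum_ge p a : (~~ odd a)%:R <= \sum_(0 <= j < a.+1) v p ^+ j.
Proof.
case: (v_cases p) => ->.
- by rewrite big_nat_recl//= expr0 big1 ?addr0 ?lern1 ?leq_b1// => j _; rewrite exprS mul0r.
- by rewrite big_nat_recl// expr0 -[leLHS]addr0 lerD ?lern1 ?leq_b1// sumr_ge0// => j _; rewrite expr1n.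
- rewrite le_eqVlt; apply/orP; left; apply/eqP; elim: a => [|a IH].
    by rewrite big_nat1 expr0.
  rewrite big_nat_recr//= -IH -signr_odd /=; case: (odd a) => /=.
    by rewrite expr0 add0r.
  by rewrite expr1 subrr.
Qed.

Lemma divisor_sum_ge0 n : (0 < n)%N -> 0 <= divisor_sum n.
Proof.
elim/prime_factorization_ind: n / => [|p a m pp pm m0 IH].
  by rewrite /divisor_sum big_seq1 v1.
rewrite divisor_sum_primeM// mulr_ge0//; apply: le_trans (geometric_sum_ge _ _).
exact: ler0n.
Qed.

Lemma divisor_sum_square n : (0 < n)%N -> 1 <= divisor_sum (n ^ 2).
Proof.
elim/prime_factorization_ind: n / => [|p a m pp pm m0 IH].
  by rewrite /divisor_sum big_seq1 v1.
rewrite expnMn -expnM divisor_sum_primeM ?expn_gt0 ?m0//; last first.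
  by rewrite Euclid_dvdX// negb_and pm.
rewrite -[1]mulr1; apply: ler_pM => //.
by apply: le_trans (geometric_sum_ge _ _); rewrite muln2 odd_double.
Qed.

Lemma sum_divisor_sum_riesz X :
  \sum_(1 <= n < X.+1) divisor_sum n * (X%:R - n%:R) =
  \sum_(1 <= d < X.+1) v d * riesz_count R X d.
Proof.
under eq_big_nat => n nN do
  rewrite /divisor_sum (sum_divisors _ nN) mulr_suml big_mkcond.
rewrite exchange_big_nat /=; apply: eq_big_nat => d /andP[d0 _].
by rewrite -big_mkcond -mulr_sumr sum_multiples.
Qed.

(** The squares [k ^ 2] with [k <= 4 m ^ 3] lie below [X / 4], so each of these [4 m ^ 3] terms is
    at least [32 m ^ 6]. The shape [X = 64 m ^ 6] keeps the bound on [k], as well as the later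
    splitting point of order [X ^ (2 / 3)], an integer. *)
Lemma riesz_mean_lb m : 
  128 * m%:R ^+ 9 <= \sum_(1 <= n < (64 * m ^ 6).+1) divisor_sum n * ((64 * m ^ 6)%:R - n%:R).
Proof.
set X := (64 * m ^ 6)%N.
have XE : X%:R = 64 * m%:R ^+ 6 :> R by rewrite natrM natrX.
have nonneg n : (1 <= n < X.+1)%N -> 0 <= divisor_sum n * (X%:R - n%:R).
  by case/andP=> n0 nX; rewrite mulr_ge0 ?divisor_sum_ge0// subr_ge0 ler_nat.
apply: (@le_trans _ _ (\sum_(n <- [seq (k ^ 2)%N | k <- index_iota 1 (4 * m ^ 3).+1])
   divisor_sum n * (X%:R - n%:R))).
  rewrite big_map; apply: (@le_trans _ _ (\sum_(1 <= k < (4 * m ^ 3).+1) (32 * m%:R ^+ 6))).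
    rewrite sumr_const_nat subSS subn0 -[_ * _ *+ _]mulr_natr natrM natrX.
    by rewrite le_eqVlt; apply/orP; left; apply/eqP; ring.
  apply: ler_sum_nat => k /andP[k0 km].
  have k2 : (k ^ 2)%:R <= 16 * m%:R ^+ 6 :> R.
    rewrite -[16]/(16%:R) -natrX -natrM ler_nat.
    have -> : (16 * m ^ 6 = (4 * m ^ 3) ^ 2)%N by rewrite expnMn -expnM.
    by rewrite leq_exp2r.
  have m6 : 0 <= m%:R ^+ 6 :> R by rewrite exprn_ge0.
  rewrite -[leLHS]mul1r; apply: ler_pM; rewrite ?mulr_ge0//.
    exact: divisor_sum_square.
  by rewrite XE; move: k2 m6; move: (m%:R ^+ 6) => z; lra.
apply: ler_sum_subset.
- by rewrite map_inj_uniq ?iota_uniq// => x y /eqP; rewrite eqn_exp2r//= => /eqP.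
- exact: iota_uniq.
- move=> _ /mapP[k + ->]; rewrite !mem_index_iota => /andP[k0 km].
  rewrite expn_gt0 k0 /= ltnS (@leq_trans ((4 * m ^ 3) ^ 2)) ?leq_exp2r//.
  by rewrite expnMn -expnM leq_mul2r orbT.
- by move=> n; rewrite mem_index_iota; exact: nonneg.
Qed.

End QuadraticDivisorSum.

Section NonvanishingReal.
Variables (R : realType) (q : nat).

(* If the series vanished, the Riesz means of [\sum_(d | n) chi(d)] up to [X = 64 m ^ 6]
   would be [O(X ^ (4 / 3))], by splitting the sum over [d] at [m ^ 4]; the squares
   alone contribute at least [X ^ (3 / 2) / 4]. *)
Lemma nonvanishing_real (chi : nat -> R[i]) :
  dirichlet_character q chi -> (forall n, cnorm (chi n) <= 1) ->
  ~ (chi =1 principal_character R q) ->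
  ((fun n => chi n ^+ 2) =1 principal_character R q) ->
  exists2 c : R, 0 < c & exists N0, forall N, (N0 <= N)%N -> c <= cnorm (psum chi N).
Proof.
move=> chi_char chi_le1 nonpr pr2.
have [//|van] := nonvanishing_dichotomy (psum_tail chi_char chi_le1 nonpr).
exfalso.
have chi_cases n : [\/ chi n = 0, chi n = 1 | chi n = -1].
  have := pr2 n; rewrite /principal_character; case: (coprime n q) => /= /eqP.
    by rewrite sqrf_eq1 => /orP[] /eqP ->; [constructor 2|constructor 3].
  by rewrite sqrf_eq0 => /eqP ->; constructor 1.
pose v n : R := cre (chi n).
have vE n : chi n = (v n)%:C.
  rewrite /v; case: (chi_cases n) => -> //=.
  by apply/eqP; rewrite eq_complex /= oppr0 !eqxx.
have v_cases n : [\/ v n = 0, v n = 1 | v n = -1].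
  by rewrite /v; case: (chi_cases n) => ->; [constructor 1|constructor 2|constructor 3].
have v1 : v 1%N = 1 by rewrite /v (character1 chi_char).
have vM m n : v (m * n)%N = v m * v n.
  have mul : chi (m * n)%N = chi m * chi n by case: chi_char.
  by rewrite {1}/v mul !vE -rmorphM.
have v_le1 n : `|v n| <= 1.
  by case: (v_cases n) => ->; rewrite ?normr0 ?normrN ?normr1.
have realsum (g : nat -> R) a b :
    `|\sum_(a <= n < b) v n * g n| = cnorm (\sum_(a <= n < b) chi n * (g n)%:C).
  rewrite -cnorm_real rmorph_sum; congr cnorm; apply: eq_bigr => n _.
  by rewrite rmorphM vE.
pose B : R := 3 * q%:R.
have B0 : 0 <= B by rewrite mulr_ge0.
have q0 : 0 <= q%:R :> R by [].
(* The four constants belong, in order, to the vanishing series up to [D = m ^ 4], the character sum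
   against [X / 2], the approximation error [D ^ 2], and the tail [X ^ 2 / D]. *)
have key m : (0 < m)%N -> 128 * m%:R ^+ 9 <= (2048 * B + 32 * q%:R + 1 + 4096 * q%:R) * m%:R ^+ 8.
  move=> m0; have m0' : 1 <= m%:R :> R by rewrite ler1n.
  apply: (le_trans (riesz_mean_lb v1 vM v_cases m)).
  set X := (64 * m ^ 6)%N; pose D := (m ^ 4)%N.
  have XE : X%:R = 64 * m%:R ^+ 6 :> R by rewrite natrM natrX.
  have DE : D%:R = m%:R ^+ 4 :> R by rewrite natrX.
  have D0 : (0 < D)%N by rewrite expn_gt0 m0.
  have D0' : 0 < D%:R :> R by rewrite ltr0n.
  have DX : (D < X)%N.
    apply: (@leq_ltn_trans (m ^ 6)); first exact: leq_pexp2l.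
    by rewrite /X ltn_Pmull// expn_gt0 m0.
  clearbody X D; rewrite sum_divisor_sum_riesz (@big_cat_nat _ _ _ D.+1)//=; last by rewrite ltnS ltnW.
  (* As [riesz_count] decreases in [d], its variation beyond [D] telescopes, and with the endpoint
     amounts to [riesz_count X (D + 1) <= X ^ 2 / D]. *)
  have tail : \sum_(D.+1 <= d < X.+1) v d * riesz_count R X d <= q%:R * (4096 * m%:R ^+ 8).
    apply: (le_trans (ler_norm _)); rewrite realsum.
    apply: (le_trans (character_abel chi_char chi_le1 nonpr _ DX)).
    rewrite ler_wpM2l//.
    apply: (@le_trans _ _ (riesz_count R X X + \sum_(D.+1 <= d < X)
         (- riesz_count R X d.+1 - - riesz_count R X d))).
      apply: lerD; first by rewrite cnorm_real ger0_norm// riesz_count_ge0.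
      apply: ler_sum_nat => d /andP[Dd _]; rewrite -rmorphB cnorm_real ger0_norm.
        by rewrite opprK addrC.
      by rewrite subr_ge0 riesz_count_noninc// (leq_trans _ Dd).
    rewrite (telescope_sumr (fun d => - riesz_count R X d))// opprK addrA subrr add0r.
    apply: (le_trans (riesz_count_ub _ _ _)).
    apply: (@le_trans _ _ (X%:R ^+ 2 / D%:R)).
      by rewrite ler_wpM2l ?sqr_ge0// lef_pV2 ?posrE ?ltr0n// ler_nat.
    rewrite ler_pdivrMr// XE DE le_eqVlt; apply/orP; left; apply/eqP; ring.
  have head : \sum_(1 <= d < D.+1) v d * riesz_count R X d <=
     X%:R ^+ 2 / 2 * (B / D%:R) + X%:R / 2 * q%:R + D%:R * D%:R.
    (* The main term [X ^ 2 / (2 d)] meets the vanishing series, the term [X / 2] meets a bounded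
       character sum, and the remaining error is at most [d <= D] for each [d]. *)
    have -> : \sum_(1 <= d < D.+1) v d * riesz_count R X d =
       X%:R ^+ 2 / 2 * \sum_(1 <= d < D.+1) v d * d%:R^-1 +
       X%:R / 2 * - (\sum_(1 <= d < D.+1) v d * 1) +
       \sum_(1 <= d < D.+1) v d * (riesz_count R X d - (X%:R ^+ 2 / (2 * d%:R) - X%:R / 2)).
      rewrite -sumrN !mulr_sumr -!big_split /=; apply: eq_big_nat => d /andP[d0 _].
      by field; rewrite pnatr_eq0 -lt0n.
    apply: lerD; first apply: lerD.
    - rewrite ler_wpM2l ?divr_ge0 ?sqr_ge0//.
      apply: (le_trans (ler_norm _)); rewrite realsum.
      under eq_bigr do rewrite fmorphV rmorph_nat.
      apply: (le_trans (van D)); rewrite ler_wpM2l// lef_pV2 ?posrE ?ltr0n//.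
      by rewrite ler_nat.
    - rewrite ler_wpM2l ?divr_ge0//; apply: (le_trans (ler_norm _)); rewrite normrN realsum.
      under eq_bigr do rewrite rmorph1 mulr1.
      exact: (character_sum_bound chi_char chi_le1 nonpr).
    - apply: (@le_trans _ _ (\sum_(1 <= d < D.+1) D%:R)); last first.
        by rewrite sumr_const_nat subSS subn0 mulr_natr.
      apply: ler_sum_nat => d /andP[d0 dD]; apply: (le_trans (ler_norm _)).
      rewrite normrM -[leRHS]mul1r; apply: ler_pM => //.
      by apply: (le_trans (riesz_count_approx R X d0)); rewrite ler_nat.
  apply: (le_trans (lerD head tail)).
  have -> : X%:R ^+ 2 / 2 * (B / D%:R) = 2048 * B * m%:R ^+ 8.
    by rewrite XE DE; field; rewrite gt_eqF// (lt_le_trans ltr01).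
  rewrite XE DE.
  have m68 : m%:R ^+ 6 <= m%:R ^+ 8 :> R by rewrite ler_weXn2l.
  have : m%:R ^+ 4 * m%:R ^+ 4 = m%:R ^+ 8 :> R by rewrite -exprD.
  have := ler_wpM2l q0 m68.
  move: (m%:R ^+ 6) (m%:R ^+ 8) (m%:R ^+ 4 * m%:R ^+ 4) => a b c; lra.
pose C := 2048 * B + 32 * q%:R + 1 + 4096 * q%:R.
have [m [_ m0 /ltW Cm]] : exists m, [/\ True, (0 < m)%N & C < m%:R].
  exists (Num.truncn C).+1; split => //; exact: truncnS_gt.
have := key m m0; rewrite -/C exprS mulrA ler_pM2r ?exprn_gt0 ?ltr0n//.
have : 0 < m%:R :> R by rewrite ltr0n.
lra.
Qed.

Lemma nonvanishing (chi : nat -> R[i]) :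
  dirichlet_character q chi -> (forall n, cnorm (chi n) <= 1) ->
  ~ (chi =1 principal_character R q) ->
  exists2 c : R, 0 < c & exists N0, forall N, (N0 <= N)%N -> c <= cnorm (psum chi N).
Proof.
move=> chi_char chi_le1 nonpr.
case: (pselect ((fun n => chi n ^+ 2) =1 principal_character R q)) => h.
  exact: nonvanishing_real.
exact: (nonvanishing_complex chi_char).
Qed.

End NonvanishingReal.

(** * Prime sums of characters *)

Section PrimeSumsOfCharacters.
Variables (R : realType).
Implicit Types (n N p k : nat).

(** Abel summation against the decreasing factor [1 / ln n]: its variation on [[2, N]] and its value
    at [N] add up to [1 / ln 2]. *)
Lemma prime_sum_of_log_sum (a : nat -> R) (C : R) :
  (forall N, `|\sum_(1 <= p < N.+1 | prime p) a p * (ln p%:R / p%:R)| <= C) ->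
  forall N, `|\sum_(1 <= p < N.+1 | prime p) a p / p%:R| <= C / ln 2.
Proof.
move=> H N; have C0 : 0 <= C by apply: le_trans (H 0%N).
have l2 : 0 < ln 2 :> R by rewrite ln_gt0// ltr1n.
have [N1|N1] := ltnP 1 N; last first.
  rewrite primes_from2 big_geq// normr0 divr_ge0//; exact: ltW.
have lN := ln_nat_gt0 R N1.
have H2 M : `|\sum_(2 <= p < M.+1) (if prime p then a p * (ln p%:R / p%:R) else 0)| <= C.
  by rewrite -primes_from2.
have -> : \sum_(1 <= p < N.+1 | prime p) a p / p%:R =
   \sum_(2 <= p < N.+1) (if prime p then a p * (ln p%:R / p%:R) else 0) * (ln p%:R)^-1.
  rewrite primes_from2; apply: eq_big_nat => p /andP[p1 _]; case: ifP => _; last by rewrite mul0r.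
  by rewrite -!mulrA [_^-1 * _]mulrC [ln _ * _]mulrA divff ?mul1r// gt_eqF// ln_nat_gt0.
rewrite abel_sum//; apply: (le_trans (ler_normD _ _)).
apply: (@le_trans _ _ (C * (ln N%:R)^-1 + \sum_(2 <= n < N) C * ((ln n%:R)^-1 - (ln n.+1%:R)^-1))).
  apply: lerD.
    by rewrite normrM [X in _ * X]gtr0_norm ?invr_gt0// ler_pM2r ?invr_gt0.
  apply: (le_trans (ler_norm_sum _ _ _)); apply: ler_sum_nat => n /andP[n1 _].
  have d0 := inv_ln_decr R n1.
  by rewrite normrM [X in _ * X]ger0_norm// ler_wpM2r.
by rewrite -mulr_sumr sum_inv_ln_decr// -mulrDr addrC subrK.
Qed.

Variables (q : nat) (chi : nat -> R[i]).
Hypothesis chi_char : dirichlet_character q chi.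
Hypothesis chi_le1 : forall n, cnorm (chi n) <= 1.
Hypothesis nonpr : ~ (chi =1 principal_character R q).

Lemma psum_twist_tail xi M N : `|xi| <= 1 -> (N <= M)%N ->
  cnorm (psum (twist chi xi) M - psum (twist chi xi) N) <= 3 * q%:R / N.+1%:R.
Proof.
move=> xi1 NM; rewrite /psum (@big_cat_nat _ _ _ N.+1)//=.
by rewrite addrAC subrr add0r; apply: twist_tail.
Qed.

Lemma psum_twist_continuous xi N :
  cnorm (psum (twist chi xi) N - psum chi N) <=
  2 * `|xi| * \sum_(1 <= n < N.+1) ln n%:R / n%:R.
Proof.
rewrite /psum -sumrB mulr_sumr; apply: (le_trans (cnorm_sum _ _ _)).
apply: ler_sum => n _; have -> : twist chi xi n / n%:R - chi n / n%:R = chi n * (cis (xi * ln n%:R) - cis 0) / n%:R.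
  by rewrite cis0 mulrBr mulr1 mulrBl.
rewrite !cnormM cnormV cnorm_nat mulrA ler_wpM2r//.
rewrite -[leRHS]mul1r; apply: ler_pM; rewrite ?cnorm_ge0//.
apply: (le_trans (cis_lip _ _)); rewrite subr0 normrM mulrA.
by rewrite [X in _ * X <= _]ger0_norm ?ln_nat_ge0.
Qed.

(** At a fixed large [Y] the tail is at most [c1 / 4], uniformly in [|xi| <= 1]; for small [xi] the
    finite sum up to [Y] moves by at most [c1 / 4] from its value at [xi = 0]. This leaves [c1 / 2]
    for all [N >= Y]. *)
Lemma psum_twist_lb : exists2 c0 : R, 0 < c0 <= 1 & exists2 c : R, 0 < c &
  exists N0, forall xi, `|xi| <= c0 -> forall N, (N0 <= N)%N ->
    c <= cnorm (psum (twist chi xi) N).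
Proof.
have [c1 c10 [N0 HN0]] := nonvanishing chi_char chi_le1 nonpr.
pose Y := maxn N0 (Num.truncn (12 * q%:R / c1)).+1.
pose K : R := \sum_(1 <= n < Y.+1) ln n%:R / n%:R.
have K0 : 0 <= K by rewrite sumr_ge0// => n _; rewrite divr_ge0 ?ln_nat_ge0.
pose c0 := Num.min 1 (c1 / (8 * (K + 1))).
have K1 : 0 < 8 * (K + 1) by lra.
exists c0.
  by rewrite /c0 lt_min ltr01 divr_gt0//= ge_min lexx.
exists (c1 / 2); first by rewrite divr_gt0.
exists Y => xi xic N YN.
have xi1 : `|xi| <= 1 by apply: (le_trans xic); rewrite ge_min lexx.
have h1 := psum_twist_tail xi1 YN.
have h2 := psum_twist_continuous xi Y.
have h3 := HN0 Y (leq_maxl _ _).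
have h4 : 3 * q%:R / Y.+1%:R <= c1 / 4.
  rewrite ler_pdivrMr ?ltr0n//.
  have : 12 * q%:R / c1 <= Y.+1%:R.
    apply: (@le_trans _ _ Y%:R); last by rewrite ler_nat.
    apply: (@le_trans _ _ (Num.truncn (12 * q%:R / c1)).+1%:R); first exact/ltW/truncnS_gt.
    by rewrite ler_nat leq_maxr.
  rewrite ler_pdivrMr//; lra.
have h5 : 2 * `|xi| * K <= c1 / 4.
  have : `|xi| <= c1 / (8 * (K + 1)) by apply: (le_trans xic); rewrite ge_min lexx orbT.
  rewrite ler_pdivlMr//; have := normr_ge0 xi; move: (`|xi|) => z; nra.
have h6 := cnorm_subr_le (psum chi Y) (psum (twist chi xi) Y).
have h7 := cnorm_subr_le (psum (twist chi xi) Y) (psum (twist chi xi) N).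
rewrite cnorm_distC in h6; rewrite cnorm_distC in h7.
have h1' := le_trans h1 h4; have h2' := le_trans h2 h5.
move: h1' h2' h6 h7 h3 {h1 h2 h4 h5}; lra.
Qed.

Lemma twisted_prime_sum : exists2 c0 : R, 0 < c0 <= 1 & exists C : R,
  forall xi, `|xi| <= c0 -> forall N,
    `|\sum_(1 <= p < N.+1 | prime p) cre (twist chi xi p) / p%:R| <= C.
Proof.
have [c0 c01 [c c_gt0 [N0 HN]]] := psum_twist_lb; exists c0 => //.
pose Y := maxn N0 1.
pose C1 := (7 * q%:R + 4 * (3 * q%:R)) / c.
pose C2 : R := ln Y%:R + 2.
exists (Num.max C1 C2 / ln 2) => xi xic; apply: prime_sum_of_log_sum => N.
have xi1 : `|xi| <= 1 by apply: (le_trans xic); case/andP: c01.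
have mul m n : (0 < m)%N -> (0 < n)%N -> twist chi xi (m * n)%N = twist chi xi m * twist chi xi n.
  exact: twistM chi_char.
have le1 := twist_norm_le1 xi chi_le1.
have [NY|YN] := leqP N Y; last first.
  rewrite le_max; apply/orP; left.
  have N1 : (0 < N)%N by rewrite (leq_ltn_trans _ YN).
  rewrite -re_prime_log_sum; apply: (le_trans (normr_Re_le _)).
  rewrite ler_pdivlMr//.
  have := psum_mul_prime_log_sum mul le1 N1 (fun a b => @twist_tail _ _ _ chi_char chi_le1 nonpr xi a b xi1)
    (twist_ln_sum chi_char chi_le1 nonpr N xi1).
  apply: le_trans; rewrite cnormM mulrC ler_wpM2r ?cnorm_ge0//.
  by apply: HN => //; apply: leq_trans (ltnW YN); rewrite leq_maxl.
rewrite le_max; apply/orP; right.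
apply: (le_trans (ler_norm_sum _ _ _)).
apply: (@le_trans _ _ (\sum_(1 <= p < Y.+1 | prime p) ln p%:R / p%:R)); last first.
  by apply: mertens1_ub; rewrite leq_maxr.
rewrite [leRHS](@big_cat_nat _ _ _ N.+1)//= -[leLHS]addr0; apply: lerD.
  apply: ler_sum => p _; rewrite normrM [X in _ * X]ger0_norm ?divr_ge0 ?ln_nat_ge0//.
  rewrite ler_piMl ?divr_ge0 ?ln_nat_ge0//.
  exact: le_trans (normr_Re_le _) (le1 p).
by rewrite sumr_ge0// => p _; rewrite divr_ge0 ?ln_nat_ge0.
Qed.

Lemma sum_prime_divisors_le N : (0 < q)%N ->
  \sum_(1 <= p < N.+1 | prime p) (~~ coprime p q)%:R / p%:R <= q%:R :> R.
Proof.
move=> q0; have term n : (0 < n)%N -> (~~ coprime n q)%:R / n%:R <= 1 :> R.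
  move=> n0; rewrite ler_pdivrMr ?ltr0n// mul1r ler_nat.
  by apply: leq_trans n0; case: (~~ _).
apply: (@le_trans _ _ (\sum_(1 <= p < (maxn N q).+1 | prime p) (~~ coprime p q)%:R / p%:R)).
  rewrite [leRHS](@big_cat_nat _ _ _ N.+1)//=; last by rewrite ltnS leq_maxl.
  by rewrite lerDl sumr_ge0// => p _; rewrite divr_ge0.
rewrite (@big_cat_nat _ _ _ q.+1)//=; last by rewrite ltnS leq_maxr.
rewrite [X in _ + X]big_nat_cond [X in _ + X]big1 ?addr0; last first.
  move=> p /andP[/andP[qp _] pp]; rewrite prime_coprime//.
  have -> : (p %| q)%N = false by apply: gtnNdvd.
  by rewrite mul0r.
apply: (@le_trans _ _ (\sum_(1 <= p < q.+1) 1)).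
  rewrite big_mkcond; apply: ler_sum_nat => p /andP[p0 _]; case: ifP => // _; exact: term.
by rewrite sumr_const_nat subSS subn0.
Qed.

End PrimeSumsOfCharacters.

(** * Orthogonality over the powers of a character *)

Section CharacterOrder.
Variables (R : realType) (q r : nat) (chi : nat -> R[i]).
Hypothesis chi_char : dirichlet_character q chi.
Hypothesis chi_order : character_order q chi r.

Lemma character_norm n : cnorm (chi n) = (coprime n q)%:R.
Proof.
case: chi_order => r0 pr _; have := pr n; rewrite /principal_character => e.
have := congr1 (@ComplexField.Normc.normc R) e; rewrite cnormX cnorm_nat.
case: (coprime n q) => /=.
  by move/eqP; rewrite pexpr_eq1 ?cnorm_ge0// => /eqP.
by move/eqP; rewrite expf_eq0 r0 => /eqP.
Qed.

Lemma character_norm_le1 n : cnorm (chi n) <= 1.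
Proof. by rewrite character_norm lern1 leq_b1. Qed.

Lemma character_pow_nonprincipal k : (0 < k < r)%N ->
  ~ ((fun n => chi n ^+ k) =1 principal_character R q).
Proof.
case/andP=> k0 kr h; case: chi_order => _ _ /(_ k k0 h).
by rewrite leqNgt kr.
Qed.

Lemma sum_character_pow n : coprime n q -> chi n != 1 -> \sum_(k < r) chi n ^+ k = 0.
Proof.
move=> nq c1; case: chi_order => r0 /(_ n); rewrite /principal_character nq => e _.
have := subrX1 (chi n) r; rewrite e subrr => /esym/eqP; rewrite mulf_eq0 subr_eq0.
by rewrite (negPf c1) => /eqP.
Qed.

(** The mean of [chi p ^+ k] over [k < r] detects [chi p = 1] when [p] is prime to [q]. Each [k]
    with [0 < k < r] yields a nonprincipal character, hence a bounded prime sum; [k = 0] yields the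
    main term. *)
Lemma prime_sum_character_eq1 : exists C : R, forall N,
  (\sum_(1 <= p < N.+1 | prime p) p%:R^-1) / r%:R - C <=
  \sum_(1 <= p < N.+1 | prime p) (chi p == 1)%:R / p%:R.
Proof.
have r0 : (0 < r)%N by case: chi_order.
have r0' : 0 < r%:R :> R by rewrite ltr0n.
have q0 : (0 < q)%N by case: chi_char.
have /boolp.choice[C HC] : forall k : nat, exists c : R, (0 < k < r)%N -> forall N,
    `|\sum_(1 <= p < N.+1 | prime p) cre (chi p ^+ k) / p%:R| <= c.
  move=> k.
  case: (boolP (0 < k < r)%N) => [kr|]; last by exists 0.
  have k0 : (0 < k)%N by case/andP: kr.
  have [c0 /andP[c00 _] [C HC]] := twisted_prime_sum (character_pow_char chi_char k0)
    (character_pow_le1 character_norm_le1 k) (character_pow_nonprincipal kr).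
  exists C => _ N; have := HC 0; rewrite normr0 => /(_ (ltW c00) N).
  by rewrite twist0.
exists (\sum_(1 <= k < r) C k + q%:R) => N.
(* At [p | q] the mean is [1 / r] instead of [0], because [chi p ^+ 0 = 1]; the subtracted indicator
   absorbs it. *)
have pt p : prime p ->
   r%:R^-1 * (1 + \sum_(1 <= k < r) cre (chi p ^+ k)) - (~~ coprime p q)%:R <= (chi p == 1)%:R.
  move=> pp; have e : 1 + \sum_(1 <= k < r) cre (chi p ^+ k) = cre (\sum_(k < r) chi p ^+ k).
    by rewrite Re_sum -(big_mkord xpredT (fun k => cre (chi p ^+ k))) big_ltn// expr0.
  rewrite e; case: (boolP (coprime p q)) => pq /=.
    case: eqP => [->|/eqP c1]; last by rewrite sum_character_pow// mulr0 subr0.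
    rewrite Re_sum (eq_bigr (fun=> 1)); last by move=> k _; rewrite expr1n.
    by rewrite sumr_const card_ord mulVf ?gt_eqF// subr0.
  have c0 : chi p = 0.
    by apply/eqP; rewrite -cnorm_eq0 character_norm (negPf pq).
  rewrite c0 -(big_mkord xpredT (fun k => 0 ^+ k)) big_ltn// expr0 big_nat_cond big1 ?addr0; last first.
    by move=> k /andP[/andP[k0 _] _]; rewrite expr0n gtn_eqF.
  rewrite mulr1 (le_trans (y := 0))// subr_le0 invf_le1// ler1n//.
apply: (@le_trans _ _ (\sum_(1 <= p < N.+1 | prime p)
   (r%:R^-1 * (1 + \sum_(1 <= k < r) cre (chi p ^+ k)) - (~~ coprime p q)%:R) / p%:R)); last first.
  by apply: ler_sum => p pp; rewrite ler_wpM2r ?invr_ge0// pt.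
have -> : \sum_(1 <= p < N.+1 | prime p)
   (r%:R^-1 * (1 + \sum_(1 <= k < r) cre (chi p ^+ k)) - (~~ coprime p q)%:R) / p%:R =
   (\sum_(1 <= p < N.+1 | prime p) p%:R^-1) / r%:R +
   r%:R^-1 * (\sum_(1 <= k < r) \sum_(1 <= p < N.+1 | prime p) cre (chi p ^+ k) / p%:R) -
   \sum_(1 <= p < N.+1 | prime p) (~~ coprime p q)%:R / p%:R.
  rewrite exchange_big_nat mulr_sumr mulr_suml -big_split -sumrB /=.
  apply: eq_bigr => p _; rewrite -mulr_suml; ring.
rewrite -addrA lerD2l opprD; apply: lerD; last first.
  by rewrite lerN2 sum_prime_divisors_le.
rewrite lerNl -mulrN.
apply: (@le_trans _ _ (`|- \sum_(1 <= k < r) \sum_(1 <= p < N.+1 | prime p) cre (chi p ^+ k) / p%:R|)).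
  apply: (@le_trans _ _ (r%:R^-1 * `|- \sum_(1 <= k < r) \sum_(1 <= p < N.+1 | prime p) cre (chi p ^+ k) / p%:R|)).
    by rewrite ler_wpM2l ?invr_ge0 ?(ltW r0')// ler_norm.
  by rewrite ler_piMl// invf_le1// ler1n.
rewrite normrN; apply: (le_trans (ler_norm_sum _ _ _)).
by apply: ler_sum_nat => k kr; exact: HC.
Qed.

End CharacterOrder.

(** * Logarithmic means over squarefree integers *)

Section SquarefreeSums.
Variables (R : realType).
Implicit Types (m n N p w d : nat) (h : nat -> R).

Definition sqfree_weight h m : R :=
  (mobius m)%:~R ^+ 2 * (\prod_(p <- primes m) h p) / m%:R.

Lemma sqfree_weight1 h : sqfree_weight h 1 = 1.
Proof. by rewrite /sqfree_weight (_ : primes 1 = [::])// big_nil mobius1 mulr1z expr1n divr1 mulr1. Qed.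

Lemma prod_primes_primeM h p m : prime p -> ~~ (p %| m)%N -> (0 < m)%N ->
  \prod_(l <- primes (p * m)) h l = h p * \prod_(l <- primes m) h l.
Proof.
move=> pp pm m0; have := primes_primeM 0 pp pm m0; rewrite expn1 => e.
by rewrite (perm_big _ e) big_cons.
Qed.

Lemma sqfree_weight_primeM h p m : prime p -> ~~ (p %| m)%N -> (0 < m)%N ->
  sqfree_weight h (p * m) = h p / p%:R * sqfree_weight h m.
Proof.
move=> pp pm m0; rewrite /sqfree_weight mobius_primeM// prod_primes_primeM//.
rewrite rmorphN sqrrN natrM invfM; ring.
Qed.

Lemma sqfree_weight_ge0 h m : (forall p, prime p -> 0 <= h p) -> 0 <= sqfree_weight h m.
Proof.
move=> h0; rewrite /sqfree_weight divr_ge0// mulr_ge0 ?sqr_ge0//.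
by rewrite big_seq prodr_ge0// => p; rewrite mem_primes => /andP[pp _]; exact: h0.
Qed.

Definition primorial w : nat := \prod_(1 <= p < w.+1 | prime p) p.

Lemma primorial0 : primorial 0 = 1%N.
Proof. by rewrite /primorial big_geq. Qed.

Lemma primorialS w : primorial w.+1 = if prime w.+1 then (w.+1 * primorial w)%N else primorial w.
Proof.
rewrite /primorial big_nat_recr_cond//=; case: ifP => _; last by rewrite muln1.
by rewrite mulnC.
Qed.

Lemma primorial_gt0 w : (0 < primorial w)%N.
Proof. by rewrite prodn_cond_gt0// => p /prime_gt0. Qed.

Lemma prime_dvd_primorial w p : prime p -> (p %| primorial w)%N = (p <= w)%N.
Proof.
move=> pp; elim: w => [|w IH].
  by rewrite primorial0 Euclid_dvd1// leqNgt prime_gt0.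
rewrite primorialS leq_eqVlt ltnS -IH; case: ifPn => wp.
  by rewrite Euclid_dvdM// dvdn_prime2.
by case: eqP => // pw; move: wp; rewrite -pw pp.
Qed.

Lemma sum_primorial h w :
  \sum_(d <- divisors (primorial w)) sqfree_weight h d =
  \prod_(1 <= p < w.+1 | prime p) (1 + h p / p%:R).
Proof.
elim: w => [|w IH]; first by rewrite primorial0 big_geq// big_seq1 sqfree_weight1.
rewrite primorialS big_nat_recr_cond//=; case: ifPn => pp; last by rewrite IH mulr1.
have pw : ~~ (w.+1 %| primorial w)%N by rewrite prime_dvd_primorial// ltnn.
have := sum_divisors_primeM (sqfree_weight h) 0 pp pw (primorial_gt0 w).
rewrite expn1 expn0 mul1n => ->; rewrite -IH mulrDr mulr1; congr (_ + _).
rewrite mulr_suml big_seq [RHS]big_seq; apply: eq_bigr => d.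
rewrite -dvdn_divisors ?primorial_gt0// => dw.
rewrite sqfree_weight_primeM// ?(dvdn_gt0 (primorial_gt0 w))//; first by rewrite mulrC.
by apply: contraNN pw => /dvdn_trans; apply.
Qed.

(* The divisors [d > N] of the primorial have total weight at most this first moment
   divided by [log N]; this replaces Rankin's trick. *)
Lemma sum_primorial_log h w : (forall p, prime p -> 0 <= h p) ->
  \sum_(d <- divisors (primorial w)) sqfree_weight h d * ln d%:R <=
  (\sum_(1 <= p < w.+1 | prime p) h p * (ln p%:R / p%:R)) *
  \prod_(1 <= p < w.+1 | prime p) (1 + h p / p%:R).
Proof.
move=> h0; elim: w => [|w IH].
  by rewrite primorial0 [X in X * _]big_geq// big_seq1 ln1 mulr0 mul0r.
rewrite primorialS [X in X * _]big_nat_recr_cond//= [X in _ * X]big_nat_recr_cond//=.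
case: ifPn => pp; last by rewrite addr0 mulr1.
have pw : ~~ (w.+1 %| primorial w)%N by rewrite prime_dvd_primorial// ltnn.
have := sum_divisors_primeM (fun d => sqfree_weight h d * ln d%:R) 0 pp pw (primorial_gt0 w).
rewrite expn1 expn0 mul1n => ->.
have -> : \sum_(e <- divisors (primorial w)) sqfree_weight h (w.+1 * e) * ln (w.+1 * e)%:R =
   h w.+1 / w.+1%:R * (ln w.+1%:R * \sum_(e <- divisors (primorial w)) sqfree_weight h e +
     \sum_(e <- divisors (primorial w)) sqfree_weight h e * ln e%:R).
  rewrite !mulr_sumr -big_split mulr_sumr big_seq [RHS]big_seq /=; apply: eq_bigr => d.
  rewrite -dvdn_divisors ?primorial_gt0// => dw.
  have d0 : (0 < d)%N := dvdn_gt0 (primorial_gt0 w) dw.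
  rewrite sqfree_weight_primeM// ?ln_natM//.
    by rewrite [ln w.+1%:R * _]mulrC -mulrDr mulrA.
  by apply: contraNN pw => /dvdn_trans; apply.
rewrite sum_primorial; move: IH; have a0 : 0 <= h w.+1 / w.+1%:R by rewrite divr_ge0 ?h0.
have l0 := ln_nat_ge0 R w.+1.
have P0 : 0 <= \prod_(1 <= p < w.+1 | prime p) (1 + h p / p%:R).
  by apply: prodr_ge0 => p p_pr; rewrite addr_ge0// divr_ge0// h0.
rewrite [h w.+1 * (ln _ / _)]mulrCA; move: (h w.+1 / _) a0 l0 P0.
move: (\sum_(_ <- _) _) (\sum_(_ <= _ < _ | _) _) (\prod_(_ <= _ < _ | _) _) (ln w.+1%:R).
move=> E S P l a a0 l0 P0 IH.
have h1 : (1 + a) * E <= (1 + a) * (S * P) by rewrite ler_wpM2l// addr_ge0.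
have h2 : 0 <= a * a * l * P by rewrite !mulr_ge0.
nra.
Qed.

Lemma sqfree_dvd_primorial m N : (0 < m <= N)%N -> mobius m != 0 -> (m %| primorial N)%N.
Proof.
case/andP; elim/prime_factorization_ind: m / => // p a m pp pm m0 IH mN.
case: a mN => [|a] mN; last first.
  by rewrite -[a.+2]add2n expnD -mulnA mobius_square// eqxx.
rewrite expn1 in mN *; rewrite mobius_primeM// oppr_eq0 => mu.
have p0 := prime_gt0 pp.
rewrite Gauss_dvd ?prime_coprime// prime_dvd_primorial// IH// ?andbT.
  by rewrite (leq_trans _ mN)// leq_pmulr.
by rewrite (leq_trans _ mN)// leq_pmull.
Qed.

Lemma sqfree_sum_ub h N : (forall p, prime p -> 0 <= h p) ->
  \sum_(1 <= m < N.+1) sqfree_weight h m <=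
  expR (\sum_(1 <= p < N.+1 | prime p) h p / p%:R).
Proof.
move=> h0; apply: (@le_trans _ _ (\prod_(1 <= p < N.+1 | prime p) (1 + h p / p%:R))).
  rewrite -sum_primorial (bigID (fun m => mobius m != 0)) /= [X in _ + X]big1 ?addr0.
    rewrite -big_filter; apply: ler_sum_subset.
    - by rewrite filter_uniq// iota_uniq.
    - exact: divisors_uniq.
    - move=> m; rewrite mem_filter mem_index_iota ltnS => /andP[mu mN].
      by rewrite -dvdn_divisors ?primorial_gt0// sqfree_dvd_primorial.
    - by move=> m _; apply: sqfree_weight_ge0.
  by move=> m; rewrite negbK => /eqP mu; rewrite /sqfree_weight mu expr0n !mul0r.
rewrite expR_sum; apply: ler_prod => p pp.
by rewrite addr_ge0 ?divr_ge0 ?h0//= expR_ge1Dx.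
Qed.

Lemma expR_le1D (a : R) : 0 <= a -> expR (a - a ^+ 2) <= 1 + a.
Proof.
move=> a0; have a1 : 0 < 1 + a by rewrite ltr_pwDl.
have -> : 1 + a = expR (ln (1 + a)) by rewrite lnK.
rewrite ler_expR; apply: (@le_trans _ _ (1 - (1 + a)^-1)).
  have -> : 1 - (1 + a)^-1 = a - a ^+ 2 + a ^+ 3 / (1 + a) by field; rewrite gt_eqF.
  by rewrite lerDl divr_ge0 ?exprn_ge0// ltW.
have := @le_ln1Dx R ((1 + a)^-1 - 1).
rewrite addrCA subrr addr0 lnV ?posrE// ltrBrDr addNr invr_gt0 a1 => /(_ isT).
lra.
Qed.

Lemma sum_inv_prime_squares N :
  \sum_(1 <= p < N.+1 | prime p) (p%:R ^+ 2)^-1 <= 2 :> R.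
Proof.
apply: (@le_trans _ _ (\sum_(1 <= p < N.+1) 2 * (p%:R^-1 - p.+1%:R^-1))).
  rewrite big_mkcond; apply: ler_sum_nat => p /andP[p0 _].
  have p0' : 0 < p%:R :> R by rewrite ltr0n.
  have p1' : 0 < p.+1%:R :> R by rewrite ltr0n.
  rewrite inv_nat_diff//; case: ifP => _; last first.
    by rewrite mulr_ge0// invr_ge0 mulr_ge0// ltW.
  rewrite -[2 * _]invrK lef_pV2 ?posrE ?invr_gt0 ?mulr_gt0 ?exprn_gt0//; last first.
    by rewrite invr_gt0 mulr_gt0.
  rewrite invfM invrK -[leLHS]mulrC ler_pdivrMr//.
  rewrite expr2 -mulrA ler_pM2l// -natrM ler_nat; lia.
rewrite -mulr_sumr.
have -> : \sum_(1 <= p < N.+1) (p%:R^-1 - p.+1%:R^-1) = 1 - N.+1%:R^-1 :> R.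
  have := @telescope_sumr R 1 N.+1 (fun n => - (n%:R^-1)) isT.
  rewrite opprK addrC invr1 => <-; apply: eq_bigr => n _; by rewrite opprK addrC.
have : 0 < N.+1%:R^-1 :> R by rewrite invr_gt0 ltr0n.
by move: (N.+1%:R^-1) => u; lra.
Qed.

(** The Euler product over [p <= w] also counts divisors of the primorial above [N]. Taking [w] a
    small power of [N] keeps their share to one half: [H (ln w + 2) <= 5 H ln w <= ln N / 2], since
    [ln w >= 1 / 2]. The loss [2 H ^ 2] comes from [ln (1 + a) >= a - a ^ 2]. *)
Lemma sqfree_sum_lb h (H : R) (k w N : nat) :
  (forall p, prime p -> 0 <= h p <= H) -> 10 * H <= k%:R -> (1 < w)%N -> (w ^ k <= N)%N ->
  (1 < N)%N ->
  expR (\sum_(1 <= p < w.+1 | prime p) h p / p%:R - 2 * H ^+ 2) / 2 <=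
  \sum_(1 <= m < N.+1) sqfree_weight h m.
Proof.
move=> hH kH w1 wN N1.
have h0 p : prime p -> 0 <= h p by move/hH => /andP[].
have H0 : 0 <= H by have /andP[] := hH 2%N isT; apply: le_trans.
have w0 := ltnW w1; have lN := ln_nat_gt0 R N1.
set P := \prod_(1 <= p < w.+1 | prime p) (1 + h p / p%:R).
have P_lb : expR (\sum_(1 <= p < w.+1 | prime p) h p / p%:R - 2 * H ^+ 2) <= P.
  apply: (@le_trans _ _ (expR (\sum_(1 <= p < w.+1 | prime p) (h p / p%:R - (h p / p%:R) ^+ 2)))).
    rewrite ler_expR sumrB lerD2l lerN2 mulrC.
    apply: le_trans (ler_wpM2l (sqr_ge0 H) (sum_inv_prime_squares w)).
    rewrite mulr_sumr; apply: ler_sum => p pp; rewrite expr_div_n ler_wpM2r ?invr_ge0 ?sqr_ge0//.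
    by have /andP[p0 pH] := hH p pp; rewrite ler_pXn2r ?nnegrE.
  rewrite expR_sum; apply: ler_prod => p pp.
  by rewrite expR_ge0 /= expR_le1D// divr_ge0 ?h0.
have P0 : 0 <= P by apply: le_trans P_lb; exact: expR_ge0.
have log_ub : \sum_(1 <= p < w.+1 | prime p) h p * (ln p%:R / p%:R) <= ln N%:R / 2.
  apply: (@le_trans _ _ (H * (ln w%:R + 2))).
    apply: le_trans (ler_wpM2l H0 (mertens1_ub R w0)); rewrite mulr_sumr.
    apply: ler_sum => p pp; rewrite ler_wpM2r ?divr_ge0 ?ln_nat_ge0//.
    by have /andP[] := hH p pp.
  have : k%:R * ln w%:R <= ln N%:R :> R.
    by rewrite mulr_natl -lnXn ?ltr0n// -natrX ln_nat_le// expn_gt0 w0.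
  have l2 : 2^-1 <= ln w%:R :> R by apply: (le_trans (ln2_ge_half R)); exact: ln_nat_le.
  move: l2 kH H0; move: (ln w%:R) (ln N%:R) (k%:R) => a b c l2 kH H0; nra.
have split : P <= \sum_(1 <= m < N.+1) sqfree_weight h m +
    (\sum_(d <- divisors (primorial w)) sqfree_weight h d * ln d%:R) / ln N%:R.
  rewrite /P -sum_primorial (bigID (fun d => (d <= N)%N)) /=; apply: lerD.
    rewrite -big_filter; apply: ler_sum_subset.
    - by rewrite filter_uniq// divisors_uniq.
    - exact: iota_uniq.
    - move=> d; rewrite mem_filter mem_index_iota ltnS => /andP[->].
      by rewrite -dvdn_divisors ?primorial_gt0// andbT => /(dvdn_gt0 (primorial_gt0 w)).
    - by move=> m _; apply: sqfree_weight_ge0.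
  rewrite mulr_suml [leRHS](bigID (fun d => (d <= N)%N)) /=; apply: ler_wpDl.
    by apply: sumr_ge0 => d _; rewrite divr_ge0 ?(ltW lN)// mulr_ge0 ?sqfree_weight_ge0 ?ln_nat_ge0.
  apply: ler_sum => d; rewrite -ltnNge => Nd; rewrite -mulrA ler_peMr ?sqfree_weight_ge0//.
  by rewrite ler_pdivlMr// mul1r ln_nat_le// ltnW// ltnW.
have tail : (\sum_(d <- divisors (primorial w)) sqfree_weight h d * ln d%:R) / ln N%:R <= P / 2.
  rewrite ler_pdivrMr//; apply: (le_trans (sum_primorial_log w h0)).
  apply: (le_trans (ler_wpM2r P0 log_ub)).
  by rewrite mulrC [leLHS]mulrA [leRHS]mulrAC.
rewrite ler_pdivrMr//; lra.
Qed.

End SquarefreeSums.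

(** * The large sieve inequality *)

Section DeltaFacts.
Variables (R : realType) (chi : nat -> R[i]).
Hypothesis chi_le1 : forall n, cnorm (chi n) <= 1.
Implicit Types (m n p d : nat) (u v V : R).

Lemma window_ln u v d : (0 < d)%N ->
  (expR u < d%:R <= expR (u + v)) = (u < ln d%:R <= u + v).
Proof.
move=> d0; have d0' : 0 < d%:R :> R by rewrite ltr0n.
by rewrite -[in LHS](lnK d0') ltr_expR ler_expR.
Qed.

Lemma Delta_ln n u v : (0 < n)%N ->
  Delta n chi u v = \sum_(d <- divisors n | u < ln d%:R <= u + v) chi d.
Proof.
move=> n0; rewrite /Delta big_seq_cond [RHS]big_seq_cond; apply: eq_bigl => d.
case: (boolP (d \in _)) => //=; rewrite -dvdn_divisors// => dn.
by rewrite window_ln// (dvdn_gt0 n0 dn).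
Qed.

Lemma Delta_le_DeltaV n u v V : 0 <= v <= V ->
  cnorm (Delta n chi u v) <= DeltaV V n chi.
Proof.
move=> vV; apply: sup_upper_bound.
  split; first by exists (cnorm (Delta n chi u v)); exists u => //; exists v => //; rewrite /= in_itv.
  exists (size (divisors n))%:R => _ [u' _ [v' _ <-]].
  apply: (le_trans (cnorm_sum _ _ _)).
  apply: (@le_trans _ _ (\sum_(d <- divisors n) 1)).
    by rewrite big_mkcond; apply: ler_sum => d _; case: ifP.
  by rewrite big_const_seq count_predT iter_addr_0.
by exists u => //; exists v => //; rewrite /= in_itv.
Qed.

(** The window is cut so as to end at [ln m] at the latest: no divisor of [m] is lost, and the
    divisors [p d > m] stay outside. The cut is harmless because [DeltaV] allows every length up to
    [V]. *)
Lemma Delta_mulprime_le m p u v V : prime p -> (0 < m < p)%N -> 0 <= v <= V ->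
  cnorm (Delta m chi u v) <= DeltaV V (m * p) chi.
Proof.
move=> pp /andP[m0 mp] /andP[v0 vV].
have pm : ~~ (p %| m)%N by rewrite gtnNdvd.
have [mu|um] := leP (ln m%:R) u.
  rewrite Delta_ln// big_seq_cond big1; last first.
    move=> d /andP[+ /andP[ud _]]; rewrite -dvdn_divisors// => dm.
    have h := @ln_nat_le R _ _ (dvdn_gt0 m0 dm) (dvdn_leq m0 dm); exfalso; lra.
  rewrite cnorm0; apply: le_trans (cnorm_ge0 (Delta (m * p) chi u v)) _.
  by apply: Delta_le_DeltaV; rewrite v0.
pose v' := Num.min v (ln m%:R - u).
have -> : Delta m chi u v = Delta (m * p) chi u v'.
  rewrite !Delta_ln ?muln_gt0 ?m0 ?prime_gt0//.
  have := perm_divisors_primeM 0 pp pm m0; rewrite expn1 expn0 mul1n mulnC => e.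
  rewrite [RHS](perm_big _ e) big_cat /= [X in _ = _ + X]big_map.
  rewrite [X in _ = _ + X]big_seq_cond [X in _ = _ + X]big1 ?addr0; last first.
    move=> d /andP[+ /andP[_ dv]]; rewrite -dvdn_divisors// => dm.
    have d0 := dvdn_gt0 m0 dm.
    have h1 : ln (p * d)%:R <= ln m%:R :> R.
      by apply: (le_trans dv); rewrite -lerBrDl ge_min lexx orbT.
    have : ln m%:R < ln (p * d)%:R :> R.
      have md : (m < p * d)%N by rewrite (leq_trans mp)// leq_pmulr.
      by rewrite ltr_ln ?posrE ?ltr0n ?ltr_nat// (leq_ltn_trans _ md).
    by rewrite ltNge h1.
  rewrite big_seq_cond [RHS]big_seq_cond; apply: eq_bigl => d.
  case: (boolP (d \in _)) => //=; rewrite -dvdn_divisors// => dm.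
  have dm' : ln d%:R <= ln m%:R :> R.
    exact: ln_nat_le (dvdn_gt0 m0 dm) (dvdn_leq m0 dm).
  congr (_ && _); rewrite -[RHS]lerBlDl le_min !lerBlDl.
  by rewrite [u + (_ - u)]addrC subrK dm' andbT.
apply: Delta_le_DeltaV; rewrite le_min v0 subr_ge0 (ltW um) /=.
by rewrite ge_min vV.
Qed.

(** The window from [-1] to [0] on the logarithmic scale catches the divisor [1] only; its length
    [1] is where [1 <= V] enters. *)
Lemma DeltaV_mulprime_ge1 m p V : chi 1%N = 1 -> prime p -> (0 < m < p)%N -> 1 <= V ->
  1 <= DeltaV V (m * p) chi.
Proof.
move=> chi1 pp mp V1; have /andP[m0 _] := mp.
have <- : cnorm (Delta m chi (-1) 1) = 1.
  rewrite Delta_ln// addNr big_mkcond (bigD1_seq 1%N) ?divisors_uniq//=; last first.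
    by rewrite -dvdn_divisors.
  rewrite ln1 lexx ltrN10 /= chi1 big_seq_cond big1 ?addr0 ?cnorm1// => d.
  rewrite -dvdn_divisors// => /andP[dm d1].
  have d2 : (1 < d)%N by have := dvdn_gt0 m0 dm; case: d d1 {dm} => [|[]].
  by rewrite [_ <= 0]leNgt ln_nat_gt0// andbF.
by apply: Delta_mulprime_le => //; rewrite ler01.
Qed.

Definition tau xi n : R[i] := \sum_(d <- divisors n) twist chi xi d.

Lemma tau_sqfree q xi (a : R) n : dirichlet_character q chi -> (0 < n)%N -> mobius n != 0 ->
  \prod_(p <- primes n) (a * cnorm (1 + twist chi xi p) ^+ 2) =
  a ^+ omega n * cnorm (tau xi n) ^+ 2.
Proof.
move=> chi_char; elim/prime_factorization_ind: n / => [|p k m pp pm m0 IH].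
  rewrite (_ : primes 1 = [::])// big_nil expr0 mul1r /tau big_seq1 /twist.
  by rewrite (character1 chi_char) ln1 mulr0 cis0 mulr1 cnorm1 expr1n.
case: k => [|k]; last by rewrite -[k.+2]add2n expnD -mulnA mobius_square// eqxx.
have := omega_primeM 0 pp pm m0; have := sum_divisors_primeM (twist chi xi) 0 pp pm m0.
rewrite expn1 expn0 mul1n mobius_primeM// oppr_eq0 prod_primes_primeM// => t -> /IH ->.
have -> : tau xi (p * m) = (1 + twist chi xi p) * tau xi m.
  rewrite /tau t mulrDl mul1r mulr_sumr; congr (_ + _).
  rewrite big_seq [RHS]big_seq; apply: eq_bigr => d; rewrite -dvdn_divisors// => dm.
  exact: (twistM _ chi_char (prime_gt0 pp) (dvdn_gt0 m0 dm)).
by rewrite cnormM exprMn [a ^+ _.+1]exprS mulrACA.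
Qed.

End DeltaFacts.

(** * Parseval's identity for the discrete Fourier transform *)

Section FiniteFourier.
Variable R : realType.
Implicit Types (M j k l : nat).

Lemma cis_conj (x : R) : conjc (cis x) = cis (- x).
Proof. by rewrite /cis sinN cosN. Qed.

Lemma cnorm_sqr_conj (z : R[i]) : z * conjc z = (cnorm z ^+ 2)%:C.
Proof.
by rewrite cnorm_sqr; case: z => a b; apply/eqP; rewrite eq_complex /= !expr2; apply/andP; split; apply/eqP; ring.
Qed.

Lemma cis_neq1 (x : R) : 0 < x < 2 * pi -> cis x != 1.
Proof.
move=> /andP[x0 x2]; apply/eqP => /(congr1 (@complex.Re R)) /= cx.
have : 0 < sin (x / 2).
  by apply: sin_gt0_pi; apply/andP; split; lra.
have -> : sin (x / 2) = 0; last by rewrite ltxx.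
apply/eqP; rewrite -sqrf_eq0 sin2cos2.
have : cos (x / 2 *+ 2) = 1 by rewrite -mulr_natr divfK.
by rewrite cos_mulr2n => h; apply/eqP; move: h; rewrite mulr2n; lra.
Qed.

Lemma cis_2pi_nat l : cis (2 * pi * l%:R) = 1 :> R[i].
Proof.
rewrite mulr_natr cisXn; have -> : cis (2 * pi) = 1 :> R[i].
  by rewrite /cis [2 * pi]mulrC mulr_natr cos2pi sin2pi.
by rewrite expr1n.
Qed.

Lemma sum_roots_of_unity M j l : (j < M)%N -> (l < M)%N ->
  \sum_(k < M) cis (2 * pi / M%:R * k%:R * (j%:R - l%:R)) = M%:R * (j == l)%:R :> R[i].
Proof.
move=> jM lM; have M0 : 0 < M%:R :> R by rewrite ltr0n (leq_ltn_trans _ jM).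
have [->|jl] := eqVneq j l.
  rewrite (eq_bigr (fun=> 1)); last by move=> k _; rewrite subrr mulr0 cis0.
  by rewrite sumr_const card_ord mulr1.
rewrite mulr0; set z := cis (2 * pi / M%:R * (j%:R - l%:R)) : R[i].
rewrite (eq_bigr (fun k : 'I_M => z ^+ k)); last first.
  by move=> k _; rewrite -cisXn -mulr_natr; congr cis; ring.
have zM : z ^+ M = 1.
  rewrite -cisXn -[_ *+ M]mulr_natr.
  have -> : 2 * pi / M%:R * (j%:R - l%:R) * M%:R = 2 * pi * j%:R + - (2 * pi * l%:R) :> R.
    by field; rewrite gt_eqF.
  by rewrite cisD -cis_conj !cis_2pi_nat conjc1 mulr1.
have z1 : z != 1.
  have zn (a b : nat) : (b < a)%N -> (a < M)%N -> cis (2 * pi / M%:R * (a%:R - b%:R) : R) != 1.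
    move=> ba aM; apply: cis_neq1; have p0 := pi_gt0 R.
    rewrite mulr_gt0 ?divr_gt0 ?mulr_gt0 ?subr_gt0 ?ltr_nat//=.
    rewrite -mulrA gtr_pMr ?mulr_gt0// mulrC ltr_pdivrMr// mul1r.
    have h : a%:R < M%:R :> R by rewrite ltr_nat.
    by apply: le_lt_trans h; rewrite gerBl.
  case: (ltnP l j) => lj; first exact: zn.
  have : cis (2 * pi / M%:R * (l%:R - j%:R) : R) != 1.
    by apply: zn => //; rewrite ltn_neqAle jl.
  apply: contraNN => /eqP zE; rewrite -[l%:R - _]opprB mulrN -cis_conj.
  by rewrite -/z zE conjc1.
have := subrX1 z M; rewrite zM subrr => /esym/eqP; rewrite mulf_eq0 subr_eq0.
by rewrite (negPf z1) => /eqP.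
Qed.

Definition dft M (G : nat -> R[i]) k : R[i] :=
  \sum_(j < M) G j * cis (2 * pi / M%:R * k%:R * j%:R).

Lemma parseval M (G : nat -> R[i]) :
  \sum_(k < M) cnorm (dft M G k) ^+ 2 = M%:R * \sum_(j < M) cnorm (G j) ^+ 2.
Proof.
apply: (@complexI R); rewrite rmorphM rmorph_nat !rmorph_sum /=.
under eq_bigr => k _ do rewrite -cnorm_sqr_conj /dft rmorph_sum mulr_suml.
under eq_bigr => k _ do under eq_bigr => j _ do rewrite mulr_sumr.
rewrite exchange_big /= mulr_sumr; apply: eq_bigr => j _.
rewrite exchange_big /=.
have E (l : 'I_M) : \sum_(k < M) G j * cis (2 * pi / M%:R * k%:R * j%:R) *
    conjc (G l * cis (2 * pi / M%:R * k%:R * l%:R)) =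
   G j * conjc (G l) * (M%:R * (nat_of_ord j == l)%:R).
  rewrite -sum_roots_of_unity// mulr_sumr; apply: eq_bigr => k _.
  have cM (a b : R[i]) : conjc (a * b) = conjc a * conjc b by exact: rmorphM.
  rewrite cM cis_conj mulrBr cisD; ring.
under eq_bigr => l _ do rewrite E.
rewrite (bigD1 j)//= eqxx mulr1 big1 ?addr0; last first.
  by move=> l lj; rewrite eq_sym -val_eqE in lj *; rewrite (negPf lj) !mulr0.
by rewrite cnorm_sqr_conj mulrC.
Qed.

End FiniteFourier.

Section LargeSieve.
Variables (R : realType) (chi : nat -> R[i]).
Hypothesis chi_le1 : forall n, cnorm (chi n) <= 1.

Lemma ceil_nat (x : R) : 0 <= x -> exists J : nat,
  [/\ x <= J%:R, J%:R < x + 1 & forall j : nat, (x <= j%:R) = (J <= j)%N].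
Proof.
move=> x0; have ex : exists j : nat, x <= j%:R.
  by exists (Num.truncn x).+1; apply/ltW/truncnS_gt.
pose J := ex_minn ex; have : [/\ x <= J%:R & forall j : nat, x <= j%:R -> (J <= j)%N].
  by rewrite /J; case: ex_minnP => k h1 h2.
case=> xJ Jmin; exists J; split => //.
  rewrite ltNge; apply/negP => h; case: J xJ Jmin h => [|J] xJ Jmin h.
    lra.
  have /Jmin : x <= J%:R by move: h; rewrite -natr1 lerD2r.
  by rewrite ltnn.
move=> j; apply/idP/idP => [|Jj]; first exact: Jmin.
by apply: (le_trans xJ); rewrite ler_nat.
Qed.

(* Slide the window of length [U] along a grid of step [U / s] on a circle of length
   [N' U].  The divisor [d] lies in the [s] consecutive windows starting at the index
   [J d], the ceiling of [s ln d / U], so the Fourier transform of the window sums is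
   a geometric sum of modulus at least [s / 2] times the twisted divisor sum with
   [ln d] rounded to the grid. *)
Lemma large_sieve_grid (m N' K s : nat) (U D : R) : (0 < m)%N -> (0 < s)%N -> 0 < U ->
  (forall u, cnorm (Delta m chi u U) <= D) ->
  ln m%:R <= (N'%:R - 1) * U -> (0 < N')%N -> (16 * K <= N' + 16)%N ->
  exists J : nat -> nat,
    (forall d, (d %| m)%N -> ln d%:R <= (J d)%:R * (U / s%:R) <= ln d%:R + U / s%:R) /\
    \sum_(k < K) cnorm (\sum_(d <- divisors m)
        chi d * cis (2 * pi / (N' * s)%:R * k%:R * (J d)%:R)) ^+ 2
      <= 4 * N'%:R ^+ 2 * D ^+ 2.
Proof.
move=> m0 s0 U0 HD lnm N0 KN; set M := (N' * s)%N; pose eta := U / s%:R.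
have s0' : 0 < s%:R :> R by rewrite ltr0n.
have N0' : 0 < N'%:R :> R by rewrite ltr0n.
have eta0 : 0 < eta by rewrite divr_gt0.
have M0 : (0 < M)%N by rewrite muln_gt0 N0.
have M0' : 0 < M%:R :> R by rewrite ltr0n.
have /boolp.choice[J HJ] : forall d : nat, exists J : nat,
    [/\ ln d%:R / eta <= J%:R, J%:R < ln d%:R / eta + 1 &
        forall j : nat, (ln d%:R / eta <= j%:R) = (J <= j)%N].
  by move=> d; apply: ceil_nat; rewrite divr_ge0 ?ln_nat_ge0// ltW.
exists J; split.
  move=> d _; have [h1 h2 _] := HJ d.
  rewrite -ler_pdivrMr// h1 /= -/eta; move: (ltW h2); rewrite -(ler_pM2r eta0).
  by rewrite mulrDl divfK ?gt_eqF// mul1r.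
(* Indexing a window by its right end [j * eta] keeps the index natural: already for [d = 1] the
   windows containing [ln d = 0] start below [0]. *)
pose G (j : nat) := Delta m chi ((j%:R - s%:R) * eta) U.
(* The spare length [U] in [ln m <= (N' - 1) U] keeps all [s] windows of each divisor below the
   index [M], so nothing wraps around the circle. *)
have Js d : (d %| m)%N -> (J d + s <= M)%N.
  move=> dm; have [_ _ h] := HJ d.
  have : (J d <= (N'.-1) * s)%N.
    rewrite -h ler_pdivrMr// natrM -mulrA [s%:R * _]mulrC divfK ?gt_eqF//.
    rewrite -subn1 natrB//; apply: le_trans lnm.
    exact: (ln_nat_le R (dvdn_gt0 m0 dm) (dvdn_leq m0 dm)).
  rewrite /M; case: N' N0 {lnm KN M M0 M0' N0' G} => // n _ /=.
  by rewrite mulSn [(s + _)%N]addnC leq_add2r.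
have sE : s%:R * eta = U by rewrite mulrC divfK ?gt_eqF.
have win d (j : nat) : ((j%:R - s%:R) * eta < ln d%:R <= (j%:R - s%:R) * eta + U) =
    (J d <= j < J d + s)%N.
  have [_ _ h] := HJ d.
  have -> : (j%:R - s%:R) * eta + U = j%:R * eta by rewrite mulrBl sE subrK.
  rewrite -ler_pdivrMr// h andbC; congr (_ && _).
  rewrite -ltr_pdivlMr// ltrBlDr ltNge [RHS]ltnNge; congr (~~ _).
  have [js|sj] := leqP s j.
    rewrite -(subnK js) natrD lerD2r h leq_add2r//.
  apply/idP/idP => [hh|]; last by move=> /(leq_trans (leq_addl _ _)); rewrite leqNgt sj.
  have : s%:R <= j%:R :> R.
    by apply: le_trans hh; rewrite lerDr divr_ge0 ?ln_nat_ge0 ?(ltW eta0).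
  by rewrite ler_nat leqNgt sj.
pose E k : R[i] := \sum_(i < s) cis (2 * pi / M%:R * k%:R * i%:R).
have dftE k : dft M G k = (\sum_(d <- divisors m)
        chi d * cis (2 * pi / M%:R * k%:R * (J d)%:R)) * E k.
  rewrite /dft; under eq_bigr => j _ do rewrite /G Delta_ln// big_mkcond mulr_suml.
  rewrite exchange_big /= mulr_suml big_seq [RHS]big_seq; apply: eq_bigr => d.
  rewrite -dvdn_divisors// => dm.
  rewrite -(big_mkord xpredT (fun j : nat => (if (j%:R - s%:R) * eta < ln d%:R <= (j%:R - s%:R) * eta + U
      then chi d else 0) * cis (2 * pi / M%:R * k%:R * j%:R))).
  rewrite (@big_cat_nat _ _ _ (J d))//=; last by rewrite (leq_trans _ (Js d dm))// leq_addr.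
  rewrite big_nat_cond big1 ?add0r; last first.
    by move=> j /andP[/andP[_ jJ] _]; rewrite win leqNgt jJ /= mul0r.
  rewrite (@big_cat_nat _ _ _ (J d + s))//= ?leq_addr ?Js//.
  rewrite [X in _ + X]big_nat_cond [X in _ + X]big1 ?addr0; last first.
    by move=> j /andP[/andP[jJ _] _]; rewrite win [(j < _)%N]ltnNge jJ andbF mul0r.
  rewrite -{1}[J d]add0n big_addn addKn big_mkord /E !mulr_sumr; apply: eq_bigr => i _.
  rewrite win leq_addl /= addnC ltn_add2l ltn_ord natrD mulrDr cisD; ring.
(* From [k < K] follows [16 k <= N']; with [pi <= 4] every angle is at most [1 / 2], hence every
   cosine is at least [1 / 2]. *)
have E_lb k : (k < K)%N -> s%:R / 2 <= cnorm (E k).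
  move=> kK; apply: le_trans (Re_le _); rewrite /E Re_sum.
  apply: (@le_trans _ _ (\sum_(i < s) 2^-1)).
    by rewrite sumr_const card_ord mulr_natl.
  apply: ler_sum => i _ /=.
  have kN : 16 * k%:R <= N'%:R :> R by rewrite -natrM ler_nat; lia.
  have x0 : 0 <= 2 * pi / M%:R * k%:R * i%:R :> R.
    by rewrite !mulr_ge0 ?invr_ge0 ?pi_ge0 ?(ltW M0').
  have := cos_lip x0; rewrite cos0 subr0 distrC => /(le_trans (ler_norm _)).
  have : 2 * pi / M%:R * k%:R * i%:R <= 2^-1 :> R.
    have -> : 2 * pi / M%:R * k%:R * i%:R = pi * (2 * k%:R * i%:R) / M%:R :> R by ring.
    rewrite ler_pdivrMr// /M natrM.
    have p4 : pi <= 4 :> R by have := pihalf_lt2 R; lra.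
    have is_ : i%:R <= s%:R :> R by rewrite ler_nat ltnW.
    apply: (@le_trans _ _ (4 * (2 * k%:R * s%:R))).
      apply: ler_pM => //; rewrite ?pi_ge0 ?mulr_ge0//.
      by rewrite ler_wpM2l// mulr_ge0.
    move: kN s0'; move: (k%:R) (N'%:R) (s%:R) => a b c; nra.
  lra.
have total : \sum_(k < M) cnorm (dft M G k) ^+ 2 <= M%:R * (M%:R * D ^+ 2).
  rewrite parseval ler_pM2l//; apply: (@le_trans _ _ (\sum_(j < M) D ^+ 2)).
    apply: ler_sum => j _; rewrite ler_pXn2r ?nnegrE ?cnorm_ge0 ?HD//.
    exact: le_trans (cnorm_ge0 _) (HD 0).
  by rewrite sumr_const card_ord mulr_natl.
have KM : (K <= M)%N.
  apply: (@leq_trans N'); first by lia.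
  by rewrite /M leq_pmulr.
have part : \sum_(k < K) cnorm (dft M G k) ^+ 2 <= M%:R * (M%:R * D ^+ 2).
  apply: le_trans total.
  rewrite -(big_mkord xpredT (fun k => cnorm (dft M G k) ^+ 2)).
  rewrite -(big_mkord xpredT (fun k => cnorm (dft M G k) ^+ 2)).
  rewrite [leRHS](@big_cat_nat _ _ _ K)//= lerDl sumr_ge0// => k _.
  by rewrite sqr_ge0.
have h : (s%:R / 2) ^+ 2 * \sum_(k < K) cnorm (\sum_(d <- divisors m)
        chi d * cis (2 * pi / M%:R * k%:R * (J d)%:R)) ^+ 2 <= M%:R * (M%:R * D ^+ 2).
  apply: le_trans part; rewrite mulr_sumr; apply: ler_sum => k _.
  rewrite dftE cnormM [leRHS]exprMn [leRHS]mulrC ler_wpM2r ?sqr_ge0//.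
  by rewrite ler_pXn2r ?nnegrE ?cnorm_ge0 ?E_lb.
rewrite -(ler_pM2l (_ : 0 < (s%:R / 2) ^+ 2)) ?exprn_gt0 ?divr_gt0//.
apply: (le_trans h); rewrite /M natrM le_eqVlt; apply/orP; left; apply/eqP.
by field.
Qed.

Lemma le_of_le_add_div (a b c : R) :
  (forall s : nat, (0 < s)%N -> a <= b + c / s%:R) -> a <= b.
Proof.
move=> H; apply/ler_addgt0Pr => e e0.
pose s := (Num.truncn (`|c| / e)).+1.
have s0 : 0 < s%:R :> R by rewrite ltr0n.
apply: (le_trans (H s isT)); rewrite lerD2l ler_pdivrMr// mulrC -ler_pdivrMr//.
apply: (@le_trans _ _ (`|c| / e)); last exact/ltW/truncnS_gt.
by rewrite ler_pM2r ?invr_gt0// ler_norm.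
Qed.

(** The limit [s -> oo] of the grid version: rounding [ln d] to the grid moves each twist by
    [O(1 / s)]. The summand [16] in the condition on [K] always admits [K = 1], that is, the
    frequency [0] alone. *)
Lemma large_sieve (m N' K : nat) (U D : R) : (0 < m)%N -> 0 < U ->
  (forall u, cnorm (Delta m chi u U) <= D) ->
  ln m%:R <= (N'%:R - 1) * U -> (0 < N')%N -> (16 * K <= N' + 16)%N ->
  \sum_(k < K) cnorm (tau chi (2 * pi * k%:R / (N'%:R * U)) m) ^+ 2
      <= 4 * N'%:R ^+ 2 * D ^+ 2.
Proof.
move=> m0 U0 HD lnm N0 KN.
have N0' : 0 < N'%:R :> R by rewrite ltr0n.
pose n : R := (size (divisors m))%:R.
pose T : R := n * (4 * pi * K%:R / N'%:R).
have T0 : 0 <= T by rewrite !mulr_ge0 ?invr_ge0 ?pi_ge0 ?(ltW N0').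
apply: (@le_of_le_add_div _ _ (K%:R * (2 * n * T + T ^+ 2))) => s s0.
have s0' : 0 < s%:R :> R by rewrite ltr0n.
have s1 : s%:R^-1 <= 1 :> R by rewrite invf_le1// ler1n.
have [J [HJ Hsum]] := large_sieve_grid m0 s0 U0 HD lnm N0 KN.
have term (k : 'I_K) : cnorm (tau chi (2 * pi * k%:R / (N'%:R * U)) m) ^+ 2 <=
   cnorm (\sum_(d <- divisors m)
        chi d * cis (2 * pi / (N' * s)%:R * k%:R * (J d)%:R)) ^+ 2 + (2 * n * T + T ^+ 2) / s%:R.
  set t := tau _ _ _; set t' := \sum_(d <- divisors m) _.
  have t'n : cnorm t' <= n.
    apply: (le_trans (cnorm_sum _ _ _)).
    apply: (@le_trans _ _ (\sum_(d <- divisors m) 1)).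
      by apply: ler_sum => d _; rewrite cnormM cnorm_cis mulr1.
    by rewrite big_const_seq count_predT iter_addr_0.
  have tt' : cnorm (t - t') <= T / s%:R.
    rewrite /t /t' /tau -sumrB; apply: (le_trans (cnorm_sum _ _ _)).
    apply: (@le_trans _ _ (\sum_(d <- divisors m) 4 * pi * K%:R / N'%:R / s%:R)).
      rewrite big_seq [leRHS]big_seq; apply: ler_sum => d; rewrite -dvdn_divisors// => dm.
      rewrite /twist -mulrBr cnormM -[leRHS]mul1r; apply: ler_pM; rewrite ?cnorm_ge0//.
      apply: (le_trans (cis_lip _ _)).
      have /andP[h1 h2] := HJ d dm.
      have -> : 2 * pi * k%:R / (N'%:R * U) * ln d%:R - 2 * pi / (N' * s)%:R * k%:R * (J d)%:R =
        2 * pi * k%:R / (N'%:R * U) * (ln d%:R - (J d)%:R * (U / s%:R)).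
        by rewrite natrM; field; rewrite !gt_eqF.
      have c0 : 0 <= 2 * pi * k%:R / (N'%:R * U).
        by rewrite !mulr_ge0 ?invr_ge0 ?mulr_ge0 ?pi_ge0 ?(ltW N0') ?(ltW U0).
      rewrite normrM (ger0_norm c0) distrC ger0_norm ?subr_ge0//.
      apply: (@le_trans _ _ (2 * (2 * pi * k%:R / (N'%:R * U) * (U / s%:R)))).
        by rewrite ler_wpM2l// ler_wpM2l// lerBlDl.
      have -> : 2 * (2 * pi * k%:R / (N'%:R * U) * (U / s%:R)) =
         4 * pi / N'%:R / s%:R * k%:R by field; rewrite !gt_eqF.
      have -> : 4 * pi * K%:R / N'%:R / s%:R = 4 * pi / N'%:R / s%:R * K%:R :> R by ring.
      rewrite ler_wpM2l ?ler_nat 1?ltnW//.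
      by rewrite !mulr_ge0 ?invr_ge0 ?pi_ge0 ?(ltW N0') ?(ltW s0').
    by rewrite big_const_seq count_predT iter_addr_0 -[leLHS]mulr_natr /T mulrC !mulrA.
  have tle : cnorm t <= cnorm t' + T / s%:R.
    have -> : t = t' + (t - t') by rewrite addrC subrK.
    by apply: (le_trans (cnormD _ _)); rewrite lerD2l.
  have n0 : 0 <= cnorm t' := cnorm_ge0 _.
  apply: (@le_trans _ _ ((cnorm t' + T / s%:R) ^+ 2)).
    by rewrite ler_pXn2r ?nnegrE ?cnorm_ge0 ?addr_ge0 ?divr_ge0 ?(ltW s0').
  have sV0 : 0 < s%:R^-1 :> R by rewrite invr_gt0.
  rewrite sqrrD; move: (cnorm t') (s%:R^-1) t'n s1 n0 sV0 => a b an b1 a0 b0.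
  rewrite mulr2n exprMn.
  have h1 : a * (T * b) <= n * (T * b) by rewrite ler_wpM2r// mulr_ge0// ltW.
  have h2 : T ^+ 2 * b ^+ 2 <= T ^+ 2 * b.
    by rewrite ler_wpM2l ?sqr_ge0// expr2 ler_piMl// ltW.
  lra.
apply: (le_trans (ler_sum _ (fun k _ => term k))).
rewrite big_split /= sumr_const card_ord; apply: lerD => //.
by rewrite -[leLHS]mulr_natl mulrA.
Qed.

End LargeSieve.

(** * Lower bounds for the moment *)

Section Reduction.
Variables (R : realType).
Implicit Types (m n p k N X w : nat).

Lemma nat_root k X : (0 < k)%N -> (0 < X)%N ->
  exists2 w, (0 < w)%N & (w ^ k <= X < w.+1 ^ k)%N.
Proof.
move=> k0 X0.
have ex : exists w, (X < w.+1 ^ k)%N.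
  by exists X; rewrite (leq_trans (ltnSn X))// -{1}[X.+1]expn1 leq_pexp2l.
case: (ex_minnP ex) => w h1 h2.
case: w h1 h2 => [|w] h1 h2; first by move: h1; rewrite exp1n ltnNge X0.
exists w.+1 => //; rewrite h1 andbT leqNgt; apply/negP => /h2.
by rewrite ltnn.
Qed.

(** The [k]-th root [w] of [N] has a logarithm of the order of [ln x]. The constants depend on [h]
    only through [H], [kappa] and [C], so one application covers all frequencies. *)
Lemma sqfree_scale_lb (H kappa C : R) : 0 <= kappa ->
  exists2 c : R, 0 < c & exists x0 : R, forall (x : R) N (h : nat -> R), x0 <= x ->
    (N ^ 4 <= Num.truncn x < N.+1 ^ 4)%N ->
    (forall p, prime p -> 0 <= h p <= H) ->
    (forall w, (1 < w)%N -> kappa * ln (ln w%:R) - C <=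
       \sum_(1 <= p < w.+1 | prime p) h p / p%:R) ->
    c * ln x `^ kappa <= \sum_(1 <= m < N.+1) sqfree_weight h m.
Proof.
move=> kappa0; pose k := (Num.truncn (10 * H)).+1.
have kH : 10 * H <= k%:R by apply/ltW/truncnS_gt.
have k0' : 0 < k%:R :> R by rewrite ltr0n.
exists ((32 * k%:R)^-1 `^ kappa * expR (- C - 2 * H ^+ 2) / 2).
  by rewrite divr_gt0 ?mulr_gt0 ?expR_gt0 ?powR_gt0 ?invr_gt0 ?mulr_gt0.
exists ((2 ^ (4 * k))%:R) => x N h x0x /andP[NX XN] hH hsum.
have X2 : (2 ^ (4 * k) <= Num.truncn x)%N by rewrite truncn_ge_nat// (le_trans _ x0x).
have x_gt0 : 0 < x by rewrite (lt_le_trans _ x0x)// ltr0n expn_gt0.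
have Nk : (2 ^ k <= N)%N.
  have := leq_ltn_trans X2 XN; rewrite mulnC expnM ltn_exp2r//.
have N0 : (0 < N)%N by apply: leq_trans Nk; rewrite expn_gt0.
have [w w0 /andP[wN Nw]] := nat_root (isT : (0 < k)%N) N0.
have w1 : (1 < w)%N by have := leq_ltn_trans Nk Nw; rewrite ltn_exp2r.
have N1 : (1 < N)%N by apply: leq_trans Nk; rewrite -{1}(expn1 2) leq_pexp2l.
have X1 : (1 < Num.truncn x)%N.
  by apply: leq_trans NX; rewrite (leq_trans N1)// -{1}(expn1 N) leq_pexp2l.
(* Each [+ 1] caused by rounding at most doubles a logarithm: three doublings, the fourth root and
   the [k]-th root give [32 k = 2 * 4 * 2 * k * 2]. *)
have step n : (1 < n)%N -> ln n.+1%:R <= 2 * ln n%:R :> R.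
  move=> n1; rewrite mulr_natl -lnXn ?ltr0n 1?ltnW// -natrX ln_nat_le//; nia.
have lnx : ln x <= 32 * k%:R * ln w%:R.
  have h1 : ln x <= ln (Num.truncn x).+1%:R.
    by rewrite ler_ln ?posrE ?ltr0n//; exact/ltW/truncnS_gt.
  have h2 := step _ X1.
  have h3 : ln (Num.truncn x)%:R <= 4 * ln N.+1%:R :> R.
    by rewrite mulr_natl -lnXn ?ltr0n// -natrX ln_nat_le// ltnW.
  have h4 := step _ N1.
  have h5 : ln N%:R <= k%:R * ln w.+1%:R :> R.
    by rewrite mulr_natl -lnXn ?ltr0n// -natrX ln_nat_le// ltnW.
  have h6 : k%:R * ln w.+1%:R <= k%:R * (2 * ln w%:R) :> R by rewrite ler_pM2l ?step.
  move: h1 h2 h3 h4 h5 h6; move: (k%:R * ln w.+1%:R) => a; lra.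
have lw0 := ln_nat_gt0 R w1.
have lx0 : 0 <= ln x.
  by apply: ln_ge0; apply: le_trans x0x; rewrite ler1n expn_gt0.
have wk := sqfree_sum_lb hH kH w1 wN N1.
apply: le_trans wk.
have -> : (32 * k%:R)^-1 `^ kappa * expR (- C - 2 * H ^+ 2) / 2 * ln x `^ kappa =
  (32 * k%:R)^-1 `^ kappa * ln x `^ kappa * expR (- C - 2 * H ^+ 2) / 2 by ring.
rewrite ler_pM2r ?invr_gt0//.
apply: (@le_trans _ _ (expR (kappa * ln (ln w%:R) - C - 2 * H ^+ 2))); last first.
  by rewrite ler_expR lerD2r hsum.
rewrite -[X in _ <= expR X]addrA [leRHS]expRD ler_pM2r ?expR_gt0//.
have -> : expR (kappa * ln (ln w%:R)) = ln w%:R `^ kappa.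
  by rewrite /powR gt_eqF.
rewrite -powRM ?invr_ge0 ?mulr_ge0 ?(ltW k0')//.
apply: ge0_ler_powR; rewrite ?nnegrE ?mulr_ge0 ?invr_ge0 ?mulr_ge0 ?(ltW k0') ?(ltW lw0)//.
by rewrite mulrC ler_pdivrMr ?mulr_gt0// mulrC.
Qed.

Lemma ln_le_sqrt (a : R) : 1 <= a -> ln a <= 2 * Num.sqrt a.
Proof.
move=> a1; have a0 : 0 < a by apply: lt_le_trans a1.
have s0 : 0 < Num.sqrt a by rewrite sqrtr_gt0.
rewrite -{1}(sqr_sqrtr (ltW a0)) lnXn// mulr_natl ler_wMn2r//.
exact/ltW/ln_sublinear.
Qed.

(** The primes up to [N] are discarded by their trivial count: [ln Q <= 2 sqrt Q] and [N ^ 3 <= Q]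
    give [C N ln Q <= Q / 2] as soon as [16 C ^ 2 <= N]. *)
Lemma prime_count_interval : exists2 C : R, 0 < C & exists N0, forall N Q,
  (N0 <= N)%N -> (N ^ 3 <= Q)%N ->
  Q%:R <= C * ln Q%:R * \sum_(N.+1 <= p < Q.+1 | prime p) 1.
Proof.
have [C C0 [N1 HC]] := chebyshev_lb R.
exists (2 * C); first by rewrite mulr_gt0.
exists (maxn (maxn N1 2) (Num.truncn (16 * C ^+ 2)).+1) => N Q.
rewrite !geq_max => /andP[/andP[NN1 N2] NC] NQ.
have NQ' : (N <= Q)%N.
  by apply: leq_trans NQ; rewrite -{1}(expn1 N) leq_pexp2l// ltnW.
have Q1 : (1 < Q)%N by apply: leq_trans NQ'.
have lQ := ln_nat_gt0 R Q1.
have h := HC Q (leq_trans NN1 NQ').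
have NC' : 16 * C ^+ 2 <= N%:R.
  apply: (@le_trans _ _ (Num.truncn (16 * C ^+ 2)).+1%:R); first exact/ltW/truncnS_gt.
  by rewrite ler_nat.
have Q0' : 0 < Q%:R :> R by rewrite ltr0n ltnW.
have lnQ : ln Q%:R <= 2 * Num.sqrt Q%:R :> R by apply: ln_le_sqrt; rewrite ler1n ltnW.
have key : 4 * C * N%:R <= Num.sqrt Q%:R.
  rewrite -(@ler_pXn2r _ 2) ?nnegrE ?sqrtr_ge0 ?mulr_ge0 ?(ltW C0)//.
  rewrite sqr_sqrtr ?(ltW Q0')//; apply: (@le_trans _ _ (N ^ 3)%:R); last by rewrite ler_nat.
  rewrite natrX !exprMn [N%:R ^+ 3]exprS ler_wpM2r ?sqr_ge0//.
  by move: NC'; lra.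
have piN : \sum_(1 <= p < N.+1 | prime p) 1 <= N%:R :> R.
  apply: (@le_trans _ _ (\sum_(1 <= p < N.+1) 1)).
    by rewrite big_mkcond; apply: ler_sum => p _; case: ifP.
  by rewrite sumr_const_nat subSS subn0.
move: h; rewrite (@big_cat_nat _ _ _ N.+1)//= mulrDr.
have h1 : C * ln Q%:R * \sum_(1 <= p < N.+1 | prime p) 1 <= Q%:R / 2.
  apply: (@le_trans _ _ (C * (2 * Num.sqrt Q%:R) * N%:R)).
    apply: ler_pM => //; rewrite ?mulr_ge0 ?(ltW C0) ?(ltW lQ) ?sumr_ge0//.
    by rewrite ler_wpM2l// ltW.
  have := ler_wpM2r (sqrtr_ge0 Q%:R) key.
  rewrite -[X in _ <= X]expr2 sqr_sqrtr ?(ltW Q0')//; lra.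
move: h1; move: (\sum_(N.+1 <= p < Q.+1 | prime p) 1) (C * ln Q%:R * \sum_(1 <= p < N.+1 | prime p) 1) => a b h1 h2.
lra.
Qed.

(** A prime [p > N] cannot divide a cofactor [m <= N], so [p], and then [m], can be recovered from
    [m * p]. *)
Lemma uniq_prime_multiples N X :
  uniq [seq (m * p)%N | m <- index_iota 1 N.+1,
          p <- [seq p <- index_iota N.+1 (X %/ m).+1 | prime p]].
Proof.
apply: allpairs_uniq_dep; first exact: iota_uniq.
  by move=> m _; rewrite filter_uniq// iota_uniq.
move=> /= [m p] [m' p'] /allpairsPdep[a [b [am +]]] + /allpairsPdep[a' [b' [am' +]]].
rewrite !mem_filter !mem_index_iota in am am' *.
move=> /andP[bp /andP[Nb _]] [-> ->] /andP[b'p /andP[Nb' _]] [-> ->] /= e.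
move: am am' => /andP[a0 aN] /andP[a0' aN'].
have : (b %| a' * b')%N by rewrite -e dvdn_mull.
rewrite Euclid_dvdM// => /orP[h|].
  by have := dvdn_leq a0' h; lia.
rewrite dvdn_prime2// => /eqP bb; move: e; rewrite -bb => /eqP.
by rewrite eqn_pmul2r ?prime_gt0// => /eqP ->.
Qed.

Variables (chi : nat -> R[i]) (y t : R).
Hypothesis y_gt0 : 0 < y.

Definition moment_term V n : R :=
  (mobius n)%:~R ^+ 2 * y ^+ omega n * DeltaV V n chi `^ (2 * t).

Lemma moment_term_ge0 V n : 0 <= moment_term V n.
Proof. by rewrite /moment_term mulr_ge0 ?powR_ge0// mulr_ge0 ?sqr_ge0// exprn_ge0// ltW. Qed.

(** [G] is left open because each of the three terms uses its own minorant of [DeltaV ^ (2 t)]. The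
    factor [y] in the constant is the contribution of the prime [p] to [y ^ omega]. *)
Lemma moment_reduction : exists2 c : R, 0 < c & exists x0 : R,
  forall (x V : R) N (G : nat -> R), x0 <= x ->
    (N ^ 4 <= Num.truncn x < N.+1 ^ 4)%N ->
    (forall m, 0 <= G m) ->
    (forall m p, prime p -> (0 < m < p)%N -> (m <= N)%N -> G m <= DeltaV V (m * p) chi `^ (2 * t)) ->
    c * (x / ln x * \sum_(1 <= m < N.+1) (mobius m)%:~R ^+ 2 * y ^+ omega m * G m / m%:R) <=
    \sum_(1 <= n < (Num.truncn x).+1) moment_term V n.
Proof.
have [C C0 [N0 HC]] := prime_count_interval.
exists (y / (4 * C)); first by rewrite divr_gt0 ?mulr_gt0.
exists (((maxn N0 2).+1 ^ 4)%:R) => x V N G x0x /andP[NX XN] G0 HG.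
set X := Num.truncn x in NX XN *.
have X2 : ((maxn N0 2).+1 ^ 4 <= X)%N.
  by rewrite /X truncn_ge_nat// (le_trans _ x0x).
have := leq_ltn_trans X2 XN; rewrite ltn_exp2r// ltnS gtn_max => /andP[/ltnW N0N N2].
have N0' : (0 < N)%N by apply: leq_trans N2.
have x0 : 0 < x by apply: lt_le_trans x0x; rewrite ltr0n expn_gt0.
have Xx : X%:R <= x by rewrite /X truncn_le// ltW.
have X0 : (0 < X)%N by apply: leq_trans X2; rewrite expn_gt0.
have xX : x <= 2 * X%:R.
  apply: (@le_trans _ _ X.+1%:R); first exact/ltW/truncnS_gt.
  by rewrite -natrM ler_nat; lia.
pose s := [seq (m * p)%N | m <- index_iota 1 N.+1,
          p <- [seq p <- index_iota N.+1 (X %/ m).+1 | prime p]].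
apply: (@le_trans _ _ (\sum_(n <- s) moment_term V n)); last first.
  apply: ler_sum_subset.
  - exact: uniq_prime_multiples.
  - exact: iota_uniq.
  - move=> n /allpairsPdep[m [p [+ + ->]]]; rewrite mem_filter !mem_index_iota.
    move=> /andP[m0 mN] /andP[pp /andP[Np pX]]; rewrite muln_gt0 m0 prime_gt0//= ltnS.
    by rewrite mulnC (leq_trans _ (leq_trunc_div X m))// leq_mul2r -ltnS pX orbT.
  - by move=> n _; exact: moment_term_ge0.
rewrite big_allpairs_dep !mulr_sumr big_seq_cond [leRHS]big_seq_cond.
apply: ler_sum => m; rewrite mem_index_iota andbT ltnS => /andP[m0 mN].
rewrite big_filter; set W := (mobius m)%:~R ^+ 2 * y ^+ omega m.
have W0 : 0 <= W by rewrite mulr_ge0 ?sqr_ge0// exprn_ge0// ltW.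
have m0' : 0 < m%:R :> R by rewrite ltr0n.
apply: (@le_trans _ _ (\sum_(N.+1 <= p < (X %/ m).+1 | prime p) y * (W * G m) * 1)); last first.
  rewrite [leRHS](_ : _ = \sum_(N.+1 <= p < (X %/ m).+1 | prime p) moment_term V (m * p))//.
  rewrite big_nat_cond [leRHS]big_nat_cond; apply: ler_sum => p /andP[/andP[Np pX] pp].
  have mp : (m < p)%N by apply: leq_ltn_trans Np.
  have pm : ~~ (p %| m)%N by rewrite gtnNdvd.
  rewrite mulr1 /moment_term [(m * p)%N]mulnC.
  have := omega_primeM 0 pp pm m0; rewrite expn1 => ->.
  rewrite mobius_primeM// mulrNz sqrrN [y ^+ _.+1]exprS.
  have -> : (mobius m)%:~R ^+ 2 * (y * y ^+ omega m) = y * W by rewrite /W; ring.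
  rewrite mulrA; apply: ler_wpM2l; first by apply: mulr_ge0 => //; exact: ltW.
  by rewrite mulnC HG// m0.
rewrite -mulr_sumr; set S := \sum_(_ <= _ < _ | _) 1.
have NQ : (N ^ 3 <= X %/ m)%N.
  rewrite leq_divRL//; apply: leq_trans NX; rewrite [X in (_ <= X)%N]expnSr.
  by rewrite leq_mul2l mN orbT.
have := HC N (X %/ m)%N N0N NQ; rewrite -/S => hS.
have S0 : 0 <= S by rewrite sumr_ge0.
have Q1 : (0 < X %/ m)%N by apply: leq_trans NQ; rewrite expn_gt0 N0'.
have lx0 : 0 < ln x.
  apply: ln_gt0; apply: lt_le_trans Xx; rewrite ltr1n.
  apply: leq_trans NX; apply: (@leq_trans N); first exact: ltnW.
  by rewrite -{1}(expn1 N) leq_pexp2l.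
(* The [4] pays for two roundings: [x <= 2 X], and [X / m] is at most twice its integer part. *)
have hS2 : x / (4 * m%:R) <= C * ln x * S.
  apply: (@le_trans _ _ (X %/ m)%:R).
    have := natdiv_ge R X m0; have : 1 <= (X %/ m)%:R :> R by rewrite ler1n.
    rewrite ler_pdivrMr ?mulr_gt0// ler_pdivrMr//; nra.
  apply: (le_trans hS); rewrite ler_wpM2r// ler_wpM2l ?(ltW C0)//.
  rewrite ler_ln ?posrE ?ltr0n//; apply: le_trans Xx; rewrite ler_nat leq_div//.
have -> : y / (4 * C) * (x / ln x * (W * G m / m%:R)) =
   y * (W * G m) * (x / (4 * m%:R) / (C * ln x)).
  by field; rewrite !gt_eqF.
apply: ler_wpM2l.
  by apply: mulr_ge0; [exact: ltW | apply: mulr_ge0].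
by rewrite ler_pdivrMr ?mulr_gt0// [leRHS]mulrC.
Qed.

End Reduction.

(** * The three lower bounds *)

Section LowerBounds.
Variables (R : realType) (q r : nat) (chi : nat -> R[i]).
Hypothesis chi_char : dirichlet_character q chi.
Hypothesis nonpr : ~ (chi =1 principal_character R q).
Hypothesis chi_order : character_order q chi r.
Variables (y t : R).
Hypotheses (y_gt0 : 0 < y) (t_ge1 : 1 <= t).
Implicit Types (m n p k N : nat) (x V : R).

Let chi_le1 := character_norm_le1 chi_order.
Let t_gt0 : 0 < t. Proof. exact: lt_le_trans t_ge1. Qed.
Let t_ge0 : 0 <= t. Proof. exact: ltW. Qed.

Lemma prod_primes_const (a : R) m : \prod_(p <- primes m) a = a ^+ omega m.
Proof. by rewrite big_const_seq count_predT iter_mulr_1. Qed.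

Lemma powR_prod (I : Type) (s : seq I) (F : I -> R) (a : R) :
  (forall i, 0 <= F i) -> \prod_(i <- s) F i `^ a = (\prod_(i <- s) F i) `^ a.
Proof.
move=> F0; elim: s => [|i s IH]; first by rewrite !big_nil powR1.
by rewrite !big_cons IH powRM// prodr_ge0.
Qed.

Lemma powRXn (a b : R) n : 0 <= a -> (a ^+ n) `^ b = (a `^ b) ^+ n.
Proof.
move=> a0; elim: n => [|n IH]; first by rewrite !expr0 powR1.
by rewrite !exprS powRM ?exprn_ge0// IH.
Qed.

(** Below [s] the left side is nonpositive; above it, [t >= 1] gives [a ^ (t - 1) >= s ^ (t - 1)].
    The minorant is affine in [a], so summing it needs only the weighted sums of [a] and of [1]. *)
Lemma powR_tangent (a s : R) : 0 <= a -> 0 < s -> s `^ (t - 1) * (a - s) <= a `^ t.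
Proof.
move=> a0 s0; have p0 := powR_ge0 s (t - 1).
have [as_|sa] := leP a s.
  by apply: le_trans (powR_ge0 _ _); rewrite mulr_ge0_le0// subr_le0.
rewrite -[leRHS]mulr_powRB1//; apply: (@le_trans _ _ (s `^ (t - 1) * a)).
  by rewrite ler_wpM2l// gerBl ltW.
rewrite mulrC ler_wpM2l//; apply: ge0_ler_powR; rewrite ?nnegrE ?subr_ge0// ltW//.
Qed.

Lemma exists_nat_root4 x : 1 <= x -> exists N, (N ^ 4 <= Num.truncn x < N.+1 ^ 4)%N.
Proof.
move=> x1; have X0 : (0 < Num.truncn x)%N.
  by rewrite truncn_ge_nat//; exact: le_trans ler01 x1.
by have [N _ h] := nat_root (isT : (0 < 4)%N) X0; exists N.
Qed.

Lemma ln_le_of_root4 x N m : 1 <= x -> (N ^ 4 <= Num.truncn x)%N -> (0 < m <= N)%N ->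
  ln m%:R <= ln x.
Proof.
move=> x1 NX /andP[m0 mN]; have x0 : 0 < x by apply: lt_le_trans x1.
rewrite ler_ln ?posrE ?ltr0n//.
apply: (@le_trans _ _ (Num.truncn x)%:R); last by rewrite truncn_le// ltW.
rewrite ler_nat (leq_trans mN)// (leq_trans _ NX)//.
by rewrite -{1}(expn1 N) leq_pexp2l// (leq_trans m0).
Qed.

Lemma ln_powR_shift (L a b : R) : 0 < L -> L `^ a / L `^ b = L `^ (a - b).
Proof. by move=> L0; rewrite powRB// (gt_eqF L0) implybT. Qed.

Lemma moment_lb1 : exists2 c : R, 0 < c & exists x0 : R, forall x V, x0 <= x -> 1 <= V ->
  c * (x * ln x `^ (y - 1)) <=
  \sum_(1 <= n < (Num.truncn x).+1) moment_term chi y t V n.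
Proof.
have [c1 c10 [x1 H1]] := moment_reduction chi t y_gt0.
have [C HC] := mertens2_lb R.
have [c2 c20 [x2 H2]] := sqfree_scale_lb y (y * C) (ltW y_gt0).
exists (c1 * c2); first by rewrite mulr_gt0.
exists (Num.max (Num.max x1 x2) (expR 1)) => x V.
rewrite !ge_max => /andP[/andP[x1x x2x] ex] V1.
have x_ge1 : 1 <= x by apply: le_trans ex; rewrite (le_trans _ (expR_ge1Dx _))// lerDl.
have x0 : 0 < x by apply: lt_le_trans x_ge1.
have L1 : 1 <= ln x by rewrite -[1]expRK ler_ln ?posrE ?expR_gt0.
have L0 : 0 < ln x by apply: lt_le_trans L1.
have [N NX] := exists_nat_root4 x_ge1.
apply: le_trans (H1 x V N (fun=> 1) x1x NX _ _) => //; last first.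
  move=> m p pp mp _; have d1 := DeltaV_mulprime_ge1 chi_le1 (character1 chi_char) pp mp V1.
  by rewrite -[leLHS](powRr0 (DeltaV V (m * p) chi)); apply: ler_powR; rewrite // mulr_ge0.
have -> : \sum_(1 <= m < N.+1) (mobius m)%:~R ^+ 2 * y ^+ omega m * 1 / m%:R =
   \sum_(1 <= m < N.+1) sqfree_weight (fun=> y) m.
  by apply: eq_bigr => m _; rewrite mulr1 /sqfree_weight prod_primes_const.
rewrite -mulrA ler_pM2l//.
have h := H2 x N (fun=> y) x2x NX.
apply: (@le_trans _ _ (x / ln x * (c2 * ln x `^ y))).
  rewrite -ln_powR_shift// powRr1 ?(ltW L0)// le_eqVlt; apply/orP; left; apply/eqP.
  by ring.
rewrite ler_wpM2l ?divr_ge0 ?(ltW x0) ?(ltW L0)//; apply: h.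
  by move=> p _; rewrite (ltW y_gt0) lexx.
by move=> w w1; rewrite -mulr_sumr -mulrBr ler_wpM2l ?(ltW y_gt0) ?HC.
Qed.

Lemma powR_le_DeltaV (a : R) V n : 0 <= a -> a <= DeltaV V n chi ^+ 2 -> 0 <= DeltaV V n chi ->
  a `^ t <= DeltaV V n chi `^ (2 * t).
Proof.
move=> a0 aD D0; rewrite powRrM -[2]/(2%:R) powR_mulrn//.
by apply: ge0_ler_powR; rewrite ?nnegrE// exprn_ge0.
Qed.

(** The circumference of the Fourier circle in units of [U]. One successor rounds [ln x / U] up, the
    other is the spare window that prevents wrapping. *)
Definition sieve_length x V : nat := (Num.truncn (ln x / Num.min V (ln x))).+2.

Lemma sieve_length_ub x V : 1 <= V -> 0 < ln x ->
  (sieve_length x V)%:R <= 3 * (ln x / Num.min V (ln x)).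
Proof.
move=> V1 L0; set U := Num.min V (ln x).
have U0 : 0 < U by rewrite lt_min L0 (lt_le_trans _ V1).
have LU : 1 <= ln x / U by rewrite ler_pdivlMr// mul1r ge_min lexx orbT.
have : (Num.truncn (ln x / U))%:R <= ln x / U by rewrite truncn_le// (le_trans _ LU).
by rewrite /sieve_length -/U -!natr1; lra.
Qed.

Lemma sieve_lb x V m p k : 1 <= V -> 0 < ln x -> prime p -> (0 < m < p)%N -> ln m%:R <= ln x ->
  (16 * k <= sieve_length x V + 16)%N ->
  \sum_(j < k) cnorm (tau chi (2 * pi * j%:R /
      ((sieve_length x V)%:R * Num.min V (ln x))) m) ^+ 2
  <= 4 * (sieve_length x V)%:R ^+ 2 * DeltaV V (m * p) chi ^+ 2.
Proof.
move=> V1 L0 pp mp mx kN; have /andP[m0 _] := mp.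
set U := Num.min V (ln x).
have U0 : 0 < U by rewrite lt_min L0 (lt_le_trans _ V1).
apply: large_sieve => //.
  by move=> u; apply: Delta_mulprime_le => //; rewrite (ltW U0) ge_min lexx.
apply: (le_trans mx); rewrite -ler_pdivrMr// lerBrDr /sieve_length -/U -natr1 lerD2r.
exact/ltW/truncnS_gt.
Qed.

Lemma DeltaV_mulprime_ge0 V m p : 1 <= V -> prime p -> (0 < m < p)%N ->
  0 <= DeltaV V (m * p) chi.
Proof.
move=> V1 pp mp; apply: le_trans ler01 _.
exact: (DeltaV_mulprime_ge1 chi_le1 (character1 chi_char) pp mp V1).
Qed.

Lemma moment_lb3 : exists2 c : R, 0 < c & exists x0 : R, forall x V, x0 <= x -> 1 <= V ->
  c * (x * (ln x `^ (2 `^ (2 * t) * y / r%:R - 2 * t - 1) * Num.min V (ln x) `^ (2 * t))) <=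
  \sum_(1 <= n < (Num.truncn x).+1) moment_term chi y t V n.
Proof.
have r0 : 0 < r%:R :> R by rewrite ltr0n; case: chi_order.
have [c1 c10 [x1 H1]] := moment_reduction chi t y_gt0.
have [C1 HC1] := mertens2_lb R.
have [C2 HC2] := prime_sum_character_eq1 chi_char chi_order.
pose kappa := 2 `^ (2 * t) * y / r%:R.
have p4 : 0 < 2 `^ (2 * t) :> R by rewrite powR_gt0.
have kappa0 : 0 <= kappa by rewrite !mulr_ge0 ?powR_ge0 ?invr_ge0 ?(ltW y_gt0) ?(ltW r0).
have [c2 c20 [x2 H2]] := sqfree_scale_lb (y * 2 `^ (2 * t))
   (y * 2 `^ (2 * t) * (C1 / r%:R + C2)) kappa0.
exists (c1 * c2 * 6^-1 `^ (2 * t)); first by rewrite !mulr_gt0 ?powR_gt0 ?invr_gt0.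
exists (Num.max (Num.max x1 x2) (expR 1)) => x V.
rewrite !ge_max => /andP[/andP[x1x x2x] ex] V1.
have x_ge1 : 1 <= x by apply: le_trans ex; rewrite (le_trans _ (expR_ge1Dx _))// lerDl.
have x0 : 0 < x by apply: lt_le_trans x_ge1.
have L1 : 1 <= ln x by rewrite -[1]expRK ler_ln ?posrE ?expR_gt0.
have L0 : 0 < ln x by apply: lt_le_trans L1.
have [N NX] := exists_nat_root4 x_ge1.
set U := Num.min V (ln x).
have U0 : 0 < U by rewrite lt_min L0 (lt_le_trans _ V1).
set N' := sieve_length x V.
have N'0 : 0 < N'%:R :> R by rewrite ltr0n.
have N'U : N'%:R <= 3 * (ln x / U) by exact: sieve_length_ub.
(* [6 = 2 * 3]: the [2] is the root of the [4] in the large sieve, and the [3] comes from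
   [N' <= 3 ln x / U]. *)
pose b := (6^-1 * (U / ln x)) ^+ 2.
have b0 : 0 <= b by rewrite sqr_ge0.
have bN : b * (4 * N'%:R ^+ 2) <= 1.
  have -> : b * (4 * N'%:R ^+ 2) = (6^-1 * (U / ln x) * 2 * N'%:R) ^+ 2 by rewrite /b; ring.
  have h0 : 0 <= 6^-1 * (U / ln x) * 2 by rewrite !mulr_ge0 ?invr_ge0 ?(ltW U0) ?(ltW L0).
  apply: exprn_ile1; first by rewrite mulr_ge0.
  apply: (le_trans (ler_wpM2l h0 N'U)).
  rewrite le_eqVlt; apply/orP; left; apply/eqP; field; rewrite !gt_eqF//.
pose h p := y * (cnorm (1 + twist chi 0 p) ^+ 2) `^ t.
pose G m := (cnorm (tau chi 0 m) ^+ 2 * b) `^ t.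
apply: le_trans (H1 x V N G x1x NX _ _); last first.
- move=> m p pp mp mN; have /andP[m0 _] := mp.
  have D0 := DeltaV_mulprime_ge0 V1 pp mp.
  apply: powR_le_DeltaV => //; first by rewrite mulr_ge0 ?sqr_ge0.
  have mx : ln m%:R <= ln x.
    by case/andP: NX => NX _; apply: (ln_le_of_root4 x_ge1 NX); rewrite m0.
  have := @sieve_lb x V m p 1 V1 L0 pp mp mx (leq_addl _ _).
  rewrite big_ord1 mulr0 mul0r -/N' => hs.
  have := ler_wpM2r b0 hs => hb; apply: (le_trans hb).
  by rewrite mulrAC ler_piMl ?sqr_ge0// mulrC.
- by move=> m; exact: powR_ge0.
have hE m : (mobius m)%:~R ^+ 2 * y ^+ omega m * G m / m%:R = b `^ t * sqfree_weight h m.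
  rewrite /sqfree_weight /G powRM ?sqr_ge0//.
  have [->|mu] := eqVneq (mobius m) 0; first by rewrite expr0n !mul0r mulr0.
  have m0 : (0 < m)%N by case: m mu.
  have := tau_sqfree 0 1 chi_char m0 mu; rewrite expr1n mul1r => <-.
  under eq_bigr do rewrite mul1r.
  have -> : \prod_(p <- primes m) h p =
      y ^+ omega m * (\prod_(p <- primes m) cnorm (1 + twist chi 0 p) ^+ 2) `^ t.
    rewrite -powR_prod; last by move=> p; exact: sqr_ge0.
    by rewrite -(prod_primes_const y m) -big_split.
  ring.
under eq_bigr => m _ do rewrite hE.
rewrite -mulr_sumr.
have hw := H2 x N h x2x NX.
apply: (@le_trans _ _ (c1 * (x / ln x * (b `^ t * (c2 * ln x `^ kappa))))); last first.
  rewrite ler_pM2l// ler_wpM2l ?divr_ge0 ?(ltW x0) ?(ltW L0)// ler_wpM2l ?powR_ge0//.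
  apply: hw => [p pp|w w1].
    rewrite /h mulr_ge0 ?powR_ge0 ?(ltW y_gt0)//= ler_wpM2l ?(ltW y_gt0)//.
    rewrite powRrM; apply: ge0_ler_powR; rewrite ?nnegrE ?sqr_ge0 ?powR_ge0//.
    rewrite -[X in _ `^ X]/(2%:R) powR_mulrn// ler_pXn2r ?nnegrE ?cnorm_ge0//.
    apply: (le_trans (cnormD _ _)); rewrite cnorm1.
    have := twist_norm_le1 0 chi_le1 p; lra.
  (* Primes with [chi p != 1] are dropped, since [h] is nonnegative there; at the others
     [h p = y * 2 ^ (2 t)], and they make up a proportion [1 / r] of the sum of [1 / p]. *)
  apply: (@le_trans _ _ (y * 2 `^ (2 * t) * \sum_(1 <= p < w.+1 | prime p) (chi p == 1)%:R / p%:R)).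
    have -> : kappa * ln (ln w%:R) - y * 2 `^ (2 * t) * (C1 / r%:R + C2) =
       y * 2 `^ (2 * t) * ((ln (ln w%:R) - C1) / r%:R - C2).
      by rewrite /kappa; ring.
    rewrite ler_wpM2l ?mulr_ge0 ?powR_ge0 ?(ltW y_gt0)//.
    apply: le_trans (HC2 w); rewrite lerD2r ler_wpM2r ?invr_ge0 ?(ltW r0)//.
    exact: HC1.
  rewrite mulr_sumr; apply: ler_sum => p pp; rewrite mulrA ler_wpM2r ?invr_ge0//.
  rewrite /h twist0; case: eqP => [->|_]; last first.
    by rewrite mulr0n mulr0 mulr_ge0 ?powR_ge0 ?(ltW y_gt0).
  rewrite mulr1n mulr1 -[1 + 1]/(2%:R) cnorm_nat [X in _ <= _ * X `^ _](_ : _ = 2 `^ 2).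
    by rewrite -powRrM.
  by rewrite -[X in _ `^ X]/(2%:R) powR_mulrn.
rewrite -/kappa /b powRXn; last by rewrite !mulr_ge0 ?invr_ge0 ?(ltW U0) ?(ltW L0).
have i6 : 0 <= 6^-1 :> R by rewrite invr_ge0.
have UL : 0 <= U / ln x by rewrite divr_ge0 ?(ltW U0) ?(ltW L0).
rewrite -[_ ^+ 2]powR_mulrn ?powR_ge0// -powRrM [t * _]mulrC.
rewrite powRM// powRM ?invr_ge0 ?(ltW U0) ?(ltW L0)//.
rewrite -ln_powR_shift// -ln_powR_shift// powRr1 ?(ltW L0)//.
have -> : (ln x)^-1 `^ (2 * t) = (ln x `^ (2 * t))^-1.
  by rewrite -powRN -powR_inv1 ?(ltW L0)// -powRrM mulN1r.
rewrite le_eqVlt; apply/orP; left; apply/eqP; ring.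
Qed.

(** For every frequency the weight [h k] has total at least [c2 * ln x ^ la], while [la ^ omega] has
    total at most [C4 * ln x ^ la]. The equality of the two exponents is what makes the linear
    minorant effective. *)
Lemma moment_lb2 : exists2 c : R, 0 < c & exists x0 : R, forall x V, x0 <= x -> 1 <= V ->
  c * (x * (ln x `^ (2 `^ t * y - t - 1) * Num.min V (ln x) `^ t)) <=
  \sum_(1 <= n < (Num.truncn x).+1) moment_term chi y t V n.
Proof.
have [c1 c10 [x1 H1]] := moment_reduction chi t y_gt0.
have [C1 HC1] := mertens2_lb R.
have [C2 HC2] := mertens2_ub R.
have [xi0 /andP[xi00 xi01] [C3 HC3]] := twisted_prime_sum chi_char chi_le1 nonpr.
have q_gt0 : (0 < q)%N by case: chi_char.
pose la := 2 `^ t * y.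
have la0 : 0 < la by rewrite mulr_gt0 ?powR_gt0.
have [c2 c20 [x2 H2]] := sqfree_scale_lb (2 * la) (la * C1 + la * C3 + la / 2 * q%:R) (ltW la0).
pose C4 := expR (la * C2).
have C40 : 0 < C4 by rewrite expR_gt0.
(* At this threshold the subtracted term is at most half of the lower bound [c2 * ln x ^ la]. *)
pose s := c2 / (2 * C4).
have s0 : 0 < s by rewrite divr_gt0 ?mulr_gt0.
(* Keeping [k <= N' / B] makes the frequencies at most [2 pi / B <= 8 / B], as [U >= 1]. So
   [B >= 16 / xi0] puts them in the range of [twisted_prime_sum], and [xi0 <= 1] then gives the
   [B >= 16] behind [16 * K <= N' + 16]. *)
pose B := (Num.truncn (16 / xi0)).+1.
have B0 : 0 < B%:R :> R by rewrite ltr0n.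
have B_ub : 8 / B%:R <= xi0.
  have : 16 / xi0 <= B%:R by apply/ltW/truncnS_gt.
  rewrite ler_pdivrMr// => h; rewrite ler_pdivrMr//; lra.
have B16 : (16 <= B)%N.
  rewrite -(ler_nat R); apply: (@le_trans _ _ (16 / xi0)); last exact/ltW/truncnS_gt.
  by rewrite ler_pdivlMr// ler_piMr.
exists (c1 * (12 * B%:R)^-1 `^ t * s `^ (t - 1) * (c2 / 2)).
  have d0 : 0 < (12 * B%:R)^-1 :> R by rewrite invr_gt0 mulr_gt0.
  have p1 := powR_gt0 t d0; have p2 := powR_gt0 (t - 1) s0.
  have c2' : 0 < c2 / 2 by rewrite divr_gt0.
  exact: mulr_gt0 (mulr_gt0 (mulr_gt0 c10 p1) p2) c2'.
exists (Num.max (Num.max x1 x2) (Num.max (expR 1) 16)) => x V.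
rewrite !ge_max => /andP[/andP[x1x x2x] /andP[ex x16]] V1.
have x_ge1 : 1 <= x by apply: le_trans ex; rewrite (le_trans _ (expR_ge1Dx _))// lerDl.
have x0 : 0 < x by apply: lt_le_trans x_ge1.
have L1 : 1 <= ln x by rewrite -[1]expRK ler_ln ?posrE ?expR_gt0.
have L0 : 0 < ln x by apply: lt_le_trans L1.
have [N NX] := exists_nat_root4 x_ge1.
have N1 : (1 < N)%N.
  have : (2 ^ 4 <= Num.truncn x)%N by rewrite truncn_ge_nat// ltW.
  case/andP: NX => _ XN /leq_ltn_trans /(_ XN); rewrite ltn_exp2r//.
set U := Num.min V (ln x).
have U0 : 0 < U by rewrite lt_min L0 (lt_le_trans _ V1).
have U1 : 1 <= U by rewrite le_min V1.
set N' := sieve_length x V.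
have N'0 : 0 < N'%:R :> R by rewrite ltr0n.
have N'U : N'%:R <= 3 * (ln x / U) by exact: sieve_length_ub.
pose K := (N' %/ B).+1.
have K0 : 0 < K%:R :> R by rewrite ltr0n.
have KN : (16 * K <= N' + 16)%N.
  rewrite mulnS addnC leq_add2r (leq_trans _ (leq_trunc_div N' B))//.
  by rewrite mulnC leq_mul2l B16 orbT.
have NK : N'%:R <= B%:R * K%:R :> R.
  have := @natdiv_ge R N' B isT; rewrite ler_pdivrMr// natr1 mulrC //.
pose xi (k : nat) : R := 2 * pi * k%:R / (N'%:R * U).
have xi_le (k : 'I_K) : `|xi k| <= xi0.
  have p0 := pi_gt0 R.
  rewrite /xi ger0_norm; last by rewrite !mulr_ge0 ?invr_ge0 ?mulr_ge0 ?(ltW p0) ?(ltW N'0) ?(ltW U0).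
  apply: le_trans B_ub; rewrite ler_pdivrMr ?mulr_gt0//.
  have kN : k%:R * B%:R <= N'%:R :> R.
    rewrite -natrM ler_nat (leq_trans _ (leq_trunc_div N' B))// leq_mul2r.
    by rewrite -ltnS ltn_ord orbT.
  have p4 : 2 * pi <= 8 :> R by have := pihalf_lt2 R; lra.
  apply: (@le_trans _ _ (8 * k%:R)); first by rewrite ler_wpM2r.
  rewrite -mulrA ler_pM2l// ler_pdivlMl// mulrC; apply: (le_trans kN).
  by rewrite ler_peMr// ltW.
pose Q m := \sum_(k < K) cnorm (tau chi (xi k) m) ^+ 2.
have Q0 m : 0 <= Q m by rewrite sumr_ge0// => k _; exact: sqr_ge0.
(* Only one factor [U / ln x] is lost: of the two factors [N'] in the large sieve, one is at most
   [3 ln x / U] and the other at most [B * K], which is compensated by averaging over [K]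
   frequencies. *)
pose b := (12 * B%:R)^-1 * (U / ln x).
have b0 : 0 < b by rewrite mulr_gt0 ?invr_gt0 ?divr_gt0 ?mulr_gt0.
have bN : b * (4 * N'%:R ^+ 2) <= K%:R.
  have h1 : N'%:R * (U / ln x) <= 3.
    have := ler_wpM2r (ltW (divr_gt0 U0 L0)) N'U => h; apply: (le_trans h).
    by rewrite le_eqVlt; apply/orP; left; apply/eqP; field; rewrite !gt_eqF.
  have -> : b * (4 * N'%:R ^+ 2) = N'%:R * (U / ln x) * N'%:R * (3 * B%:R)^-1.
    by rewrite /b; field; rewrite !gt_eqF.
  rewrite ler_pdivrMr ?mulr_gt0//.
  apply: (@le_trans _ _ (3 * (B%:R * K%:R))); last first.
    by rewrite le_eqVlt; apply/orP; left; apply/eqP; ring.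
  apply: ler_pM => //; first by rewrite !mulr_ge0 ?invr_ge0 ?(ltW N'0) ?(ltW U0) ?(ltW L0).
pose G m := (b * (Q m / K%:R)) `^ t.
apply: le_trans (H1 x V N G x1x NX _ _); last first.
- move=> m p pp mp mN; have /andP[m0 _] := mp.
  have D0 := DeltaV_mulprime_ge0 V1 pp mp.
  apply: powR_le_DeltaV => //; first by rewrite mulr_ge0 ?(ltW b0)// divr_ge0 ?(ltW K0).
  have mx : ln m%:R <= ln x.
    by case/andP: NX => NX _; apply: (ln_le_of_root4 x_ge1 NX); rewrite m0.
  have := @sieve_lb x V m p K V1 L0 pp mp mx KN; rewrite -/N' -/U -/(Q m) => hs.
  rewrite mulrA ler_pdivrMr//.
  apply: (le_trans (ler_wpM2l (ltW b0) hs)); rewrite mulrA mulrC.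
  by rewrite ler_wpM2l ?sqr_ge0.
- by move=> m; exact: powR_ge0.
pose h (k : nat) p := la / 2 * cnorm (1 + twist chi (xi k) p) ^+ 2.
have Gm m : (0 < m)%N -> b `^ t * s `^ (t - 1) *
    (K%:R^-1 * \sum_(k < K) sqfree_weight (h k) m - s * sqfree_weight (fun=> la) m) <=
    (mobius m)%:~R ^+ 2 * y ^+ omega m * G m / m%:R.
  move=> m0; have [mu|mu] := eqVneq (mobius m) 0.
    rewrite /sqfree_weight mu expr0n !mul0r.
    rewrite big1 ?mulr0 ?subrr ?mulr0// => k _; by rewrite !mul0r.
  (* Dividing by [2 ^ omega m] matches the factor [1 / 2] per prime in [h], and moves
     [(2 ^ t) ^ omega m] into the weight [la ^ omega m]. *)
  pose a := Q m / (2 ^+ omega m * K%:R).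
  have w0 : 0 < 2 ^+ omega m :> R by rewrite exprn_gt0.
  have a0 : 0 <= a by rewrite divr_ge0 ?mulr_ge0 ?(ltW K0) ?(ltW w0).
  have GE : G m = b `^ t * ((2 `^ t) ^+ omega m * a `^ t).
    rewrite /G powRM ?(ltW b0) ?divr_ge0 ?(ltW K0)//; congr (_ * _).
    rewrite -powRXn// -powRM ?(ltW w0)//; congr (_ `^ _).
    by rewrite /a; field; rewrite !gt_eqF.
  rewrite GE.
  have hk (k : 'I_K) : sqfree_weight (h k) m =
     (mobius m)%:~R ^+ 2 * ((la / 2) ^+ omega m * cnorm (tau chi (xi k) m) ^+ 2) / m%:R.
    by rewrite /sqfree_weight -(tau_sqfree _ _ chi_char).
  under eq_bigr => k _ do rewrite hk.
  rewrite -mulr_suml -mulr_sumr -mulr_sumr -/(Q m).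
  have mu0 : 0 <= (mobius m)%:~R ^+ 2 / m%:R :> R by rewrite divr_ge0 ?sqr_ge0.
  have -> : K%:R^-1 * ((mobius m)%:~R ^+ 2 * ((la / 2) ^+ omega m * Q m) / m%:R) -
     s * sqfree_weight (fun=> la) m =
     (mobius m)%:~R ^+ 2 / m%:R * la ^+ omega m * (a - s).
    rewrite /sqfree_weight prod_primes_const /a expr_div_n.
    have m0' : m%:R != 0 :> R by rewrite pnatr_eq0 -lt0n.
    by field; rewrite m0' !gt_eqF.
  have -> : (mobius m)%:~R ^+ 2 * y ^+ omega m * (b `^ t * ((2 `^ t) ^+ omega m * a `^ t)) / m%:R =
     b `^ t * ((mobius m)%:~R ^+ 2 / m%:R * la ^+ omega m) * a `^ t.
    by rewrite /la exprMn; ring.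
  have -> : b `^ t * s `^ (t - 1) * ((mobius m)%:~R ^+ 2 / m%:R * la ^+ omega m * (a - s)) =
     b `^ t * ((mobius m)%:~R ^+ 2 / m%:R * la ^+ omega m) * (s `^ (t - 1) * (a - s)) by ring.
  apply: ler_wpM2l; last exact: powR_tangent.
  by rewrite mulr_ge0 ?powR_ge0// mulr_ge0// exprn_ge0// ltW.
apply: (@le_trans _ _ (c1 * (x / ln x * \sum_(1 <= m < N.+1) b `^ t * s `^ (t - 1) *
    (K%:R^-1 * \sum_(k < K) sqfree_weight (h k) m - s * sqfree_weight (fun=> la) m)))); last first.
  rewrite ler_pM2l// ler_wpM2l ?divr_ge0 ?(ltW x0) ?(ltW L0)//.
  by apply: ler_sum_nat => m /andP[m0 _]; exact: Gm.
rewrite -mulr_sumr sumrB -!mulr_sumr exchange_big /=.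
have hlow (k : 'I_K) : c2 * ln x `^ la <= \sum_(1 <= m < N.+1) sqfree_weight (h k) m.
  have c_le p := twist_norm_le1 (xi k) chi_le1 p.
  apply: (H2 x N (h k) x2x NX) => [p pp|w w1].
    rewrite /h mulr_ge0 ?sqr_ge0 ?divr_ge0 ?(ltW la0)//=.
    have : cnorm (1 + twist chi (xi k) p) ^+ 2 <= 2 ^+ 2.
      rewrite ler_pXn2r ?nnegrE ?cnorm_ge0//.
      by apply: (le_trans (cnormD _ _)); rewrite cnorm1; have := c_le p; lra.
    move: (cnorm _ ^+ 2) la0 => z la0 hz; nra.
  (* If [|z| = 1] then [|1 + z| ^ 2 = 2 + 2 Re z]; the last term corrects the primes dividing [q],
     where [z = 0]. *)
  have hp p : prime p -> la + la * cre (twist chi (xi k) p) - la / 2 * (~~ coprime p q)%:R <= h k p.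
    move=> pp; have : cnorm (1 + twist chi (xi k) p) ^+ 2 =
       1 + 2 * cre (twist chi (xi k) p) + cnorm (twist chi (xi k) p) ^+ 2.
      by rewrite !cnorm_sqr; case: (twist _ _ _) => u v /=; rewrite add0r; ring.
    rewrite /h => ->; rewrite /twist cnormM cnorm_cis mulr1 (character_norm chi_order) -/(twist chi (xi k) p).
    move: (cre _) => z; case: (coprime p q) => /=; rewrite ?expr1n ?expr0n /=; lra.
  apply: (@le_trans _ _ (\sum_(1 <= p < w.+1 | prime p)
      (la + la * cre (twist chi (xi k) p) - la / 2 * (~~ coprime p q)%:R) / p%:R)); last first.
    by apply: ler_sum => p pp; rewrite ler_wpM2r ?invr_ge0 ?hp.
  have -> : \sum_(1 <= p < w.+1 | prime p)
      (la + la * cre (twist chi (xi k) p) - la / 2 * (~~ coprime p q)%:R) / p%:R =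
     la * (\sum_(1 <= p < w.+1 | prime p) p%:R^-1) +
     la * (\sum_(1 <= p < w.+1 | prime p) cre (twist chi (xi k) p) / p%:R) -
     la / 2 * (\sum_(1 <= p < w.+1 | prime p) (~~ coprime p q)%:R / p%:R).
    by rewrite !mulr_sumr -big_split -sumrB /=; apply: eq_bigr => p _; ring.
  have h1 := HC1 w w1; have h2 := HC3 _ (xi_le k) w; have h3 := sum_prime_divisors_le R w q_gt0.
  rewrite ler_norml in h2; case/andP: h2 => h2 _.
  have aux (S1 S2 S3 l : R) : l - C1 <= S1 -> - C3 <= S2 -> S3 <= q%:R ->
      la * l - (la * C1 + la * C3 + la / 2 * q%:R) <= la * S1 + la * S2 - la / 2 * S3.
    move=> h4 h5 h6; have := ler_wpM2l (ltW la0) h4; have := ler_wpM2l (ltW la0) h5.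
    have := ler_wpM2l (ltW la0) h6; lra.
  exact: aux.
have lowK : c2 * ln x `^ la <= K%:R^-1 * \sum_(k < K) \sum_(1 <= m < N.+1) sqfree_weight (h k) m.
  rewrite ler_pdivlMl//.
  apply: (@le_trans _ _ (\sum_(k < K) c2 * ln x `^ la)); last exact: ler_sum.
  by rewrite sumr_const card_ord mulr_natl.
have up : \sum_(1 <= m < N.+1) sqfree_weight (fun=> la) m <= C4 * ln x `^ la.
  apply: (le_trans (sqfree_sum_ub N (fun p _ => ltW la0))).
  rewrite -mulr_sumr; apply: (@le_trans _ _ (expR (la * (ln (ln N%:R) + C2)))).
    by rewrite ler_expR ler_wpM2l ?(ltW la0) ?HC2.
  rewrite mulrDr expRD mulrC ler_pM2l//.
  have lN := ln_nat_gt0 R N1.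
  have -> : expR (la * ln (ln N%:R)) = ln N%:R `^ la by rewrite /powR gt_eqF.
  apply: ge0_ler_powR; rewrite ?nnegrE ?(ltW la0) ?(ltW lN) ?(ltW L0)//.
  by case/andP: NX => NX _; apply: (ln_le_of_root4 x_ge1 NX); rewrite leqnn ltnW.
have diff : c2 / 2 * ln x `^ la <= K%:R^-1 * \sum_(k < K) \sum_(1 <= m < N.+1) sqfree_weight (h k) m -
    s * \sum_(1 <= m < N.+1) sqfree_weight (fun=> la) m.
  have := ler_wpM2l (ltW s0) up.
  have -> : s * (C4 * ln x `^ la) = c2 / 2 * ln x `^ la.
    by rewrite /s; field; rewrite gt_eqF.
  move: lowK; lra.
apply: (@le_trans _ _ (c1 * (x / ln x * (b `^ t * s `^ (t - 1) * (c2 / 2 * ln x `^ la))))); last first.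
  rewrite ler_pM2l// ler_wpM2l ?divr_ge0 ?(ltW x0) ?(ltW L0)// ler_wpM2l//.
  by rewrite mulr_ge0 ?powR_ge0.
have iB : 0 <= (12 * B%:R)^-1 :> R by rewrite invr_ge0 mulr_ge0.
have UL : 0 <= U / ln x by rewrite divr_ge0 ?(ltW U0) ?(ltW L0).
have iL : 0 <= (ln x)^-1 by rewrite invr_ge0 ltW.
rewrite /b (powRM _ iB UL) (powRM _ (ltW U0) iL).
rewrite -/la -!(ln_powR_shift _ _ L0) powRr1 ?(ltW L0)//.
have -> : (ln x)^-1 `^ t = (ln x `^ t)^-1.
  by rewrite -powRN -powR_inv1 ?(ltW L0)// -powRrM mulN1r.
rewrite le_eqVlt; apply/orP; left; apply/eqP; ring.
Qed.

End LowerBounds.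

Theorem theorem2 (R : realType) (q r : nat) (chi : nat -> R[i])
    (chi_char : dirichlet_character q chi)
    (chi_nonprincipal : ~ (chi =1 principal_character R q))
    (chi_order : character_order q chi r) (r_ge2 : (2 <= r)%N)
    (y : R) (y_gt0 : 0 < y) (t : R) (t_ge1 : 1 <= t) :
  exists c : R, 0 < c /\
    \forall x \near +oo, forall V : R, 1 <= V ->
      let U := Num.min V (ln x) in
      c * (x * ((ln x) `^ (y - 1)
              + (ln x) `^ (2 `^ t * y - t - 1) * U `^ t
              + (ln x) `^ (2 `^ (2 * t) * y / r%:R - 2 * t - 1) * U `^ (2 * t)))
      <= \sum_(1 <= n < (Num.truncn x).+1)
           (mobius n)%:~R ^+ 2 * y ^+ omega n * DeltaV V n chi `^ (2 * t).
Proof.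
have [c1 c10 [x1 H1]] := moment_lb1 chi_char chi_order y_gt0 t_ge1.
have [c2 c20 [x2 H2]] := moment_lb2 chi_char chi_nonprincipal chi_order y_gt0 t_ge1.
have [c3 c30 [x3 H3]] := moment_lb3 chi_char chi_order y_gt0 t_ge1.
pose c := Num.min c1 (Num.min c2 c3).
have c0 : 0 < c by rewrite !lt_min c10 c20.
exists (c / 3); split; first by rewrite divr_gt0.
exists (Num.max 0 (Num.max x1 (Num.max x2 x3))); split; first exact: num_real.
move=> x; rewrite !gt_max => /and4P[x0 /ltW x1x /ltW x2x /ltW x3x] V V1 /=.
have := H1 x V x1x V1; have := H2 x V x2x V1; have := H3 x V x3x V1.
rewrite /moment_term; move: (\sum_(_ <= _ < _) _) => S.
have U0 := powR_ge0 (Num.min V (ln x)).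
have L0 := powR_ge0 (ln x).
have := mulr_ge0 (ltW x0) (L0 (y - 1)).
have := mulr_ge0 (ltW x0) (mulr_ge0 (L0 (2 `^ t * y - t - 1)) (U0 t)).
have := mulr_ge0 (ltW x0) (mulr_ge0 (L0 (2 `^ (2 * t) * y / r%:R - 2 * t - 1)) (U0 (2 * t))).
rewrite !mulrDr.
have cc1 : c <= c1 by rewrite ge_min lexx.
have cc2 : c <= c2 by rewrite !ge_min lexx orbT.
have cc3 : c <= c3 by rewrite !ge_min lexx !orbT.
move: (x * _) (x * _) (x * _) => A1 A2 A3 a1 a2 a3 h1 h2 h3.
nra.
Qed.
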